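(* There exists a constant $\xi_0>0$, depending only on $(K_2,K_3,K_4,\gamma,\rho_0,U_{1,0},U_{2,0},S_0)$, such that for every $r_1\in\big(r_0,r_0(1+\xi_0)\big)$ the following holds. There exist constants $\sigma_1>0$ and $C_1>0$ such that for any $0<\sigma<\sigma_1$ and any $C^1$ functions $H_1,H_2,H_3,H_4$ on $\mathbb{R}_+$ satisfying $$H_i(t+T)=H_i(t)\ \ (t>0),\qquad \|H_i\|_{C^1(\mathbb{R}_+)}\le\sigma,\qquad i=1,2,3,4,$$ there exists a $C^1$ function $\Psi_0(r)=(\Psi_{1,0},\Psi_{2,0},\Psi_{3,0},\Psi_{4,0})^\top(r)$ on $[r_0,r_1]$ with $$\|\Psi_{i,0}\|_{C^1([r_0,r_1])}\le C_1\sigma,\qquad i=1,2,3,4,$$ such that the initial-boundary value problem consisting of the system (P), the boundary conditions (B) and the initial condition $\Psi(0,r)=\Psi_0(r)$ admits a $C^1$ time-periodic solution $\Psi^{(T)}(t,r)=(\Psi_1^{(T)},\Psi_2^{(T)},\Psi_3^{(T)},\Psi_4^{(T)})^\top$ on $D=\{(t,r): t\in\mathbb{R}_+,\ r\in[r_0,r_1]\}$ satisfying $$\Psi^{(T)}(t+T,r)=\Psi^{(T)}(t,r)\quad\forall (t,r)\in D,\qquad \|\Psi_i^{(T)}\|_{C^1(D)}\le C_1\sigma,\quad i=1,2,3,4.$$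
   Context: Background flow. Fix $\gamma>1$, $r_0>0$ and positive constants $\rho_0,U_{1,0},U_{2,0},S_0$ with $U_{1,0}^2+U_{2,0}^2<\gamma e^{S_0}\rho_0^{\gamma-1}$. It is known that the problem $$(\bar\rho\bar U_1)'+\frac{\bar\rho\bar U_1}{r}=0,\quad \bar U_1\bar U_1'+\frac{\bar P'}{\bar\rho}-\frac{\bar U_2^2}{r}=0,\quad \bar U_1\bar U_2'+\frac{\bar U_1\bar U_2}{r}=0,\quad \bar U_1\bar S'=0,\qquad \bar P=e^{\bar S}\bar\rho^{\gamma},$$ $(\bar\rho,\bar U_1,\bar U_2,\bar S)(r_0)=(\rho_0,U_{1,0},U_{2,0},S_0)$, has a unique smooth solution on $[r_0,+\infty)$ with $\bar U_1^2+\bar U_2^2<\bar c^2$ there, where $\bar c=\sqrt{\gamma e^{S_0}\bar\rho^{\gamma-1}}$ (and $\bar S\equiv S_0$). Put $\mathfrak c(r)=\frac{\bar c(r)}{\gamma(\gamma-1)}$ and $$\bar R_1=\bar U_1-\frac{2\bar c}{\gamma-1},\quad \bar R_2=\bar U_2,\quad \bar R_3=S_0,\quad \bar R_4=\bar U_1+\frac{2\bar c}{\gamma-1},\qquad \bar{\mathbf R}=(\bar R_1,\bar R_2,\bar R_3,\bar R_4)^\top.$$ Fix constants $K_2,K_3,K_4$ with $|K_i|<1$ and a period $T>0$. For $r_1>r_0$ the unknown is $\Psi=(\Psi_1,\Psi_2,\Psi_3,\Psi_4)^\top(t,r)$, $r\in[r_0,r_1]$, and $$\lambda_1(\Psi+\bar{\mathbf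 R})=\tfrac{\gamma+1}4(\Psi_1+\bar R_1-\mathfrak c\Psi_3)+\tfrac{3-\gamma}4(\Psi_4+\bar R_4+\mathfrak c\Psi_3),$$ $$\lambda_2(\Psi+\bar{\mathbf R})=\lambda_3(\Psi+\bar{\mathbf R})=\tfrac12(\Psi_1+\bar R_1+\Psi_4+\bar R_4),$$ $$\lambda_4(\Psi+\bar{\mathbf R})=\tfrac{3-\gamma}4(\Psi_1+\bar R_1-\mathfrak c\Psi_3)+\tfrac{\gamma+1}4(\Psi_4+\bar R_4+\mathfrak c\Psi_3);$$ write $\lambda_i=\lambda_i(\Psi+\bar{\mathbf R})$. System (P): $$\begin{aligned}\partial_t\Psi_1+\lambda_1\partial_r\Psi_1=&\Big(-\tfrac{\gamma+1}{4}\bar R_1'-\tfrac{\gamma-1}{4r}\bar R_1\Big)\Psi_1+\tfrac{2\bar R_2}{r}\Psi_2+\Big(-\tfrac{3-\gamma}{4}\bar R_1'+\tfrac{\gamma-1}{4r}\bar R_4\Big)\Psi_4+\tfrac{\Psi_2^2}{r}+\tfrac{\gamma-1}{8r}(\Psi_4^2-\Psi_1^2)\\&+\tfrac{(\gamma-1)\mathfrak c}{4r}\Psi_3(\Psi_1+\Psi_4)+\Big(\tfrac{\gamma-1}{2}\bar R_1'+\tfrac{\gamma-1}{4r}(\bar R_1+\bar R_4)\Big)\mathfrak c\Psi_3+\lambda_1\mathfrak c'\Psi_3\\&-\Big(\tfrac{\Psi_4-\Psi_1}{4\gamma}+\tfrac{(\gamma-1)\mathfrak c\Psi_3}{2}\Big)(\partial_t\Psi_3+\lambda_1\partial_r\Psi_3),\end{aligned}$$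 $$\partial_t\Psi_2+\lambda_2\partial_r\Psi_2=-\tfrac{\lambda_2}{r}\Psi_2,\qquad \partial_t\Psi_3+\lambda_3\partial_r\Psi_3=0,$$ $$\begin{aligned}\partial_t\Psi_4+\lambda_4\partial_r\Psi_4=&\Big(-\tfrac{3-\gamma}{4}\bar R_4'+\tfrac{\gamma-1}{4r}\bar R_1\Big)\Psi_1+\tfrac{2\bar R_2}{r}\Psi_2+\Big(-\tfrac{\gamma+1}{4}\bar R_4'-\tfrac{\gamma-1}{4r}\bar R_4\Big)\Psi_4+\tfrac{\Psi_2^2}{r}-\tfrac{\gamma-1}{8r}(\Psi_4^2-\Psi_1^2)\\&-\tfrac{(\gamma-1)\mathfrak c}{4r}\Psi_3(\Psi_1+\Psi_4)-\Big(\tfrac{\gamma-1}{2}\bar R_4'+\tfrac{\gamma-1}{4r}(\bar R_1+\bar R_4)\Big)\mathfrak c\Psi_3-\lambda_4\mathfrak c'\Psi_3\\&+\Big(\tfrac{\Psi_4-\Psi_1}{4\gamma}+\tfrac{(\gamma-1)\mathfrak c\Psi_3}{2}\Big)(\partial_t\Psi_3+\lambda_4\partial_r\Psi_3).\end{aligned}$$ Boundary conditions (B): $$\Psi_j(t,r_0)=H_j(t)+K_j\Psi_1(t,r_0)\ (j=2,3,4),\qquad \Psi_1(t,r_1)=H_1(t)-\Psi_4(t,r_1).$$ *)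

(* Defs.v *)
From Stdlib Require Import Reals Lra.
From Coquelicot Require Import Coquelicot.
Open Scope R_scope.

(** * Derivatives and C^1 regularity relative to a set *)

(** Coquelicot's [is_derive] with [locally x] cut down to [A]: at an endpoint of
    an interval this is the one-sided derivative. *)
Definition is_derive_on (A : R -> Prop) (f : R -> R) (x l : R) : Prop :=
  filterdiff f (within A (locally x)) (fun y : R => scal y l).

Definition ex_derive_on (A : R -> Prop) (f : R -> R) (x : R) : Prop :=
  exists l : R, is_derive_on A f x l.

(** Total operator; meaningful where [ex_derive_on A f x] holds and [x] is an
    accumulation point of [A] (see [Derive_on_unique]). *)
Definition Derive_on (A : R -> Prop) (f : R -> R) (x : R) : R :=
  iota (is_derive_on A f x).

Definition smooth_on (A : R -> Prop) (f : R -> R) : Prop :=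
  forall (n : nat) (x : R), A x -> ex_derive_on A (Nat.iter n (Derive_on A) f) x.

Definition C1_on (A : R -> Prop) (f : R -> R) : Prop :=
  (forall x, A x -> ex_derive_on A f x) /\
  continuous_on A f /\ continuous_on A (Derive_on A f).

(** Supremum of |f| over A, possibly [p_infty]. *)
Definition sup_norm {X : Type} (A : X -> Prop) (f : X -> R) : Rbar :=
  Lub_Rbar (fun y => exists x, A x /\ y = Rabs (f x)).

Definition C1_norm (A : R -> Prop) (f : R -> R) : Rbar :=
  Rbar_plus (sup_norm A f) (sup_norm A (Derive_on A f)).

Definition half_line (a : R) : R -> Prop := fun x => a <= x.
Definition segment (a b : R) : R -> Prop := fun x => a <= x <= b.

(** ** Functions of (t, r) on R_+ x [r0, r1] *)

Definition dom (r0 r1 : R) : R * R -> Prop :=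
  fun p => 0 <= fst p /\ r0 <= snd p <= r1.

Definition uncurry2 (f : R -> R -> R) : R * R -> R := fun p => f (fst p) (snd p).

Definition dt (f : R -> R -> R) (t r : R) : R :=
  Derive_on (half_line 0) (fun s => f s r) t.

Definition dr (r0 r1 : R) (f : R -> R -> R) (t r : R) : R :=
  Derive_on (segment r0 r1) (fun s => f t s) r.

Definition C1_on_dom (r0 r1 : R) (f : R -> R -> R) : Prop :=
  (forall t r, dom r0 r1 (t, r) ->
     ex_derive_on (half_line 0) (fun s => f s r) t /\
     ex_derive_on (segment r0 r1) (fun s => f t s) r) /\
  continuous_on (dom r0 r1) (uncurry2 f) /\
  continuous_on (dom r0 r1) (uncurry2 (dt f)) /\
  continuous_on (dom r0 r1) (uncurry2 (dr r0 r1 f)).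

Definition C1_norm_dom (r0 r1 : R) (f : R -> R -> R) : Rbar :=
  Rbar_plus (sup_norm (dom r0 r1) (uncurry2 f))
    (Rbar_plus (sup_norm (dom r0 r1) (uncurry2 (dt f)))
               (sup_norm (dom r0 r1) (uncurry2 (dr r0 r1 f)))).

(** * The background flow *)

Definition sound_speed (gamma S0 : R) (rho : R -> R) (r : R) : R :=
  sqrt (gamma * exp S0 * Rpower (rho r) (gamma - 1)).

(** Positivity of [rho] is part of the notion: [Rpower x y] is a real power
    only for [0 < x]. *)
Record background_flow (gamma rho0 U10 U20 S0 r0 : R)
    (rho U1 U2 Sb : R -> R) : Prop := {
  bg_smooth_rho : smooth_on (half_line r0) rho;
  bg_smooth_U1 : smooth_on (half_line r0) U1;
  bg_smooth_U2 : smooth_on (half_line r0) U2;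
  bg_smooth_S : smooth_on (half_line r0) Sb;
  bg_rho_pos : forall r, r0 <= r -> 0 < rho r;
  bg_mass : forall r, r0 <= r ->
    Derive_on (half_line r0) (fun s => rho s * U1 s) r + rho r * U1 r / r = 0;
  bg_radial : forall r, r0 <= r ->
    U1 r * Derive_on (half_line r0) U1 r
    + Derive_on (half_line r0) (fun s => exp (Sb s) * Rpower (rho s) gamma) r / rho r
    - U2 r ^ 2 / r = 0;
  bg_angular : forall r, r0 <= r ->
    U1 r * Derive_on (half_line r0) U2 r + U1 r * U2 r / r = 0;
  bg_entropy : forall r, r0 <= r -> U1 r * Derive_on (half_line r0) Sb r = 0;
  bg_init : rho r0 = rho0 /\ U1 r0 = U10 /\ U2 r0 = U20 /\ Sb r0 = S0;
  bg_subsonic : forall r, r0 <= r ->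
    U1 r ^ 2 + U2 r ^ 2 < sound_speed gamma S0 rho r ^ 2
}.

Inductive idx4 : Set := i1 | i2 | i3 | i4.

Definition frak_c (gamma S0 : R) (rho : R -> R) (r : R) : R :=
  sound_speed gamma S0 rho r / (gamma * (gamma - 1)).

Definition Rbg (gamma S0 : R) (rho U1 U2 : R -> R) (i : idx4) (r : R) : R :=
  match i with
  | i1 => U1 r - 2 * sound_speed gamma S0 rho r / (gamma - 1)
  | i2 => U2 r
  | i3 => S0
  | i4 => U1 r + 2 * sound_speed gamma S0 rho r / (gamma - 1)
  end.

(** * The perturbation system *)

(** The speeds at [Psi + Rb], with [c] the function frak_c.  The background
    entropy does not enter: it is [Psi i3] that multiplies [c]. *)
Definition lambda (gamma : R) (c : R -> R) (Rb : idx4 -> R -> R)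
    (Psi : idx4 -> R -> R -> R) (i : idx4) (t r : R) : R :=
  match i with
  | i1 => (gamma + 1) / 4 * (Psi i1 t r + Rb i1 r - c r * Psi i3 t r)
          + (3 - gamma) / 4 * (Psi i4 t r + Rb i4 r + c r * Psi i3 t r)
  | i2 | i3 => 1 / 2 * (Psi i1 t r + Rb i1 r + Psi i4 t r + Rb i4 r)
  | i4 => (3 - gamma) / 4 * (Psi i1 t r + Rb i1 r - c r * Psi i3 t r)
          + (gamma + 1) / 4 * (Psi i4 t r + Rb i4 r + c r * Psi i3 t r)
  end.

Definition system_P (gamma r0 r1 : R) (c : R -> R) (Rb : idx4 -> R -> R)
    (Psi : idx4 -> R -> R -> R) (t r : R) : Prop :=
  let P1 := Psi i1 t r in
  let P2 := Psi i2 t r in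
  let P3 := Psi i3 t r in
  let P4 := Psi i4 t r in
  let B1 := Rb i1 r in
  let B2 := Rb i2 r in
  let B4 := Rb i4 r in
  let B1' := Derive_on (half_line r0) (Rb i1) r in
  let B4' := Derive_on (half_line r0) (Rb i4) r in
  let c' := Derive_on (half_line r0) c r in
  let lam i := lambda gamma c Rb Psi i t r in
  let transport l i := dt (Psi i) t r + l * dr r0 r1 (Psi i) t r in
  transport (lam i1) i1 =
    (- ((gamma + 1) / 4) * B1' - (gamma - 1) / (4 * r) * B1) * P1
    + 2 * B2 / r * P2
    + (- ((3 - gamma) / 4) * B1' + (gamma - 1) / (4 * r) * B4) * P4
    + P2 ^ 2 / r
    + (gamma - 1) / (8 * r) * (P4 ^ 2 - P1 ^ 2)
    + (gamma - 1) * c r / (4 * r) * P3 * (P1 + P4)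
    + ((gamma - 1) / 2 * B1' + (gamma - 1) / (4 * r) * (B1 + B4)) * c r * P3
    + lam i1 * c' * P3
    - ((P4 - P1) / (4 * gamma) + (gamma - 1) * c r * P3 / 2)
      * transport (lam i1) i3
  /\
  transport (lam i2) i2 = - (lam i2 / r) * P2
  /\
  transport (lam i3) i3 = 0
  /\
  transport (lam i4) i4 =
    (- ((3 - gamma) / 4) * B4' + (gamma - 1) / (4 * r) * B1) * P1
    + 2 * B2 / r * P2
    + (- ((gamma + 1) / 4) * B4' - (gamma - 1) / (4 * r) * B4) * P4
    + P2 ^ 2 / r
    - (gamma - 1) / (8 * r) * (P4 ^ 2 - P1 ^ 2)
    - (gamma - 1) * c r / (4 * r) * P3 * (P1 + P4)
    - ((gamma - 1) / 2 * B4' + (gamma - 1) / (4 * r) * (B1 + B4)) * c r * P3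
    - lam i4 * c' * P3
    + ((P4 - P1) / (4 * gamma) + (gamma - 1) * c r * P3 / 2)
      * transport (lam i4) i3.

Definition boundary_B (K2 K3 K4 r0 r1 : R) (H : idx4 -> R -> R)
    (Psi : idx4 -> R -> R -> R) (t : R) : Prop :=
  Psi i2 t r0 = H i2 t + K2 * Psi i1 t r0 /\
  Psi i3 t r0 = H i3 t + K3 * Psi i1 t r0 /\
  Psi i4 t r0 = H i4 t + K4 * Psi i1 t r0 /\
  Psi i1 t r1 = H i1 t - Psi i4 t r1.

(** * Uniqueness of relative derivatives *)

Lemma is_derive_on_unique (A : R -> Prop) (f : R -> R) (x l1 l2 : R) :
  (forall eps : posreal, exists y, A y /\ y <> x /\ Rabs (y - x) < eps) ->
  is_derive_on A f x l1 -> is_derive_on A f x l2 -> l1 = l2.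
Proof.
intros HA [_ D1] [_ D2].
assert (Hx : is_filter_lim (within A (locally x)) x).
{ intros P HP. unfold within. apply (filter_imp P); [ now intros | exact HP ]. }
specialize (D1 x Hx). specialize (D2 x Hx).
destruct (Req_dec l1 l2) as [E | E]; [exact E | exfalso].
assert (He : 0 < Rabs (l1 - l2) / 4).
{ assert (H := Rabs_pos_lt (l1 - l2) ltac:(lra)). lra. }
specialize (D1 (mkposreal _ He)). specialize (D2 (mkposreal _ He)).
destruct (filter_and _ _ D1 D2) as [d Hd].
destruct (HA d) as [y [Ay [Ny Hy]]].
destruct (Hd y Hy Ay) as [Q1 Q2]. clear -Q1 Q2 Ny He E.
change (Rabs ((f y - f x) - (y - x) * l1) <= Rabs (l1 - l2) / 4 * Rabs (y - x)) in Q1.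
change (Rabs ((f y - f x) - (y - x) * l2) <= Rabs (l1 - l2) / 4 * Rabs (y - x)) in Q2.
assert (H := Rabs_triang ((f y - f x) - (y - x) * l2)
               (- ((f y - f x) - (y - x) * l1))).
rewrite Rabs_Ropp in H.
replace ((f y - f x) - (y - x) * l2 + - ((f y - f x) - (y - x) * l1))
  with ((l1 - l2) * (y - x)) in H by ring.
rewrite Rabs_mult in H.
assert (0 < Rabs (y - x)) by (apply Rabs_pos_lt; lra).
assert (0 < Rabs (l1 - l2) * Rabs (y - x)) by (apply Rmult_lt_0_compat; lra).
lra.
Qed.

Lemma Derive_on_unique (A : R -> Prop) (f : R -> R) (x l : R) :
  (forall eps : posreal, exists y, A y /\ y <> x /\ Rabs (y - x) < eps) ->
  is_derive_on A f x l -> Derive_on A f x = l.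
Proof.
intros HA Hl. unfold Derive_on.
apply (iota_unique (V := R_CompleteNormedModule)); [ | exact Hl].
intros y Hy. exact (is_derive_on_unique A f x y l HA Hy Hl).
Qed.

(* Main.v *)
Require Import Defs.
From Stdlib Require Import Reals Lra Lia Psatz List ZArith ClassicalEpsilon FunctionalExtensionality.
From Coquelicot Require Import Coquelicot.
Open Scope R_scope.

(** The background flow is subsonic with [U1 > 0], so all four speeds of the
    system stay away from 0.  Dividing each equation by its speed makes [r] the
    evolution variable and leaves [t], running over the whole line, as the
    space variable: for each component the boundary relations then give initial
    values on one of the lines [r = r0], [r = r1].  A time-periodic solution is
    a bounded solution of this problem, and is obtained as a fixed point.

    Where the contraction comes from.  Small data are rescaled to size 1 by
    their size [nu], which multiplies all nonlinear effects by [nu].  What is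
    left is the reflection at the two ends and the zero-order terms of the
    linearized system.  The reflections are [K_j] at [r0] and -1 at [r1]; giving
    the first component the weight [th], with [|K_j| <= th^2] and [th < 1],
    spreads the gain over both ends and makes each of them at most [th].  The
    zero-order terms have size [1 / r0] and act on a segment of length at most
    [xi0 r0], hence contribute [O(xi0)], which is less than [1 - th] when [xi0]
    is small.  The constants in this comparison must not depend on [r0]:
    conservation of mass, Bernoulli's law and the subsonic formula for the
    logarithmic slope of the density bound the background by its values at
    [r0], and its derivatives by a multiple of [1 / r0] ([background_bounds],
    [background_speed]).

    Why the scheme closes in C^1.  The iteration freezes the coefficients at
    the previous state and solves scalar transport problems along the orbits of
    the frozen speeds ([transport_solution]).  Two points need care.  First, the
    equations of the components 1 and 4 contain the derivative of the third one
    along their own orbits.  Along an orbit this is a total derivative, so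
    integrating by parts replaces its [t]-derivative by a Jacobian, which only
    has first-order factors ([is_derive_RInt_jacobian]).  Second, the equations
    are quasilinear, so the iteration contracts only in the uniform norm
    ([contraction]).  It preserves however a common modulus of continuity of the
    first derivatives, here in the affine form [e + b |t - t'|], and together
    with uniform convergence this forces the derivatives to converge uniformly
    ([approx_cauchy_t]), so that the limit is C^1 and solves the system
    ([fixed_state_exists]).  The contraction also gives uniqueness among bounded
    solutions; comparing the solution with its translate by [T] shows that it is
    periodic ([fixed_state_periodic]).

    To work on all of [R * R] the background is frozen outside [r0, r1], the
    speeds are cut off there, and the boundary data are continued periodically
    to negative times. *)
(** * Calculus with parameters *)

Lemma abs_plus_le {u v a b} : Rabs u <= a -> Rabs v <= b -> Rabs (u + v) <= a + b.
Proof. intros Hu Hv. eapply Rle_trans; [apply Rabs_triang|lra]. Qed.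

Lemma abs_minus_le {u v a b} : Rabs u <= a -> Rabs v <= b -> Rabs (u - v) <= a + b.
Proof. intros Hu Hv. apply abs_plus_le; auto. rewrite Rabs_Ropp; auto. Qed.

Lemma abs_mult_le {u v a b} : Rabs u <= a -> Rabs v <= b -> Rabs (u * v) <= a * b.
Proof. intros Hu Hv. rewrite Rabs_mult. apply Rmult_le_compat; auto; apply Rabs_pos. Qed.

Lemma abs_scal_le {c u b} : 0 <= c -> Rabs u <= b -> Rabs (c * u) <= c * b.
Proof. intros Hc Hu. apply abs_mult_le; auto. rewrite Rabs_pos_eq; lra. Qed.

Ltac abs_lra := unfold Rmin, Rmax, Rabs; repeat destruct Rle_dec; repeat destruct Rcase_abs; lra.

Definition cont2 (f : R -> R -> R) : Prop :=
  forall r t, continuous (fun p : R * R => f (fst p) (snd p)) (r, t).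

Lemma continuous_eps {U : UniformSpace} (f : U -> R) (x : U) :
  (forall eps, 0 < eps -> locally x (fun y => Rabs (f y - f x) < eps)) ->
  continuous f x.
Proof.
intros H P [e He]. change (locally x (fun y => P (f y))).
generalize (H e (cond_pos e)). apply filter_imp.
intros y Hy. apply He. exact Hy.
Qed.

Lemma continuous_eps_inv {U : UniformSpace} (f : U -> R) (x : U) eps :
  continuous f x -> 0 < eps -> locally x (fun y => Rabs (f y - f x) < eps).
Proof.
intros H He. apply (H (fun z => Rabs (z - f x) < eps)).
exists (mkposreal eps He). intros y Hy. exact Hy.
Qed.

Lemma continuous_Rmult {U : UniformSpace} (f g : U -> R) (x : U) :
  continuous f x -> continuous g x -> continuous (fun y => f y * g y) x.
Proof. exact (fun Hf Hg => continuous_mult (K := R_AbsRing) f g x Hf Hg). Qed.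

Lemma continuous_Rplus {U : UniformSpace} (f g : U -> R) (x : U) :
  continuous f x -> continuous g x -> continuous (fun y => f y + g y) x.
Proof. exact (fun Hf Hg => continuous_plus (V := R_NormedModule) f g x Hf Hg). Qed.

Lemma continuous_Rminus {U : UniformSpace} (f g : U -> R) (x : U) :
  continuous f x -> continuous g x -> continuous (fun y => f y - g y) x.
Proof. exact (fun Hf Hg => continuous_minus (V := R_NormedModule) f g x Hf Hg). Qed.

Lemma continuous_Ropp {U : UniformSpace} (f : U -> R) (x : U) :
  continuous f x -> continuous (fun y => - f y) x.
Proof. exact (fun Hf => continuous_opp (V := R_NormedModule) f x Hf). Qed.

Lemma continuous_cont2 {U : UniformSpace} (f : R -> R -> R) (g h : U -> R) (x : U) :
  cont2 f -> continuous g x -> continuous h x -> continuous (fun y => f (g y) (h y)) x.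
Proof. intros Hf Hg Hh. apply (continuous_comp_2 g h f); auto. Qed.

Lemma continuous_R1 {U : UniformSpace} (f : R -> R) (g : U -> R) (x : U) :
  (forall y, continuous f y) -> continuous g x -> continuous (fun y => f (g y)) x.
Proof. intros Hf Hg. apply (continuous_comp g f); auto. Qed.

Ltac cts :=
  repeat match goal with
    | H : forall y, continuous ?f y |- continuous ?f _ => apply H
    | |- continuous (fun y => @?f y + @?g y) _ => apply (continuous_Rplus f g)
    | |- continuous (fun y => @?f y - @?g y) _ => apply (continuous_Rminus f g)
    | |- continuous (fun y => @?f y * @?g y) _ => apply (continuous_Rmult f g)
    | |- continuous (fun y => - @?f y) _ => apply (continuous_Ropp f)
    | |- continuous (fun y => fst y) _ => apply continuous_fst
    | |- continuous (fun y => snd y) _ => apply continuous_snd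
    | |- continuous fst _ => apply continuous_fst
    | |- continuous snd _ => apply continuous_snd
    | |- continuous (fun y => y) _ => apply continuous_id
    | |- continuous (fun _ => ?c) _ => apply continuous_const
    | |- continuous (fun y => ?f (@?g y) (@?h y)) _ =>
        match goal with
        | H : cont2 f |- _ => apply (continuous_cont2 f g h); [exact H | |]
        end
    | |- continuous (fun y => ?f (@?g y)) _ =>
        match goal with
        | H : forall y, continuous f y |- _ => apply (continuous_R1 f g); [exact H |]
        end
    | H : continuous ?f ?x |- continuous ?f ?x => exact H
    end.

Lemma Rplus_sub_l (x y : R) : x + y - x = y.
Proof. ring. Qed.

Lemma Rplus_sub_cancel (x y z : R) : x + y - (x + z) = y - z.
Proof. ring. Qed.

Lemma Rplus_sub_swap (x y z w : R) : x + y - (z + w) = (x - z) + (y - w).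
Proof. ring. Qed.

Lemma cont2_r (f : R -> R -> R) t : cont2 f -> forall r, continuous (fun r => f r t) r.
Proof. intros Hf r. cts. Qed.

Lemma cont2_t (f : R -> R -> R) r : cont2 f -> forall t, continuous (fun t => f r t) t.
Proof. intros Hf t. cts. Qed.

Lemma ex_RInt_cont (f : R -> R) a b : (forall x, continuous f x) -> ex_RInt f a b.
Proof. intros H. apply (ex_RInt_continuous (V := R_CompleteNormedModule)). intros; apply H. Qed.

Lemma RInt_Rext (f g : R -> R) a b : (forall x, f x = g x :> R) -> RInt f a b = RInt g a b :> R.
Proof. intros H. apply (RInt_ext (V := R_CompleteNormedModule)). intros; apply H. Qed.

Lemma RInt_minus_cont (f g : R -> R) a b :
  (forall x, continuous f x) -> (forall x, continuous g x) ->
  RInt f a b - RInt g a b = RInt (fun x => f x - g x) a b.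
Proof.
intros Hf Hg. symmetry.
apply (RInt_minus (V := R_CompleteNormedModule) f g a b); apply ex_RInt_cont; auto.
Qed.

Lemma RInt_Chasles_cont (f : R -> R) a b c :
  (forall x, continuous f x) -> RInt f a b + RInt f b c = RInt f a c.
Proof.
intros Hf. apply (RInt_Chasles (V := R_CompleteNormedModule)); apply ex_RInt_cont; auto.
Qed.

Lemma RInt_swap_cont (f : R -> R) a b :
  (forall x, continuous f x) -> RInt f b a = - RInt f a b.
Proof.
intros Hf. symmetry. apply (opp_RInt_swap (V := R_CompleteNormedModule)).
apply ex_RInt_cont; auto.
Qed.

Lemma RInt_plus_cont (f g : R -> R) a b :
  (forall x, continuous f x) -> (forall x, continuous g x) ->
  RInt f a b + RInt g a b = RInt (fun x => f x + g x) a b.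
Proof.
intros Hf Hg. symmetry.
apply (RInt_plus (V := R_CompleteNormedModule) f g a b); apply ex_RInt_cont; auto.
Qed.

Lemma is_derive_RInt_cont (f : R -> R) a x :
  (forall x, continuous f x) -> is_derive (fun x => RInt f a x) x (f x).
Proof.
intros Hf. apply (is_derive_RInt (V := R_NormedModule) f (fun x => RInt f a x) a x); auto.
apply filter_forall. intros y. apply (RInt_correct (V := R_CompleteNormedModule)).
apply ex_RInt_cont; auto.
Qed.

(** By compactness of [a, b], continuity in the parameter is uniform in [s]. *)
Lemma tube {P : UniformSpace} (F : R -> P -> R) (p0 : P) (a b eps : R) :
  (forall s, continuous (fun z : R * P => F (fst z) (snd z)) (s, p0)) -> 0 < eps ->
  locally p0 (fun p => forall s, a <= s <= b -> Rabs (F s p - F s p0) < eps).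
Proof.
intros HF He.
assert (H : forall s, exists d : posreal, forall s' p, Rabs (s' - s) < d -> ball p0 d p ->
   Rabs (F s' p - F s p0) < eps / 2).
{ intros s. destruct (continuous_eps_inv _ _ (eps/2) (HF s) ltac:(lra)) as [d Hd].
  exists d. intros s' p Hs Hp. apply (Hd (s', p)). split; assumption. }
set (dl := fun s => proj1_sig (constructive_indefinite_description _ (H s))).
assert (Hdl : forall s s' p, Rabs (s' - s) < dl s -> ball p0 (dl s) p ->
   Rabs (F s' p - F s p0) < eps / 2).
{ intros s. unfold dl. destruct constructive_indefinite_description as [d Hd]. exact Hd. }
destruct (compactness_value_1d a b dl) as [d Hd].
exists d. intros p Hp s Hs. apply NNPP. intros HN. apply (Hd s Hs). intros [t [Ht [Hst Hdt]]].
apply HN.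
assert (A1 := Hdl t s p Hst (ball_le p0 d (dl t) Hdt p Hp)).
assert (A2 := Hdl t s p0 Hst (ball_center p0 (dl t))).
unfold Rabs in *; repeat destruct Rcase_abs; lra.
Qed.

Lemma continuous_bounded (f : R -> R) a b :
  (forall x, continuous f x) -> exists M, 0 <= M /\ forall x, a <= x <= b -> Rabs (f x) <= M.
Proof.
intros Hf. destruct (Rle_lt_dec a b) as [Hab|Hab].
- destruct (continuity_ab_maj (fun x => Rabs (f x)) a b Hab) as [x [Hx _]].
  { intros c _. apply continuity_pt_filterlim. apply (continuous_comp f Rabs); [apply Hf|].
    apply continuous_Rabs. }
  exists (Rabs (f x)). split; [apply Rabs_pos | exact Hx].
- exists 0. split; [lra|intros; lra].
Qed.

Lemma abs_RInt_le_gen (f : R -> R) a b M :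
  (forall x, continuous f x) ->
  (forall x, Rmin a b <= x <= Rmax a b -> Rabs (f x) <= M) ->
  Rabs (RInt f a b) <= M * Rabs (b - a).
Proof.
intros Hc Hf. destruct (Rle_lt_dec a b) as [H|H].
- rewrite (Rabs_pos_eq (b - a)) by lra. rewrite Rmult_comm.
  apply abs_RInt_le_const; auto. apply ex_RInt_cont; auto.
  intros t Ht. apply Hf. rewrite Rmin_left, Rmax_right; lra.
- rewrite (Rabs_left (b - a)) by lra.
  replace (RInt f a b) with (- RInt f b a).
  2:{ apply (opp_RInt_swap (V := R_CompleteNormedModule)). apply ex_RInt_cont; auto. }
  rewrite Rabs_Ropp, Rmult_comm. replace (- (b - a)) with (a - b) by ring.
  apply abs_RInt_le_const; auto; try lra. apply ex_RInt_cont; auto.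
  intros t Ht. apply Hf. rewrite Rmin_right, Rmax_left; lra.
Qed.

Lemma continuous_RInt_param {P : UniformSpace} (F : R -> P -> R) (al be : P -> R) (p0 : P) :
  (forall s p, continuous (fun z : R * P => F (fst z) (snd z)) (s, p)) ->
  continuous al p0 -> continuous be p0 ->
  continuous (fun p => RInt (fun s => F s p) (al p) (be p)) p0.
Proof.
intros HF Ha Hb. apply continuous_eps. intros eps He.
assert (Hs : forall p s, continuous (fun s => F s p) s).
{ intros p s. apply (continuous_comp_2 (fun s => s) (fun _ => p) F).
  apply continuous_id. apply continuous_const. apply HF. }
set (lo := Rmin (al p0) (be p0) - 1). set (hi := Rmax (al p0) (be p0) + 1).
destruct (continuous_bounded (fun s => F s p0) lo hi (Hs p0)) as [B [HB0 HB]].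
assert (Hlohi : 0 < hi - lo).
{ unfold lo, hi, Rmin, Rmax; repeat destruct Rle_dec; lra. }
set (e1 := eps / (2 * (hi - lo) + 4)).
assert (He1 : 0 < e1) by (apply Rdiv_lt_0_compat; lra).
set (e2 := Rmin 1 (eps / (4 * (B + e1)))).
assert (He2 : 0 < e2).
{ apply Rmin_pos; try lra. apply Rdiv_lt_0_compat; lra. }
assert (E2 : (B + e1) * e2 <= eps / 4).
{ apply Rle_trans with ((B + e1) * (eps / (4 * (B + e1)))).
  apply Rmult_le_compat_l; [lra | apply Rmin_r]. right; field; lra. }
assert (E3 : e2 <= 1) by apply Rmin_l.
assert (E1 : e1 * (hi - lo) < eps / 2).
{ unfold e1. apply Rmult_lt_reg_r with (2 * (hi - lo) + 4). lra.
  replace (eps / (2 * (hi - lo) + 4) * (hi - lo) * (2 * (hi - lo) + 4)) with (eps * (hi - lo)) by (field; lra).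
  nra. }
generalize (filter_and _ _ (tube F p0 lo hi e1 (fun s => HF s p0) He1)
  (filter_and _ _ (continuous_eps_inv _ _ e2 Ha He2) (continuous_eps_inv _ _ e2 Hb He2))).
apply filter_imp. intros p [HT [Hap Hbp]].
assert (HBp : forall s, lo <= s <= hi -> Rabs (F s p) <= B + e1).
{ intros s Hs'. specialize (HT s Hs'). specialize (HB s Hs').
  unfold Rabs in *; repeat destruct Rcase_abs; lra. }
replace (RInt (fun s => F s p) (al p) (be p) - RInt (fun s => F s p0) (al p0) (be p0)) with
 (RInt (fun s => F s p - F s p0) (al p0) (be p0) + RInt (fun s => F s p) (be p0) (be p)
   + RInt (fun s => F s p) (al p) (al p0)).
2:{ rewrite <- RInt_minus_cont by apply Hs.
    rewrite <- (RInt_Chasles_cont (fun s => F s p) (al p) (al p0) (be p)) by apply Hs.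
    rewrite <- (RInt_Chasles_cont (fun s => F s p) (al p0) (be p0) (be p)) by apply Hs. ring. }
assert (Rlo : lo = Rmin (al p0) (be p0) - 1) by reflexivity.
assert (Rhi : hi = Rmax (al p0) (be p0) + 1) by reflexivity.
assert (M1 := Rmin_l (al p0) (be p0)). assert (M2 := Rmin_r (al p0) (be p0)).
assert (M3 := Rmax_l (al p0) (be p0)). assert (M4 := Rmax_r (al p0) (be p0)).
assert (I1 : Rabs (RInt (fun s => F s p - F s p0) (al p0) (be p0)) <= e1 * Rabs (be p0 - al p0)).
{ apply abs_RInt_le_gen. intros; cts; apply Hs. intros x Hx. left. apply HT. lra. }
assert (I1' : e1 * Rabs (be p0 - al p0) <= e1 * (hi - lo)).
{ apply Rmult_le_compat_l; [lra|]. abs_lra. }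
assert (I2 : Rabs (RInt (fun s => F s p) (be p0) (be p)) <= (B + e1) * Rabs (be p - be p0)).
{ apply abs_RInt_le_gen. apply Hs. intros x Hx. apply HBp.
  revert Hx Hbp; abs_lra. }
assert (I3 : Rabs (RInt (fun s => F s p) (al p) (al p0)) <= (B + e1) * Rabs (al p0 - al p)).
{ apply abs_RInt_le_gen. apply Hs. intros x Hx. apply HBp.
  revert Hx Hap; abs_lra. }
assert (I2' : (B + e1) * Rabs (be p - be p0) <= (B + e1) * e2) by (apply Rmult_le_compat_l; lra).
assert (I3' : (B + e1) * Rabs (al p0 - al p) <= (B + e1) * e2).
{ rewrite Rabs_minus_sym. apply Rmult_le_compat_l; lra. }
eapply Rle_lt_trans. apply Rabs_triang.
apply Rle_lt_trans with (e1 * (hi - lo) + eps / 4 + eps / 4); [|lra].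
apply Rplus_le_compat; [|lra].
eapply Rle_trans. apply Rabs_triang. lra.
Qed.

Lemma is_derive_RInt_under (F Ft : R -> R -> R) a b t :
  (forall s t, is_derive (fun t => F s t) t (Ft s t)) ->
  (forall t s, continuous (fun s => F s t) s) -> cont2 Ft ->
  is_derive (fun t => RInt (fun s => F s t) a b) t (RInt (fun s => Ft s t) a b).
Proof.
intros HD HF HFt.
replace (RInt (fun s => Ft s t) a b) with (RInt (fun s => Derive (fun u => F s u) t) a b).
2:{ apply RInt_ext. intros x _. apply is_derive_unique. apply HD. }
apply (is_derive_RInt_param (fun t s => F s t) a b t).
- apply filter_forall. intros u s _. exists (Ft s u). apply HD.
- intros s _. apply continuity_2d_pt_ext with (fun u v => Ft v u).
  { intros u v. symmetry. apply is_derive_unique. apply HD. }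
  apply continuity_2d_pt_filterlim. 
  apply (continuous_cont2 Ft (fun z : R * R => snd z) (fun z => fst z) (t, s)); auto; cts.
- apply filter_forall. intros u. apply ex_RInt_cont. apply HF.
Qed.

Lemma MVT_real (f df : R -> R) a b :
  (forall x, is_derive f x (df x)) ->
  exists c, Rmin a b <= c <= Rmax a b /\ f b - f a = df c * (b - a).
Proof.
intros H. apply MVT_gen.
- intros; apply H.
- intros x _. apply continuity_pt_filterlim.
  apply (ex_derive_continuous (K := R_AbsRing) (V := R_NormedModule)). exists (df x). apply H.
Qed.

Lemma lipschitz_of_derive (f df : R -> R) L a b :
  (forall x, is_derive f x (df x)) -> (forall x, Rabs (df x) <= L) ->
  Rabs (f b - f a) <= L * Rabs (b - a).
Proof.
intros H HL. destruct (MVT_real f df a b H) as [c [_ ->]].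
rewrite Rabs_mult. apply Rmult_le_compat_r. apply Rabs_pos. apply HL.
Qed.

Lemma is_derive_eps (f : R -> R) x l :
  (forall eps, 0 < eps -> locally x (fun y => Rabs (f y - f x - (y - x) * l) <= eps * Rabs (y - x))) ->
  is_derive f x l.
Proof.
intros H. split. apply is_linear_scal_l.
intros x' Hx' eps.
rewrite <- (is_filter_lim_locally_unique (K := R_AbsRing) (V := R_NormedModule) x x' Hx').
generalize (H eps (cond_pos eps)). apply filter_imp. intros y Hy. exact Hy.
Qed.

Lemma is_derive_eps_inv (f : R -> R) x l eps :
  is_derive f x l -> 0 < eps ->
  locally x (fun y => Rabs (f y - f x - (y - x) * l) <= eps * Rabs (y - x)).
Proof.
intros [_ H] He.
generalize (H x (fun P H => H) (mkposreal eps He)). apply filter_imp. intros y Hy. exact Hy.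
Qed.

Lemma is_derive_continuous (f : R -> R) x l : is_derive f x l -> continuous f x.
Proof.
intros H. apply (ex_derive_continuous (K := R_AbsRing) (V := R_NormedModule)). now exists l.
Qed.

Lemma is_derive_Rext (f g : R -> R) (x l : R) :
  (forall y : R, f y = g y :> R) -> is_derive f x l -> is_derive g x l.
Proof. exact (is_derive_ext (K := R_AbsRing) (V := R_NormedModule) f g x l). Qed.

Lemma is_derive_Rplus (f g : R -> R) (x df dg : R) :
  is_derive f x df -> is_derive g x dg -> is_derive (fun y => f y + g y) x (df + dg).
Proof. exact (is_derive_plus (K := R_AbsRing) (V := R_NormedModule) f g x df dg). Qed.

Lemma is_derive_Rminus (f g : R -> R) (x df dg : R) :
  is_derive f x df -> is_derive g x dg -> is_derive (fun y => f y - g y) x (df - dg).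
Proof. exact (is_derive_minus (K := R_AbsRing) (V := R_NormedModule) f g x df dg). Qed.

Lemma is_derive_Rmult (f g : R -> R) (x df dg : R) :
  is_derive f x df -> is_derive g x dg ->
  is_derive (fun y => f y * g y) x (df * g x + f x * dg).
Proof.
intros Hf Hg. apply (is_derive_mult (K := R_AbsRing) f g x df dg Hf Hg).
intros; apply Rmult_comm.
Qed.

Lemma is_derive_Rconst (c x : R) : is_derive (fun _ : R => c) x 0.
Proof. exact (is_derive_const (K := R_AbsRing) (V := R_NormedModule) c x). Qed.

Lemma is_derive_Rid (x : R) : is_derive (fun y : R => y) x 1.
Proof. exact (is_derive_id (K := R_AbsRing) x). Qed.

Lemma is_derive_eq (f : R -> R) (x l l' : R) : is_derive f x l -> l = l' :> R -> is_derive f x l'.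
Proof. now intros H <-. Qed.

(** Moving the second argument along a curve [x] only sees the partial
    derivative [ft] at the starting point, because [ft] is continuous. *)
Lemma is_derive_shift (f ft : R -> R -> R) (x : R -> R) s x' :
  (forall r t, is_derive (fun t => f r t) t (ft r t)) -> cont2 ft ->
  is_derive x s x' ->
  is_derive (fun s' => f s' (x s') - f s' (x s)) s (ft s (x s) * x').
Proof.
intros Hf Hc Hx. apply is_derive_eps. intros eps He.
set (K := Rabs x' + 1). assert (HK : 0 < K) by (unfold K; assert (H := Rabs_pos x'); lra).
set (B := Rabs (ft s (x s)) + 1). assert (HB : 0 < B) by (unfold B; assert (H := Rabs_pos (ft s (x s))); lra).
assert (He2 : 0 < eps / (2 * B)) by (apply Rdiv_lt_0_compat; lra).
assert (He1 : 0 < eps / (2 * K)) by (apply Rdiv_lt_0_compat; lra).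
destruct (continuous_eps_inv _ _ (eps / (2 * K)) (Hc s (x s)) He1) as [d Hd].
assert (L1 := is_derive_eps_inv x s x' (eps / (2 * B)) Hx He2).
assert (L2 := is_derive_eps_inv x s x' 1 Hx Rlt_0_1).
assert (L3 := continuous_eps_inv x s d (is_derive_continuous _ _ _ Hx) (cond_pos d)).
assert (L4 : locally s (fun y => Rabs (y - s) < d)) by (exists d; intros y Hy; exact Hy).
generalize (filter_and _ _ (filter_and _ _ L1 L2) (filter_and _ _ L3 L4)).
apply filter_imp. intros y [[Y1 Y2] [Y3 Y4]].
destruct (MVT_real (fun t => f y t) (fun t => ft y t) (x s) (x y) (fun t => Hf y t)) as [c [Hc1 Hc2]].
assert (Hcc : Rabs (c - x s) < d).
{ revert Hc1 Y3. abs_lra. }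
assert (Hdd := Hd (y, c) (conj Y4 Hcc)). simpl in Hdd.
rewrite Hc2.
replace (ft y c * (x y - x s) - (f s (x s) - f s (x s)) - (y - s) * (ft s (x s) * x'))
  with ((ft y c - ft s (x s)) * (x y - x s) + ft s (x s) * (x y - x s - (y - s) * x')) by ring.
assert (Y2' : Rabs (x y - x s) <= K * Rabs (y - s)).
{ replace (x y - x s) with ((x y - x s - (y - s) * x') + (y - s) * x') by ring.
  eapply Rle_trans. apply Rabs_triang. rewrite (Rabs_mult (y - s)). unfold K. lra. }
eapply Rle_trans. apply Rabs_triang. rewrite !Rabs_mult.
apply Rle_trans with (eps / (2 * K) * (K * Rabs (y - s)) + B * (eps / (2 * B) * Rabs (y - s))).
- apply Rplus_le_compat; apply Rmult_le_compat; try apply Rabs_pos; auto.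
  left; assumption. unfold B; lra.
- right. field. lra.
Qed.

(** ** Continuously differentiable functions of two variables *)

(** Joint continuity is only asked of the partial derivatives; that of [u]
    follows, see [C1f_cont2]. *)
Definition C1f (u ut ur : R -> R -> R) : Prop :=
  (forall r t, is_derive (fun t => u r t) t (ut r t)) /\
  (forall r t, is_derive (fun r => u r t) r (ur r t)) /\
  cont2 ut /\ cont2 ur.

Lemma C1f_chain u ut ur (x : R -> R) s x' :
  C1f u ut ur -> is_derive x s x' ->
  is_derive (fun s => u s (x s)) s (ur s (x s) + x' * ut s (x s)).
Proof.
intros [H1 [H2 [H3 H4]]] Hx.
apply is_derive_Rext with (fun s' => (u s' (x s') - u s' (x s)) + u s' (x s)).
{ intros; simpl; ring. }
apply is_derive_eq with (ut s (x s) * x' + ur s (x s)); [|ring].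
apply is_derive_Rplus; [|apply H2].
apply (is_derive_shift u ut x s x'); auto.
Qed.

Lemma C1f_cont2 u ut ur : C1f u ut ur -> cont2 u.
Proof.
intros [H1 [H2 [H3 H4]]] r t. apply continuous_eps. intros eps He.
set (B := Rabs (ut r t) + 1). assert (HB : 0 < B) by (unfold B; assert (H := Rabs_pos (ut r t)); lra).
destruct (continuous_eps_inv _ _ 1 (H3 r t) Rlt_0_1) as [d Hd].
destruct (continuous_eps_inv _ _ (eps/2) (is_derive_continuous _ _ _ (H2 r t)) ltac:(lra)) as [d2 Hd2].
assert (Hm : 0 < Rmin (Rmin d d2) (eps / (2 * B))).
{ repeat apply Rmin_pos; try apply cond_pos. apply Rdiv_lt_0_compat; lra. }
exists (mkposreal _ Hm). intros [r' t'] [Hr Ht]. simpl in *.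
assert (Hr' : Rabs (r' - r) < Rmin (Rmin d d2) (eps / (2 * B))) by exact Hr.
assert (Ht' : Rabs (t' - t) < Rmin (Rmin d d2) (eps / (2 * B))) by exact Ht.
assert (Q1 := Rmin_l (Rmin d d2) (eps / (2 * B))). assert (Q2 := Rmin_r (Rmin d d2) (eps / (2 * B))).
assert (Q3 := Rmin_l d d2). assert (Q4 := Rmin_r d d2).
destruct (MVT_real (fun t => u r' t) (fun t => ut r' t) t t' (fun t => H1 r' t)) as [c [Hc1 Hc2]].
assert (Hcc : Rabs (c - t) < d).
{ assert (Hx : Rabs (c - t) <= Rabs (t' - t)). 
  { revert Hc1. abs_lra. }
  lra. }
assert (Hrd : Rabs (r' - r) < d) by lra.
assert (Hdd := Hd (r', c) (conj Hrd Hcc)). simpl in Hdd.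
assert (Hrd2 : Rabs (r' - r) < d2) by lra.
assert (Hdd2 := Hd2 r' Hrd2). 
replace (u r' t' - u r t) with ((u r' t' - u r' t) + (u r' t - u r t)) by ring.
rewrite Hc2. eapply Rle_lt_trans. apply Rabs_triang. rewrite Rabs_mult.
assert (Hb : Rabs (ut r' c) <= B).
{ unfold B. revert Hdd. abs_lra. }
assert (Rabs (ut r' c) * Rabs (t' - t) <= B * (eps / (2 * B))).
{ apply Rmult_le_compat; try apply Rabs_pos; lra. }
replace (B * (eps / (2 * B))) with (eps / 2) in H by (field; lra). lra.
Qed.

(** The [t]-derivative of [int f k_s ds] involves no mixed derivative of [k]:
    integrating by parts turns [f k_st] into the Jacobian of [(f, k)]. *)
Lemma is_derive_RInt_jacobian (f ft fs k kt ks : R -> R -> R) a b t :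
  C1f f ft fs -> C1f k kt ks ->
  is_derive (fun t => RInt (fun s => f s t * ks s t) a b) t
    (f b t * kt b t - f a t * kt a t
     + RInt (fun s => ft s t * ks s t - fs s t * kt s t) a b).
Proof.
intros Hf Hk. assert (Cf := C1f_cont2 _ _ _ Hf). assert (Ck := C1f_cont2 _ _ _ Hk).
destruct Hf as [F1 [F2 [F3 F4]]]. destruct Hk as [K1 [K2 [K3 K4]]].
assert (IBP : forall tau, RInt (fun s => f s t * ks s tau) a b
   = f b t * k b tau - f a t * k a tau - RInt (fun s => fs s t * k s tau) a b).
{ intros tau.
  assert (E : is_RInt (fun s => fs s t * k s tau + f s t * ks s tau) a b
     (f b t * k b tau - f a t * k a tau)).
  { apply (is_RInt_derive (V := R_CompleteNormedModule) (fun s => f s t * k s tau)).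
    - intros s _.
      apply (is_derive_mult (fun s => f s t) (fun s => k s tau) s (fs s t) (ks s tau)); auto.
      intros; apply Rmult_comm.
    - intros s _. cts. }
  apply (is_RInt_unique (V := R_CompleteNormedModule)) in E.
  assert (E2 := RInt_plus_cont (fun s => fs s t * k s tau) (fun s => f s t * ks s tau) a b
    ltac:(intros; cts) ltac:(intros; cts)).
  pose proof (eq_trans E2 E) as E3. lra. }
(* the product is split bilinearly at time [t]: a product of two increments,
   a term with [k] frozen, and a term with [f] frozen, integrated by parts *)
apply is_derive_Rext with (fun tau =>
  (RInt (fun s => (f s tau - f s t) * (ks s tau - ks s t)) a b
   + RInt (fun s => f s tau * ks s t) a b)
  + (f b t * k b tau - f a t * k a tau - RInt (fun s => fs s t * k s tau) a b
     - RInt (fun s => f s t * ks s t) a b)).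
{ intros tau. rewrite <- IBP.
  rewrite RInt_plus_cont by (intros; cts). rewrite RInt_minus_cont by (intros; cts).
  rewrite RInt_plus_cont by (intros; cts). apply RInt_Rext. intros; ring. }
replace (f b t * kt b t - f a t * kt a t + RInt (fun s => ft s t * ks s t - fs s t * kt s t) a b)
 with ((0 + RInt (fun s => ft s t * ks s t) a b)
  + (f b t * kt b t - f a t * kt a t - RInt (fun s => fs s t * kt s t) a b - 0)).
2:{ rewrite <- RInt_minus_cont by (intros; cts). ring. }
apply is_derive_Rplus.
apply is_derive_Rplus.
- (* the first increment is O(y - t) and the second tends to 0, uniformly in [s] *)
  apply is_derive_eps. intros eps He.
  destruct (continuous_bounded (fun s => ft s t) (Rmin a b) (Rmax a b)) as [B [HB0 HB]].
  { intros; cts. }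
  set (L := Rabs (b - a)). assert (HL : 0 <= L) by apply Rabs_pos.
  set (e1 := eps / ((B + 1) * (L + 1))).
  assert (HBL : 0 < (B + 1) * (L + 1)) by (apply Rmult_lt_0_compat; lra).
  assert (He1 : 0 < e1) by (apply Rdiv_lt_0_compat; lra).
  assert (T1 := tube (fun s z => ft s z) t (Rmin a b) (Rmax a b) 1 (fun s => F3 s t) Rlt_0_1).
  assert (T2 := tube (fun s z => ks s z) t (Rmin a b) (Rmax a b) e1 (fun s => K4 s t) He1).
  destruct (filter_and _ _ T1 T2) as [d Hd]. exists d. intros y Hy.
  replace (RInt (fun s => (f s t - f s t) * (ks s t - ks s t)) a b) with 0.
  2:{ rewrite (RInt_Rext _ (fun _ => 0)) by (intros; ring).
      rewrite RInt_const. unfold scal; simpl; unfold mult; simpl; ring. }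
  rewrite Rmult_0_r, !Rminus_0_r.
  apply Rle_trans with (((B + 1) * Rabs (y - t) * e1) * Rabs (b - a)).
  + apply abs_RInt_le_gen. intros; cts. intros s Hs. apply abs_mult_le.
    * destruct (MVT_real (fun t => f s t) (fun t => ft s t) t y (fun t => F1 s t)) as [c [Hc1 ->]].
      rewrite Rabs_mult. apply Rmult_le_compat_r. apply Rabs_pos.
      assert (Hcc : Rabs (c - t) < d).
      { apply Rle_lt_trans with (Rabs (y - t)); [|exact Hy].
        revert Hc1. abs_lra. }
      assert (Hq := proj1 (Hd c Hcc) s Hs). assert (Hq2 := HB s Hs). simpl in Hq2.
      revert Hq Hq2. abs_lra.
    * left. apply (Hd y Hy); assumption.
  + fold L. replace ((B + 1) * Rabs (y - t) * e1 * L) with ((eps * Rabs (y - t)) * (L / (L + 1))).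
    2:{ unfold e1. field. lra. }
    rewrite <- (Rmult_1_r (eps * Rabs (y - t))) at 2.
    apply Rmult_le_compat_l. apply Rmult_le_pos; [lra|apply Rabs_pos].
    apply Rmult_le_reg_r with (L + 1). lra. replace (L / (L + 1) * (L + 1)) with L by (field; lra). lra.
- apply (is_derive_RInt_under (fun s tau => f s tau * ks s t) (fun s tau => ft s tau * ks s t)).
  + intros s tau. 
    apply is_derive_eq with (ft s tau * ks s t + f s tau * 0); [|ring].
    apply (is_derive_Rmult (fun tau => f s tau) (fun _ => ks s t)). apply F1. apply is_derive_Rconst.
  + intros; cts.
  + intros r u. cts.
- apply is_derive_Rminus.
  2:{ apply is_derive_Rconst. }
  apply is_derive_Rminus.
  apply is_derive_Rminus.
  + apply (is_derive_scal (fun tau => k b tau)). apply K1.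
  + apply (is_derive_scal (fun tau => k a tau)). apply K1.
  + apply (is_derive_RInt_under (fun s tau => fs s t * k s tau) (fun s tau => fs s t * kt s tau)).
    * intros s tau. apply (is_derive_scal (fun tau => k s tau)). apply K1.
    * intros; cts.
    * intros r u. cts.
Qed.

(** * Absorption and uniform limits *)

(** A bounded quantity that improves any bound [D] to [C + q D] is at most
    [C / (1 - q)]: apply the improvement to its supremum. *)
Lemma absorb {A : Type} (P : A -> Prop) (f : A -> R) (D0 C q : R) :
  0 <= q < 1 -> (forall x, P x -> f x <= D0) ->
  (forall D, (forall x, P x -> f x <= D) -> forall x, P x -> f x <= C + q * D) ->
  forall x, P x -> f x <= C / (1 - q).
Proof.
intros Hq H0 Himp x Hx.
destruct (completeness (fun y => exists x, P x /\ y = f x)) as [S [HS1 HS2]].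
- exists D0. intros y [z [Hz ->]]. auto.
- exists (f x), x. auto.
- assert (HfS : forall z, P z -> f z <= S) by (intros z Hz; apply HS1; exists z; auto).
  assert (HS : S <= C + q * S).
  { apply HS2. intros y [z [Hz ->]]. apply Himp; auto. }
  apply Rle_trans with S; auto.
  apply Rmult_le_reg_r with (1 - q). lra.
  replace (C / (1 - q) * (1 - q)) with C by (field; lra). lra.
Qed.

Lemma inv_1_minus q : 0 <= q <= 1 / 2 -> / (1 - q) <= 1 + 2 * q.
Proof.
intros Hq. apply Rmult_le_reg_r with (1 - q). lra.
rewrite Rinv_l by lra. nra.
Qed.

Lemma pow_small (C q eps : R) : 0 <= C -> 0 <= q < 1 -> 0 < eps ->
  exists N : nat, forall n, (N <= n)%nat -> C * q ^ n < eps.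
Proof.
intros HC Hq He.
destruct (pow_lt_1_zero q) with (y := eps / (C + 1)) as [N HN].
- rewrite Rabs_pos_eq; lra.
- apply Rdiv_lt_0_compat; lra.
- exists N. intros n Hn. specialize (HN n Hn).
  rewrite Rabs_pos_eq in HN by (apply pow_le; lra).
  apply Rle_lt_trans with ((C + 1) * q ^ n).
  + apply Rmult_le_compat_r. apply pow_le; lra. lra.
  + apply Rmult_lt_reg_r with (/ (C + 1)). apply Rinv_0_lt_compat; lra.
    replace ((C + 1) * q ^ n * / (C + 1)) with (q ^ n) by (field; lra). exact HN.
Qed.

Lemma uniform_cauchy_limit {A : Type} (f : nat -> A -> R) :
  (forall eps, 0 < eps -> exists N, forall n m, (N <= n)%nat -> (N <= m)%nat ->
     forall x, Rabs (f n x - f m x) <= eps) ->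
  exists F : A -> R, forall eps, 0 < eps -> exists N, forall n, (N <= n)%nat ->
     forall x, Rabs (f n x - F x) <= eps.
Proof.
intros HC.
assert (Hl : forall x, exists l, is_lim_seq (fun n => f n x) (Finite l)).
{ intros x. apply ex_lim_seq_cauchy_corr. intros eps.
  destruct (HC (eps / 2)) as [N HN]. { assert (H := cond_pos eps); lra. }
  exists N. intros n m Hn Hm. apply Rle_lt_trans with (eps / 2). apply HN; auto.
  assert (H := cond_pos eps); lra. }
exists (fun x => proj1_sig (constructive_indefinite_description _ (Hl x))).
intros eps He. destruct (HC eps He) as [N HN]. exists N. intros n Hn x.
destruct constructive_indefinite_description as [l Hlx]. simpl.
assert (H1 : is_lim_seq (fun m => Rabs (f n x - f m x)) (Rabs (f n x - l))).
{ apply is_lim_seq_abs with (l := Finite (f n x - l)). apply is_lim_seq_minus'; auto. apply is_lim_seq_const. }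
apply (is_lim_seq_le_loc (fun m => Rabs (f n x - f m x)) (fun _ => eps) (Finite (Rabs (f n x - l))) (Finite eps)); auto.
- exists N. intros m Hm. apply HN; auto.
- apply is_lim_seq_const.
Qed.

Lemma geometric_cauchy {A : Type} (f : nat -> A -> R) (C q : R) :
  0 <= C -> 0 <= q < 1 -> (forall n x, Rabs (f (S n) x - f n x) <= C * q ^ n) ->
  forall eps, 0 < eps -> exists N, forall n m, (N <= n)%nat -> (N <= m)%nat ->
     forall x, Rabs (f n x - f m x) <= eps.
Proof.
intros HC Hq Hf eps He.
assert (HC1 : 0 <= C / (1 - q)) by (apply Rdiv_le_0_compat; lra).
destruct (pow_small (C / (1 - q)) q eps HC1 Hq He) as [N HN].
assert (Hk : forall n k x, Rabs (f (n + k)%nat x - f n x) <= C / (1 - q) * (q ^ n - q ^ (n + k)%nat)).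
{ intros n k x. induction k as [|k IH].
  - rewrite Nat.add_0_r, !Rminus_eq_0, Rabs_R0. lra.
  - rewrite Nat.add_succ_r.
    replace (f (S (n + k)) x - f n x) with ((f (S (n + k)) x - f (n + k)%nat x) + (f (n + k)%nat x - f n x)) by ring.
    eapply Rle_trans. apply Rabs_triang.
    eapply Rle_trans. apply Rplus_le_compat. apply Hf. apply IH.
    simpl. right. field. lra. }
assert (Hk2 : forall n k x, (N <= n)%nat -> Rabs (f (n + k)%nat x - f n x) <= eps).
{ intros n k x Hn. eapply Rle_trans. apply Hk.
  apply Rle_trans with (C / (1 - q) * q ^ n).
  - apply Rmult_le_compat_l; auto. assert (0 <= q ^ (n + k)) by (apply pow_le; lra). lra.
  - left. apply HN; auto. }
exists N. intros n m Hn Hm x. destruct (Nat.le_ge_cases n m) as [H|H].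
- rewrite Rabs_minus_sym. replace m with (n + (m - n))%nat by lia. apply Hk2; auto.
- replace n with (m + (n - m))%nat by lia. apply Hk2; auto.
Qed.

Lemma continuous_uniform_limit {U : UniformSpace} (f : nat -> U -> R) (F : U -> R) (x : U) :
  (forall eps, 0 < eps -> exists N, forall n, (N <= n)%nat -> forall y, Rabs (f n y - F y) <= eps) ->
  (forall n, continuous (f n) x) -> continuous F x.
Proof.
intros HF Hc. apply continuous_eps. intros eps He.
destruct (HF (eps / 4)) as [N HN]; [lra|].
generalize (continuous_eps_inv (f N) x (eps / 4) (Hc N) ltac:(lra)). apply filter_imp.
intros y Hy. assert (H1 := HN N (le_n N) x). assert (H2 := HN N (le_n N) y).
unfold Rabs in *; repeat destruct Rcase_abs; lra.
Qed.

(** * Flows of time-dependent scalar fields *)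

(** Every coefficient is localized in [r] by [chi], whose mass [W] stands for
    the length of the segment: integrals over any interval are bounded by it. *)
Definition weight (chi : R -> R) (W : R) : Prop :=
  (forall s, continuous chi s) /\ (forall s, 0 <= chi s) /\
  (forall a b, Rabs (RInt chi a b) <= W).

Lemma weight_pos chi W : weight chi W -> 0 <= W.
Proof. intros [_ [_ H]]. eapply Rle_trans; [apply Rabs_pos|apply (H 0 0)]. Qed.

Lemma abs_RInt_le_weight chi W (f : R -> R) B a b :
  weight chi W -> (forall x, continuous f x) -> 0 <= B ->
  (forall s, Rmin a b <= s <= Rmax a b -> Rabs (f s) <= chi s * B) ->
  Rabs (RInt f a b) <= W * B.
Proof.
intros [Hc [Hp HW]] Hf HB.
assert (Main : forall a b, a <= b -> (forall s, a <= s <= b -> Rabs (f s) <= chi s * B) ->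
   Rabs (RInt f a b) <= W * B).
{ intros a' b' Hab Hb.
  eapply Rle_trans. apply abs_RInt_le; auto. apply ex_RInt_cont; auto.
  apply Rle_trans with (RInt (fun s => B * chi s) a' b').
  - apply RInt_le; auto.
    + apply ex_RInt_cont. intros x. apply (continuous_comp f Rabs); auto. apply continuous_Rabs.
    + apply ex_RInt_cont. intros x. cts; auto.
    + intros x Hx. rewrite Rmult_comm. apply Hb. lra.
  - replace (RInt (fun s => B * chi s) a' b') with (B * RInt chi a' b').
    + rewrite (Rmult_comm W). apply Rmult_le_compat_l; auto.
      eapply Rle_trans; [apply Rle_abs|apply HW].
    + symmetry. apply (RInt_scal (V := R_CompleteNormedModule) chi). apply ex_RInt_cont; auto. }
intros Hb. destruct (Rle_lt_dec a b) as [H|H].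
- apply Main; auto. intros s Hs; apply Hb. rewrite Rmin_left, Rmax_right; lra.
- rewrite RInt_swap_cont by auto. rewrite Rabs_Ropp. apply Main; try lra.
  intros s Hs; apply Hb. rewrite Rmin_right, Rmax_left; lra.
Qed.

(** A field whose size and [t]-slope are dominated by the weight: its flow is
    then global in [r], with a [t]-derivative close to 1 uniformly in [r]. *)
Record speed (chi : R -> R) (N s0 : R) (a a_t : R -> R -> R) : Prop := {
  sp_cont : cont2 a;
  sp_cont_t : cont2 a_t;
  sp_der : forall r t, is_derive (fun t => a r t) t (a_t r t);
  sp_bound : forall r t, Rabs (a r t) <= chi r * N;
  sp_bound_t : forall r t, Rabs (a_t r t) <= chi r * s0 }.

Definition is_orbit (a : R -> R -> R) (x : R -> R) : Prop :=
  (forall s, continuous x s) /\ forall r s, x s = x r + RInt (fun z => a z (x z)) r s.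

Section Flow.
Context (chi : R -> R) (W N s0 : R) (a a_t : R -> R -> R).
Context (HW : weight chi W) (HN : 0 <= N) (Hs0 : 0 <= s0) (Ha : speed chi N s0 a a_t).
Context (Hsmall : W * s0 <= 1 / 2).

Let Ca := sp_cont _ _ _ _ _ Ha.
Let Cat := sp_cont_t _ _ _ _ _ Ha.

Lemma speed_lipschitz r x y : Rabs (a r x - a r y) <= chi r * s0 * Rabs (x - y).
Proof.
apply (lipschitz_of_derive (fun t => a r t) (fun t => a_t r t)).
intros t; apply Ha. intros t; apply Ha.
Qed.

Lemma Ws0_range : 0 <= W * s0 <= 1 / 2.
Proof. split; auto. apply Rmult_le_pos; auto. apply (weight_pos chi); auto. Qed.

Lemma RInt_speed_diff (x y : R -> R) D r s :
  (forall z, continuous x z) -> (forall z, continuous y z) -> 0 <= D ->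
  (forall z, Rmin r s <= z <= Rmax r s -> Rabs (x z - y z) <= D) ->
  Rabs (RInt (fun z => a z (x z)) r s - RInt (fun z => a z (y z)) r s) <= W * s0 * D.
Proof.
intros Cx Cy HD Hxy. rewrite RInt_minus_cont by (intros; cts; auto).
rewrite Rmult_assoc. apply (abs_RInt_le_weight chi); auto.
- intros; cts; auto.
- apply Rmult_le_pos; auto.
- intros z Hz. eapply Rle_trans. apply speed_lipschitz. rewrite <- Rmult_assoc.
  apply Rmult_le_compat_l; auto. apply Rmult_le_pos; auto. apply HW.
Qed.

(** Picard iteration; thanks to the weight one step contracts by [W s0] on the
    whole line at once, so no continuation of local solutions is needed. *)
Lemma orbit_exists r t : exists x, is_orbit a x /\ x r = t.
Proof.
set (pic := fix pic (n : nat) : R -> R := match n with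
  | O => fun _ => t
  | S n => fun s => t + RInt (fun z => a z (pic n z)) r s end).
assert (Cp : forall n s, continuous (pic n) s).
{ induction n as [|n IH]; intros s; simpl. apply continuous_const.
  apply continuous_Rplus. apply continuous_const.
  apply (is_derive_continuous _ _ (a s (pic n s))). 
  apply (is_derive_RInt_cont (fun z => a z (pic n z))). intros; cts; auto. }
assert (Hq := Ws0_range). assert (HW0 := weight_pos _ _ HW).
assert (HWN : 0 <= W * N) by (apply Rmult_le_pos; auto).
assert (Hd : forall n s, Rabs (pic (S n) s - pic n s) <= W * N * (W * s0) ^ n).
{ induction n as [|n IH]; intros s.
  - simpl. rewrite Rmult_1_r. rewrite Rplus_sub_l.
    apply (abs_RInt_le_weight chi); auto. intros; cts. intros; apply Ha.
  - replace (pic (S (S n)) s - pic (S n) s) with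
      (RInt (fun z => a z (pic (S n) z)) r s - RInt (fun z => a z (pic n z)) r s) by (symmetry; apply Rplus_sub_cancel).
    eapply Rle_trans. apply (RInt_speed_diff _ _ (W * N * (W * s0) ^ n)); auto.
    apply Rmult_le_pos; auto. apply pow_le; lra. simpl. right; ring. }
destruct (uniform_cauchy_limit pic) as [x Hx].
{ apply (geometric_cauchy pic (W * N) (W * s0)); auto. lra. }
assert (Cx : forall s, continuous x s).
{ intros s. apply (continuous_uniform_limit pic); auto. }
assert (E : forall s, x s = t + RInt (fun z => a z (x z)) r s).
{ intros s. apply cond_eq. intros eps He.
  destruct (Hx (eps / 4)) as [n Hn]; [lra|].
  assert (H1 := Hn (S n) ltac:(lia) s). 
  assert (H2 := RInt_speed_diff (pic n) x (eps / 4) r s (Cp n) Cx ltac:(lra) (fun z _ => Hn n (le_n n) z)).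
  assert (H3 : W * s0 * (eps / 4) <= eps / 4) by nra.
  simpl in H1. unfold Rabs in *; repeat destruct Rcase_abs; lra. }
exists x. assert (Er : x r = t).
{ rewrite E, RInt_point. unfold zero; simpl; ring. }
split; auto. split; auto. intros r' s.
rewrite (E s), (E r'), <- (RInt_Chasles_cont _ r r' s) by (intros; cts; auto). ring.
Qed.

(** Gronwall's inequality; since [W s0 <= 1/2] the exponential is replaced by
    the absorption argument of [absorb]. *)
Lemma orbit_dist x y r s : is_orbit a x -> is_orbit a y ->
  Rabs (x s - y s) <= (1 + 2 * (W * s0)) * Rabs (x r - y r).
Proof.
intros [Cx Hx] [Cy Hy]. assert (Hq := Ws0_range). assert (HW0 := weight_pos _ _ HW).
assert (HB : forall z, is_orbit a z -> forall s, Rabs (z s - z r) <= W * N).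
{ intros z [Cz Hz] s'. rewrite (Hz r s').
  rewrite Rplus_sub_l.
  apply (abs_RInt_le_weight chi); auto. intros; cts; auto. intros; apply Ha. }
assert (H := absorb (fun _ => True) (fun s => Rabs (x s - y s)) (Rabs (x r - y r) + 2 * (W * N))
  (Rabs (x r - y r)) (W * s0) ltac:(lra)).
assert (H1 : Rabs (x s - y s) <= Rabs (x r - y r) / (1 - W * s0)).
{ apply H; auto.
  - intros z _. assert (B1 := HB x (conj Cx Hx) z). assert (B2 := HB y (conj Cy Hy) z).
    unfold Rabs in *; repeat destruct Rcase_abs; lra.
  - intros D HD z _. rewrite (Hx r z), (Hy r z).
    rewrite Rplus_sub_swap.
    eapply Rle_trans. apply Rabs_triang. apply Rplus_le_compat_l.
    apply RInt_speed_diff; auto.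
    eapply Rle_trans; [apply Rabs_pos | apply (HD r); auto]. }
eapply Rle_trans. exact H1. unfold Rdiv. rewrite Rmult_comm.
apply Rmult_le_compat_r. apply Rabs_pos. apply inv_1_minus; auto.
Qed.

Lemma orbit_unique x y r : is_orbit a x -> is_orbit a y -> x r = y r -> forall s, x s = y s.
Proof.
intros Hx Hy E s. assert (H := orbit_dist x y r s Hx Hy).
rewrite E, Rminus_eq_0, Rabs_R0, Rmult_0_r in H.
assert (H2 := Rabs_pos (x s - y s)). apply Rminus_diag_uniq.
destruct (Req_dec (x s - y s) 0); auto. apply Rabs_no_R0 in H0. lra.
Qed.

(** [flow s r t] is the position at [s] of the orbit through [t] at [r]. *)
Definition flow (s r t : R) : R :=
  proj1_sig (constructive_indefinite_description _ (orbit_exists r t)) s.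

Lemma flow_orbit r t : is_orbit a (fun s => flow s r t).
Proof. unfold flow. destruct constructive_indefinite_description as [x [Hx Ex]]. exact Hx. Qed.

Lemma flow_start r t : flow r r t = t.
Proof. unfold flow. destruct constructive_indefinite_description as [x [Hx Ex]]. exact Ex. Qed.

Lemma flow_cont_s r t s : continuous (fun s => flow s r t) s.
Proof. apply flow_orbit. Qed.

Lemma flow_flow s s' r t : flow s' s (flow s r t) = flow s' r t.
Proof.
apply (orbit_unique (fun z => flow z s (flow s r t)) (fun z => flow z r t) s).
apply flow_orbit. apply flow_orbit. apply flow_start.
Qed.

Lemma flow_der r t s : is_derive (fun s => flow s r t) s (a s (flow s r t)).
Proof.
apply is_derive_Rext with (fun s => t + RInt (fun z => a z (flow z r t)) r s).
{ intros y. assert (H := proj2 (flow_orbit r t) r y). simpl in H. rewrite H at 1.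
  rewrite flow_start. reflexivity. }
apply is_derive_eq with (0 + a s (flow s r t)); [|ring].
apply is_derive_Rplus. apply is_derive_Rconst.
apply (is_derive_RInt_cont (fun z => a z (flow z r t))). intros; cts. apply flow_cont_s.
Qed.

Lemma flow_lipschitz_t s r t t' :
  Rabs (flow s r t - flow s r t') <= (1 + 2 * (W * s0)) * Rabs (t - t').
Proof.
assert (H := orbit_dist _ _ r s (flow_orbit r t) (flow_orbit r t')).
simpl in H. rewrite !flow_start in H. exact H.
Qed.

(** Two orbits are compared on the line where one of them starts: there their
    distance is small, and [flow_lipschitz_t] propagates it to every line. *)
Lemma flow_cont {U : UniformSpace} (f g h : U -> R) (x : U) :
  continuous f x -> continuous g x -> continuous h x ->
  continuous (fun y => flow (f y) (g y) (h y)) x.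
Proof.
intros Hf Hg Hh. assert (Hq := Ws0_range). apply continuous_eps. intros eps He.
assert (H1 := continuous_eps_inv _ x (eps / 2) (continuous_comp f (fun s => flow s (g x) (h x)) x Hf (flow_cont_s _ _ _)) ltac:(lra)).
assert (Hy : continuous (fun y => flow (g y) (g x) (h x)) x).
{ apply (continuous_comp g (fun s => flow s (g x) (h x)) x Hg (flow_cont_s _ _ _)). }
assert (H2 := continuous_eps_inv _ x (eps / 4) (continuous_Rminus _ _ _ Hy Hh) ltac:(lra)).
generalize (filter_and _ _ H1 H2). apply filter_imp. intros y [Y1 Y2].
simpl in Y2. rewrite flow_start in Y2.
replace (flow (f y) (g y) (h y) - flow (f x) (g x) (h x)) with
 ((flow (f y) (g y) (h y) - flow (f y) (g y) (flow (g y) (g x) (h x)))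
  + (flow (f y) (g x) (h x) - flow (f x) (g x) (h x))) by (rewrite flow_flow; ring).
assert (H := flow_lipschitz_t (f y) (g y) (h y) (flow (g y) (g x) (h x))).
assert (Rabs (h y - flow (g y) (g x) (h x)) < eps / 4).
{ rewrite Rabs_minus_sym. replace (flow (g y) (g x) (h x) - h y) with (flow (g y) (g x) (h x) - h y - (h x - h x)) by ring. exact Y2. }
eapply Rle_lt_trans. apply Rabs_triang.
assert ((1 + 2 * (W * s0)) * Rabs (h y - flow (g y) (g x) (h x)) <= 2 * (eps / 4)).
{ apply Rmult_le_compat; try lra. apply Rabs_pos. }
lra.
Qed.

(** The [t]-derivative of the flow, as the solution of the variational equation. *)
Definition flow_t (s r t : R) : R := exp (RInt (fun z => a_t z (flow z r t)) r s).

Lemma flow_t_cont {U : UniformSpace} (f g h : U -> R) (x : U) :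
  continuous f x -> continuous g x -> continuous h x ->
  continuous (fun y => flow_t (f y) (g y) (h y)) x.
Proof.
intros Hf Hg Hh. unfold flow_t.
apply (continuous_comp _ exp).
2:{ apply (is_derive_continuous exp _ (exp (RInt (fun z => a_t z (flow z (g x) (h x))) (g x) (f x)))). apply is_derive_exp. }
apply (continuous_comp_2 (fun y => (f y, g y)) h
  (fun fg h => RInt (fun z => a_t z (flow z (snd fg) h)) (snd fg) (fst fg))).
- apply (continuous_comp_2 f g (fun u v => (u, v))); auto.
  apply continuous_ext with (fun z => z). intros [u v]; reflexivity. apply continuous_id.
- auto.
- apply (continuous_RInt_param (fun s (p : (R * R) * R) => a_t s (flow s (snd (fst p)) (snd p)))
    (fun p => snd (fst p)) (fun p => fst (fst p))).
  + intros s p. apply (continuous_cont2 a_t); auto; cts. apply flow_cont; cts.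
    apply (continuous_comp snd (fun p => snd (fst p))). cts. 
    apply (continuous_comp fst snd); cts. apply (continuous_comp snd snd); cts.
  + apply (continuous_comp fst snd); cts.
  + apply (continuous_comp fst fst); cts.
Qed.

Lemma flow_t_eq s r t : flow_t s r t = 1 + RInt (fun z => a_t z (flow z r t) * flow_t z r t) r s.
Proof.
assert (D : forall z, is_derive (fun z => flow_t z r t) z (a_t z (flow z r t) * flow_t z r t)).
{ intros z. unfold flow_t. 
  apply (is_derive_comp exp (fun z => RInt (fun z0 => a_t z0 (flow z0 r t)) r z) z).
  apply is_derive_exp.
  apply (is_derive_RInt_cont (fun z => a_t z (flow z r t))). intros; cts. apply flow_cont_s. }
assert (E : is_RInt (fun z => a_t z (flow z r t) * flow_t z r t) r s (flow_t s r t - flow_t r r t)).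
{ apply (is_RInt_derive (V := R_CompleteNormedModule) (fun z => flow_t z r t)); intros z _. apply D.
  cts. apply flow_cont_s. apply (is_derive_continuous _ _ _ (D z)). }
apply (is_RInt_unique (V := R_CompleteNormedModule)) in E. 
assert (E1 : flow_t r r t = 1).
{ unfold flow_t. rewrite RInt_point. apply exp_0. }
rewrite E1 in E. 
transitivity (1 + (flow_t s r t - 1)). ring. f_equal. symmetry. exact E.
Qed.

Lemma flow_t_start r t : flow_t r r t = 1.
Proof. unfold flow_t. rewrite RInt_point. apply exp_0. Qed.

Lemma abs_flow_arg s r t : Rabs (RInt (fun z => a_t z (flow z r t)) r s) <= W * s0.
Proof.
apply (abs_RInt_le_weight chi); auto. intros; cts. apply flow_cont_s. intros; apply Ha.
Qed.

Lemma flow_t_bound s r t : 0 <= flow_t s r t <= 1 + 2 * (W * s0).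
Proof.
assert (H := abs_flow_arg s r t). assert (Hq := Ws0_range). unfold flow_t.
set (I := RInt _ _ _) in *. split. left; apply exp_pos.
assert (E : exp I <= / (1 - W * s0)).
{ assert (H1 := exp_ineq1_le (- I)). rewrite exp_Ropp in H1.
  assert (H2 : 1 - W * s0 <= / exp I) by (unfold Rabs in H; destruct Rcase_abs; lra).
  rewrite <- (Rinv_inv (exp I)). apply Rinv_le_contravar; lra. }
eapply Rle_trans. exact E. apply inv_1_minus; auto.
Qed.

(** The error of the linearization solves the variational equation with a
    right-hand side [o(h)], so it is [o(h)] itself by absorption. *)
Lemma flow_der_t s r t : is_derive (fun t => flow s r t) t (flow_t s r t).
Proof.
assert (Hq := Ws0_range). assert (HW0 := weight_pos _ _ HW).
apply is_derive_eps. intros eps He.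
set (e1 := eps / (4 * (Rabs (s - r) + 1))).
assert (Hsr := Rabs_pos (s - r)).
assert (He1 : 0 < e1) by (apply Rdiv_lt_0_compat; lra).
assert (T := tube (fun z y => a_t z (flow z r t + y)) 0 (Rmin r s) (Rmax r s) e1
  ltac:(intros z; apply (continuous_cont2 a_t); auto; cts; apply flow_cont; cts) He1).
destruct T as [d Hd].
assert (Hd2 : 0 < d / 2) by (assert (H := cond_pos d); lra).
exists (mkposreal _ Hd2). intros t' Ht'.
assert (Ht : Rabs (t' - t) < d / 2) by exact Ht'. clear Ht'.
set (h := t' - t) in *.
set (E := fun z => flow z r t' - flow z r t - h * flow_t z r t).
assert (B1 : forall z, Rabs (flow z r t' - flow z r t) <= 2 * Rabs h).
{ intros z. eapply Rle_trans. apply flow_lipschitz_t. fold h.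
  apply Rmult_le_compat_r. apply Rabs_pos. lra. }
assert (Ct : forall z, continuous (fun z => flow_t z r t) z) by (intros; apply flow_t_cont; cts).
assert (Key : forall z, Rmin r s <= z <= Rmax r s -> Rabs (E z) <= 2 * e1 * Rabs (s - r) * Rabs h / (1 - W * s0)).
{ apply (absorb (fun z => Rmin r s <= z <= Rmax r s) (fun z => Rabs (E z)) (4 * Rabs h)).
  - lra.
  - intros z _. unfold E. assert (B := flow_t_bound z r t). assert (Bz := B1 z).
    unfold Rminus at 1. eapply Rle_trans. apply Rabs_triang. rewrite Rabs_Ropp, Rabs_mult.
    rewrite (Rabs_pos_eq (flow_t z r t)) by lra.
    assert (Rabs h * flow_t z r t <= Rabs h * 2). { apply Rmult_le_compat_l. apply Rabs_pos. lra. }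
    lra.
  - intros D HD z Hz.
    assert (EE : E z = RInt (fun y => (a y (flow y r t') - a y (flow y r t) - a_t y (flow y r t) * (flow y r t' - flow y r t)) + a_t y (flow y r t) * E y) r z).
    { unfold E at 1. rewrite flow_t_eq.
      assert (O1 := proj2 (flow_orbit r t') r z). assert (O2 := proj2 (flow_orbit r t) r z). simpl in O1, O2.
      rewrite flow_start in O1, O2. rewrite O1, O2.
      transitivity (RInt (fun y => a y (flow y r t')) r z - RInt (fun y => a y (flow y r t)) r z
         - h * RInt (fun z0 => a_t z0 (flow z0 r t) * flow_t z0 r t) r z). unfold h; ring.
      replace (h * RInt (fun z0 => a_t z0 (flow z0 r t) * flow_t z0 r t) r z) with
        (RInt (fun z0 => h * (a_t z0 (flow z0 r t) * flow_t z0 r t)) r z).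
      2:{ apply (RInt_scal (V := R_CompleteNormedModule)). apply ex_RInt_cont. intros; cts; auto. apply flow_cont_s. }
      rewrite !RInt_minus_cont by (intros; cts; try apply flow_cont_s; auto).
      apply RInt_Rext. intros y. unfold E. simpl. ring. }
    rewrite EE. rewrite <- RInt_plus_cont by (unfold E; intros; cts; try apply flow_cont_s; auto).
    assert (Hzz : Rmin r s <= Rmin r z /\ Rmax r z <= Rmax r s).
    { revert Hz. unfold Rmin, Rmax; repeat destruct Rle_dec; lra. }
    apply abs_plus_le.
    + apply Rle_trans with ((e1 * (2 * Rabs h)) * Rabs (z - r)).
      * apply abs_RInt_le_gen. intros; cts; apply flow_cont_s.
        intros y Hy.
        destruct (MVT_real (fun t => a y t) (fun t => a_t y t) (flow y r t) (flow y r t') (fun t => sp_der _ _ _ _ _ Ha y t)) as [c [Hc1 Hc2]].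
        rewrite Hc2. rewrite <- Rmult_minus_distr_r. apply abs_mult_le; auto.
        assert (Hcd : Rabs (c - flow y r t) < d).
        { apply Rle_lt_trans with (2 * Rabs h); [|lra]. apply Rle_trans with (2 := B1 y).
          revert Hc1. abs_lra. }
        assert (Hb : ball 0 d (c - flow y r t)).
        { unfold ball; simpl; unfold AbsRing_ball, abs, minus, plus, opp; simpl. rewrite Ropp_0, Rplus_0_r. exact Hcd. }
        assert (Hf := Hd _ Hb y ltac:(lra)). simpl in Hf.
        rewrite Rplus_0_r in Hf. replace (flow y r t + (c - flow y r t)) with c in Hf by ring. lra.
      * replace (2 * e1 * Rabs (s - r) * Rabs h) with (e1 * (2 * Rabs h) * Rabs (s - r)) by ring.
        apply Rmult_le_compat_l. apply Rmult_le_pos. lra. assert (H := Rabs_pos h); lra.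
        revert Hz. abs_lra.
    + rewrite Rmult_assoc. 
      assert (HD0 : 0 <= D). { eapply Rle_trans; [apply Rabs_pos | apply (HD z Hz)]. }
      apply (abs_RInt_le_weight chi); auto. unfold E; intros; cts; try apply flow_cont_s; auto.
      apply Rmult_le_pos; auto.
      intros y Hy. rewrite Rabs_mult, <- Rmult_assoc. apply Rmult_le_compat; try apply Rabs_pos. apply Ha.
      apply HD. lra. }
assert (Hs : Rmin r s <= s <= Rmax r s) by (split; [apply Rmin_r | apply Rmax_r]).
apply Key in Hs. unfold E in Hs. eapply Rle_trans. exact Hs.
unfold Rdiv. 
assert (I := inv_1_minus (W * s0) Hq).
apply Rle_trans with (2 * e1 * Rabs (s - r) * Rabs h * 2).
{ assert (Hh := Rabs_pos h). apply Rmult_le_compat_l; [|lra]. apply Rmult_le_pos; auto. apply Rmult_le_pos; auto; lra. }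
replace (2 * e1 * Rabs (s - r) * Rabs h * 2) with ((eps * Rabs h) * (Rabs (s - r) / (Rabs (s - r) + 1))).
2:{ unfold e1. field. lra. }
rewrite <- (Rmult_1_r (eps * Rabs h)) at 2.
apply Rmult_le_compat_l. apply Rmult_le_pos; [lra|apply Rabs_pos].
apply Rmult_le_reg_r with (Rabs (s - r) + 1). lra.
unfold Rdiv. rewrite Rmult_assoc, Rinv_l by lra. lra.
Qed.

End Flow.

(** * The scalar transport problem *)

(** An affine modulus of continuity in [t].  A continuous periodic function has
    one for every [e > 0].  Composition with the flow multiplies it at most by
    the Lipschitz constant of the flow, so the estimates of moduli below are the
    same linear inequalities as those of the functions. *)
Definition modulus (w : R -> R) (e b : R) (f : R -> R -> R) : Prop :=
  forall r t t', Rabs (f r t - f r t') <= w r * (e + b * Rabs (t - t')).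

Lemma modulus_mult w1 w2 B1 B2 e b f g :
  (forall r, 0 <= w1 r) -> (forall r, 0 <= w2 r) -> 0 <= e -> 0 <= b ->
  modulus w1 e b f -> modulus w2 e b g ->
  (forall r t, Rabs (f r t) <= B1 r) -> (forall r t, Rabs (g r t) <= B2 r) ->
  modulus (fun r => w1 r * B2 r + B1 r * w2 r) e b (fun r t => f r t * g r t).
Proof.
intros P1 P2 He Hb Hf Hg Bf Bg r t t'.
replace (f r t * g r t - f r t' * g r t') with
  ((f r t - f r t') * g r t + f r t' * (g r t - g r t')) by ring.
eapply Rle_trans. apply Rabs_triang. rewrite !Rabs_mult.
assert (HO : 0 <= e + b * Rabs (t - t')).
{ assert (0 <= b * Rabs (t - t')) by (apply Rmult_le_pos; auto; apply Rabs_pos). lra. }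
rewrite Rmult_plus_distr_r. apply Rplus_le_compat.
- replace (w1 r * B2 r * (e + b * Rabs (t - t'))) with (w1 r * (e + b * Rabs (t - t')) * B2 r) by ring.
  apply Rmult_le_compat; try apply Rabs_pos; auto.
- rewrite (Rmult_assoc (B1 r)). apply Rmult_le_compat; try apply Rabs_pos; auto.
Qed.

Lemma modulus_plus w1 w2 e b f g :
  modulus w1 e b f -> modulus w2 e b g ->
  modulus (fun r => w1 r + w2 r) e b (fun r t => f r t + g r t).
Proof.
intros Hf Hg r t t'. rewrite Rplus_sub_swap.
eapply Rle_trans. apply Rabs_triang. rewrite Rmult_plus_distr_r.
apply Rplus_le_compat; auto.
Qed.

Lemma modulus_minus w1 w2 e b f g :
  modulus w1 e b f -> modulus w2 e b g ->
  modulus (fun r => w1 r + w2 r) e b (fun r t => f r t - g r t).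
Proof.
intros Hf Hg r t t'.
replace (f r t - g r t - (f r t' - g r t')) with ((f r t - f r t') - (g r t - g r t')) by ring.
unfold Rminus at 1. eapply Rle_trans. apply Rabs_triang. rewrite Rabs_Ropp, Rmult_plus_distr_r.
apply Rplus_le_compat; auto.
Qed.

Lemma modulus_weaken w1 w2 e b f :
  0 <= e -> 0 <= b -> (forall r, w1 r <= w2 r) -> modulus w1 e b f -> modulus w2 e b f.
Proof.
intros He Hb Hw Hf r t t'. eapply Rle_trans. apply Hf. apply Rmult_le_compat_r; auto.
assert (0 <= b * Rabs (t - t')) by (apply Rmult_le_pos; auto; apply Rabs_pos). lra.
Qed.

Lemma modulus_of_derive w e b f ft :
  0 <= e -> 1 <= b -> (forall r, 0 <= w r) ->
  (forall r t, is_derive (fun t => f r t) t (ft r t)) ->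
  (forall r t, Rabs (ft r t) <= w r) -> modulus w e b f.
Proof.
intros He Hb Hw Hd Hf r t t'.
eapply Rle_trans.
apply (lipschitz_of_derive (fun t => f r t) (fun t => ft r t) (w r) t' t); auto.
apply Rmult_le_compat_l; auto. assert (H := Rabs_pos (t - t')). nra.
Qed.

Section Transport.
Context (chi : R -> R) (W Na N s0 : R) (a a_t : R -> R -> R).
Context (HW : weight chi W) (HNa : 0 <= Na) (Hs0 : 0 <= s0) (Ha : speed chi Na s0 a a_t).
Context (Hsmall : W * s0 <= 1 / 2).
Context (m m_t m_r v v_t v_r g g_t : R -> R -> R) (phi phi' : R -> R) (a0 : R).
Context (Hm : C1f m m_t m_r) (Hv : C1f v v_t v_r).
Context (Cg : cont2 g) (Cgt : cont2 g_t) (Dg : forall r t, is_derive (fun t => g r t) t (g_t r t)).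
Context (Dphi : forall t, is_derive phi t (phi' t)) (Cphi' : forall t, continuous phi' t).

Let X := flow chi W Na s0 a a_t HW HNa Hs0 Ha Hsmall.
Let Y := flow_t chi W Na s0 a a_t HW HNa Hs0 Ha Hsmall.

Definition along (f_t f_r : R -> R -> R) (s x : R) : R := f_r s x + a s x * f_t s x.

Definition transport_rhs (s x : R) : R := g s x - m s x * along v_t v_r s x.

(** The representation by characteristics. *)
Definition transport_u (r t : R) : R :=
  phi (X a0 r t) + RInt (fun s => transport_rhs s (X s r t)) a0 r.

Definition transport_src (s x : R) : R :=
  g_t s x - m_t s x * along v_t v_r s x + along m_t m_r s x * v_t s x.

(** The [t]-derivative of [transport_u] after [is_derive_RInt_jacobian]: it
    contains [v] only through [v_t] and through its derivative along orbits. *)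
Definition transport_ut (r t : R) : R :=
  (phi' (X a0 r t) + m a0 (X a0 r t) * v_t a0 (X a0 r t)) * Y a0 r t - m r t * v_t r t
  + RInt (fun s => Y s r t * transport_src s (X s r t)) a0 r.

Definition transport_ur (r t : R) : R := transport_rhs r t - a r t * transport_ut r t.

Let Ca : cont2 a := sp_cont _ _ _ _ _ Ha.
Let Cat : cont2 a_t := sp_cont_t _ _ _ _ _ Ha.
Let Cm : cont2 m := C1f_cont2 _ _ _ Hm.
Let Cmt : cont2 m_t := proj1 (proj2 (proj2 Hm)).
Let Cmr : cont2 m_r := proj2 (proj2 (proj2 Hm)).
Let Cv : cont2 v := C1f_cont2 _ _ _ Hv.
Let Cvt : cont2 v_t := proj1 (proj2 (proj2 Hv)).
Let Cvr : cont2 v_r := proj2 (proj2 (proj2 Hv)).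

Lemma cont2_along f_t f_r : cont2 f_t -> cont2 f_r -> cont2 (along f_t f_r).
Proof. intros H1 H2 r t. unfold along. cts. Qed.

Lemma cont2_rhs : cont2 transport_rhs.
Proof.
assert (H := cont2_along _ _ Cvt Cvr). intros r t. unfold transport_rhs. cts.
Qed.

Lemma cont2_src : cont2 transport_src.
Proof.
assert (H := cont2_along _ _ Cvt Cvr). assert (H' := cont2_along _ _ Cmt Cmr).
intros r t. unfold transport_src. cts.
Qed.

Lemma X_cont {U : UniformSpace} (f h k : U -> R) (x : U) :
  continuous f x -> continuous h x -> continuous k x ->
  continuous (fun y => X (f y) (h y) (k y)) x.
Proof. apply flow_cont. Qed.

Lemma Y_cont {U : UniformSpace} (f h k : U -> R) (x : U) :
  continuous f x -> continuous h x -> continuous k x ->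
  continuous (fun y => Y (f y) (h y) (k y)) x.
Proof. apply flow_t_cont. Qed.

Ltac cts_flow :=
  cts; repeat match goal with
    | |- continuous (fun y => X (@?f y) (@?h y) (@?k y)) _ => apply (X_cont f h k); cts
    | |- continuous (fun y => Y (@?f y) (@?h y) (@?k y)) _ => apply (Y_cont f h k); cts
    end.

Lemma X_der_t s r t : is_derive (fun t => X s r t) t (Y s r t).
Proof. apply flow_der_t. Qed.

Lemma C1f_along_flow f f_t f_r r : C1f f f_t f_r ->
  C1f (fun s t => f s (X s r t)) (fun s t => f_t s (X s r t) * Y s r t)
      (fun s t => along f_t f_r s (X s r t)).
Proof.
intros Hf. assert (Cf := C1f_cont2 _ _ _ Hf).
assert (Cft := proj1 (proj2 (proj2 Hf))). assert (Cfr := proj2 (proj2 (proj2 Hf))).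
assert (CC := cont2_along _ _ Cft Cfr).
refine (conj _ (conj _ (conj _ _))).
- intros s t.
  apply is_derive_eq with (Y s r t * f_t s (X s r t)); [|ring].
  apply (is_derive_comp (fun x => f s x) (fun t => X s r t)). apply Hf. apply X_der_t.
- intros s t. apply (C1f_chain f f_t f_r (fun s => X s r t) s (a s (X s r t))); auto.
  apply flow_der.
- intros s t. cts_flow.
- intros s t. cts_flow.
Qed.

Lemma transport_der_t r t : is_derive (fun t => transport_u r t) t (transport_ut r t).
Proof.
assert (Cvv := cont2_along _ _ Cvt Cvr). assert (Cmm := cont2_along _ _ Cmt Cmr).
assert (Cg1 : forall t z, continuous (fun s => g s (X s r t)) z) by (intros; cts_flow).
assert (Cm1 : forall t z, continuous (fun s => m s (X s r t) * along v_t v_r s (X s r t)) z)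
  by (intros; cts_flow).
apply is_derive_Rext with (fun t => phi (X a0 r t) + (RInt (fun s => g s (X s r t)) a0 r
   - RInt (fun s => m s (X s r t) * along v_t v_r s (X s r t)) a0 r)).
{ intros y. unfold transport_u. rewrite RInt_minus_cont by auto. reflexivity. }
assert (D1 : is_derive (fun t => phi (X a0 r t)) t (Y a0 r t * phi' (X a0 r t))).
{ apply (is_derive_comp phi (fun t => X a0 r t)). apply Dphi. apply X_der_t. }
assert (D2 : is_derive (fun t => RInt (fun s => g s (X s r t)) a0 r) t
   (RInt (fun s => Y s r t * g_t s (X s r t)) a0 r)).
{ apply (is_derive_RInt_under (fun s t => g s (X s r t)) (fun s t => Y s r t * g_t s (X s r t))).
  - intros s y. apply (is_derive_comp (fun x => g s x) (fun t => X s r t)). apply Dg. apply X_der_t.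
  - auto.
  - intros s y. cts_flow. }
assert (D3 := is_derive_RInt_jacobian _ _ _ _ _ _ a0 r t (C1f_along_flow _ _ _ r Hm) (C1f_along_flow _ _ _ r Hv)).
apply is_derive_eq with (1 := is_derive_Rplus _ _ _ _ _ D1 (is_derive_Rminus _ _ _ _ _ D2 D3)).
unfold transport_ut, transport_src. cbv beta.
assert (Xr : X r r t = t) by apply flow_start. assert (Yr : Y r r t = 1) by apply flow_t_start.
rewrite Xr, Yr.
rewrite (RInt_Rext (fun s => Y s r t * (g_t s (X s r t) - m_t s (X s r t) * along v_t v_r s (X s r t)
    + along m_t m_r s (X s r t) * v_t s (X s r t)))
  (fun s => Y s r t * g_t s (X s r t) -
     (m_t s (X s r t) * Y s r t * along v_t v_r s (X s r t) -
      along m_t m_r s (X s r t) * (v_t s (X s r t) * Y s r t)))) by (intros; ring).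
rewrite <- (RInt_minus_cont (fun s => Y s r t * g_t s (X s r t))).
2,3: intros z; cts_flow.
rewrite <- RInt_minus_cont.
2,3: intros z; cts_flow.
ring.
Qed.

Lemma transport_cont_ut : cont2 transport_ut.
Proof.
intros r t. unfold transport_ut. assert (Cs := cont2_src).
cts_flow.
apply (continuous_RInt_param (fun s (p : R * R) => Y s (fst p) (snd p) * transport_src s (X s (fst p) (snd p)))
  (fun _ => a0) (fun p => fst p)); cts.
intros s p. 
assert (Q1 : continuous (fun z : R * (R * R) => fst (snd z)) (s, p)) by (apply (continuous_comp snd fst); cts).
assert (Q2 : continuous (fun z : R * (R * R) => snd (snd z)) (s, p)) by (apply (continuous_comp snd snd); cts).
apply (continuous_Rmult (fun z : R * (R * R) => Y (fst z) (fst (snd z)) (snd (snd z)))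
  (fun z => transport_src (fst z) (X (fst z) (fst (snd z)) (snd (snd z))))).
apply Y_cont; cts. apply (continuous_cont2 transport_src); [exact Cs| |]; cts_flow.
Qed.

(** Along an orbit the solution is an integral with a moving endpoint; the
    [r]-derivative at a fixed time is what remains after subtracting the effect
    of the motion of the orbit. *)
Lemma transport_der_r r t : is_derive (fun r => transport_u r t) r (transport_ur r t).
Proof.
assert (Xr : X r r t = t) by apply flow_start.
assert (Cr := cont2_rhs).
assert (D1 : is_derive (fun s => transport_u s (X s r t)) r (transport_rhs r t)).
{ apply is_derive_Rext with (fun s => phi (X a0 r t) + RInt (fun z => transport_rhs z (X z r t)) a0 s).
  - intros s. unfold transport_u. 
    assert (E : forall z, X z s (X s r t) = X z r t) by (intros; apply flow_flow).
    rewrite E. f_equal. apply RInt_Rext. intros z. rewrite E. reflexivity.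
  - apply is_derive_eq with (0 + transport_rhs r (X r r t)); [|rewrite Xr; ring].
    apply is_derive_Rplus. apply is_derive_Rconst.
    apply (is_derive_RInt_cont (fun z => transport_rhs z (X z r t))). intros; cts_flow. }
assert (D2 := is_derive_shift transport_u transport_ut (fun s => X s r t) r (a r (X r r t))
  transport_der_t transport_cont_ut (flow_der _ _ _ _ _ _ _ _ _ _ _ _ _ _)).
apply is_derive_eq with (transport_rhs r t - transport_ut r (X r r t) * a r (X r r t)).
2:{ rewrite Xr. unfold transport_ur. ring. }
apply is_derive_Rext with (2 := is_derive_Rminus _ _ _ _ _ D1 D2).
intros y. rewrite Xr. ring.
Qed.

Lemma transport_C1 : C1f transport_u transport_ut transport_ur.
Proof.
assert (C1 := transport_cont_ut). assert (C2 := cont2_rhs).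
refine (conj _ (conj _ (conj _ _))). apply transport_der_t. apply transport_der_r. apply C1.
intros r t. unfold transport_ur. cts.
Qed.

Lemma transport_trace t : transport_u a0 t = phi t.
Proof.
unfold transport_u. assert (E : X a0 a0 t = t) by apply flow_start.
rewrite E, RInt_point. unfold zero; simpl. ring.
Qed.

Lemma transport_pde r t :
  transport_ur r t + a r t * transport_ut r t + m r t * (v_r r t + a r t * v_t r t) = g r t.
Proof. unfold transport_ur, transport_rhs, along. ring. Qed.

(** ** Estimates *)

(* [be] bounds the initial values and [W de] the effect of the source; [x]
   dominates every product of the small number [s0] with 1, [W], [N], [W N] *)
Context (be de : R) (Hbe : 0 <= be <= 1) (Hde : 0 <= de) (HWde : W * de <= 1) (HNN : Na + de + 1 <= N).
Context (x : R) (Hx1 : s0 <= x) (Hx2 : W * s0 <= x) (Hx3 : N * s0 <= x) (Hx4 : W * (N * s0) <= x).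
Context (Hclose : be + W * de + 100 * x <= 1).
Context (Bphi : forall t, Rabs (phi t) <= be) (Bphi' : forall t, Rabs (phi' t) <= be).
Context (Bg : forall r t, Rabs (g r t) <= chi r * de) (Bgt : forall r t, Rabs (g_t r t) <= chi r * de).
Context (Bm : forall r t, Rabs (m r t) <= s0) (Bmt : forall r t, Rabs (m_t r t) <= s0).
Context (Bmm : forall r t, Rabs (along m_t m_r r t) <= chi r * s0).
Context (Bvt : forall r t, Rabs (v_t r t) <= 1).
Context (Bvv : forall r t, Rabs (along v_t v_r r t) <= chi r * (2 * N)).

Let HN : 0 <= N. Proof. lra. Qed.
Let HW0 : 0 <= W. Proof. apply (weight_pos chi); auto. Qed.
Let chi0 : forall r, 0 <= chi r. Proof. apply HW. Qed.
Let Wde0 : 0 <= W * de. Proof. apply Rmult_le_pos; auto. Qed.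
Let x0 : 0 <= x. Proof. lra. Qed.
Let Ns0 : 0 <= N * s0. Proof. apply Rmult_le_pos; auto. Qed.

Lemma transport_rhs_bound r t : Rabs (transport_rhs r t) <= chi r * (de + 2 * (N * s0)).
Proof.
unfold transport_rhs, Rminus. eapply Rle_trans. apply Rabs_triang. rewrite Rabs_Ropp, Rabs_mult.
assert (Rabs (m r t) * Rabs (along v_t v_r r t) <= s0 * (chi r * (2 * N))).
{ apply Rmult_le_compat; auto; apply Rabs_pos. }
assert (H2 := Bg r t). lra.
Qed.

Lemma transport_src_bound r t : Rabs (transport_src r t) <= chi r * (de + 2 * (N * s0) + s0).
Proof.
unfold transport_src, Rminus. eapply Rle_trans. apply Rabs_triang.
eapply Rle_trans. apply Rplus_le_compat_r, Rabs_triang. rewrite Rabs_Ropp, !Rabs_mult.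
assert (Rabs (m_t r t) * Rabs (along v_t v_r r t) <= s0 * (chi r * (2 * N))).
{ apply Rmult_le_compat; auto; apply Rabs_pos. }
assert (Rabs (along m_t m_r r t) * Rabs (v_t r t) <= chi r * s0 * 1).
{ apply Rmult_le_compat; auto; apply Rabs_pos. }
assert (H2 := Bgt r t). lra.
Qed.

Lemma transport_bound r t : Rabs (transport_u r t) <= 1.
Proof.
unfold transport_u. eapply Rle_trans. apply Rabs_triang.
assert (H : Rabs (RInt (fun s => transport_rhs s (X s r t)) a0 r) <= W * (de + 2 * (N * s0))).
{ assert (Cr := cont2_rhs). apply (abs_RInt_le_weight chi); auto; try lra.
  intros; cts_flow. intros; apply transport_rhs_bound. }
assert (H1 := Bphi (X a0 r t)). lra.
Qed.

Lemma Y_bound s r t : 0 <= Y s r t <= 1 + 2 * x.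
Proof.
assert (H := flow_t_bound chi W Na s0 a a_t HW HNa Hs0 Ha Hsmall s r t). fold Y in H. lra.
Qed.

Lemma transport_ut_bound r t : Rabs (transport_ut r t) <= 1.
Proof.
unfold transport_ut. assert (HY := Y_bound a0 r t).
assert (H : Rabs (RInt (fun s => Y s r t * transport_src s (X s r t)) a0 r) <= W * ((1 + 2 * x) * (de + 2 * (N * s0) + s0))).
{ assert (Cr := cont2_src). apply (abs_RInt_le_weight chi); auto.
  intros; cts_flow.
  apply Rmult_le_pos; lra.
  intros s _. rewrite Rabs_mult.
  replace (chi s * ((1 + 2 * x) * (de + 2 * (N * s0) + s0))) with ((1 + 2 * x) * (chi s * (de + 2 * (N * s0) + s0))) by ring.
  apply Rmult_le_compat; try apply Rabs_pos. assert (HY' := Y_bound s r t). rewrite Rabs_pos_eq; lra.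
  apply transport_src_bound. }
assert (H1 : Rabs ((phi' (X a0 r t) + m a0 (X a0 r t) * v_t a0 (X a0 r t)) * Y a0 r t) <= (be + s0) * (1 + 2 * x)).
{ apply abs_mult_le.
  - apply abs_plus_le; auto.
    rewrite <- (Rmult_1_r s0). apply abs_mult_le; auto.
  - rewrite Rabs_pos_eq; lra. }
assert (H2 : Rabs (m r t * v_t r t) <= s0).
{ rewrite <- (Rmult_1_r s0). apply abs_mult_le; auto. }
eapply Rle_trans. apply Rabs_triang. unfold Rminus.
eapply Rle_trans. apply Rplus_le_compat_r, Rabs_triang. rewrite Rabs_Ropp.
assert (E : W * ((1 + 2 * x) * (de + 2 * (N * s0) + s0)) = (1 + 2 * x) * (W * de + 2 * (W * (N * s0)) + W * s0)) by ring.
rewrite E in H.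
assert ((1 + 2 * x) * (W * de + 2 * (W * (N * s0)) + W * s0) <= (1 + 2 * x) * (W * de + 3 * x)).
{ apply Rmult_le_compat_l; lra. }
assert ((be + s0) * (1 + 2 * x) <= (be + x) * (1 + 2 * x)).
{ apply Rmult_le_compat_r; lra. }
nra.
Qed.

Lemma transport_ur_bound r t : Rabs (transport_ur r t) <= chi r * N.
Proof.
unfold transport_ur, Rminus. eapply Rle_trans. apply Rabs_triang. rewrite Rabs_Ropp, Rabs_mult.
assert (Rabs (a r t) * Rabs (transport_ut r t) <= chi r * Na * 1).
{ apply Rmult_le_compat; try apply Rabs_pos. apply Ha. apply transport_ut_bound. }
assert (H2 := transport_rhs_bound r t).
assert (chi r * (de + 2 * (N * s0) + Na) <= chi r * N) by (apply Rmult_le_compat_l; auto; lra).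
lra.
Qed.

Context (e b : R) (He : 0 <= e) (Hb : 1 <= b).
Context (Mat : modulus (fun r => chi r * s0) e b a_t).
Context (Mmt : modulus (fun _ => s0) e b m_t).
Context (Mmm : modulus (fun r => chi r * s0) e b (along m_t m_r)).
Context (Mgt : modulus (fun r => chi r * (de + s0)) e b g_t).
Context (Mvt : modulus (fun _ => 1) e b v_t).
Context (Mvv : modulus (fun r => chi r * (3 * N)) e b (along v_t v_r)).
Context (Mphi' : forall t t', Rabs (phi' t - phi' t') <= be * (e + b * Rabs (t - t'))).

Let b0 : 0 <= b. Proof. lra. Qed.

Let chis0 : forall r, 0 <= chi r * s0. Proof. intros; apply Rmult_le_pos; auto. Qed.

Lemma modulus_m : modulus (fun _ => s0) e b m.
Proof. apply (modulus_of_derive _ e b m m_t); auto. apply Hm. Qed.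

Lemma modulus_src : modulus (fun r => chi r * (de + 5 * (N * s0) + 3 * s0)) e b transport_src.
Proof.
assert (K1 : forall r, 0 <= chi r * (3 * N)) by (intros; apply Rmult_le_pos; auto; lra).
assert (M1 := modulus_mult (fun _ => s0) (fun r => chi r * (3 * N)) (fun _ => s0) (fun r => chi r * (2 * N)) e b _ _ ltac:(auto) ltac:(auto) He b0 Mmt Mvv Bmt Bvv).
assert (M2 := modulus_mult (fun r => chi r * s0) (fun _ => 1) (fun r => chi r * s0) (fun _ => 1) e b _ _ ltac:(auto) ltac:(intros; lra) He b0 Mmm Mvt Bmm Bvt).
assert (M := modulus_plus _ _ e b _ _ (modulus_minus _ _ e b _ _ Mgt M1) M2).
apply (modulus_weaken _ _ e b _ He b0) with (2 := M).
intros r. simpl. assert (H := chi0 r). right. ring.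
Qed.

Let om (t t' : R) := e + b * Rabs (t - t').

Lemma om_pos t t' : 0 <= om t t'.
Proof.
unfold om. assert (0 <= b * Rabs (t - t')) by (apply Rmult_le_pos; auto; apply Rabs_pos). lra.
Qed.

Lemma om_flow s r t t' : om (X s r t) (X s r t') <= (1 + 2 * x) * om t t'.
Proof.
unfold om. assert (H := flow_lipschitz_t chi W Na s0 a a_t HW HNa Hs0 Ha Hsmall s r t t'). fold X in H.
assert (H1 := Rabs_pos (t - t')).
assert ((1 + 2 * (W * s0)) * Rabs (t - t') <= (1 + 2 * x) * Rabs (t - t')) by (apply Rmult_le_compat_r; lra).
assert (b * Rabs (X s r t - X s r t') <= b * ((1 + 2 * x) * Rabs (t - t'))) by (apply Rmult_le_compat_l; lra).
assert (0 <= x * e) by (apply Rmult_le_pos; auto). lra.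
Qed.

Lemma modulus_flow w f s r t t' : 0 <= w s -> modulus w e b f ->
  Rabs (f s (X s r t) - f s (X s r t')) <= w s * ((1 + 2 * x) * om t t').
Proof.
intros Hw Hf. eapply Rle_trans. apply Hf. apply Rmult_le_compat_l; auto. apply om_flow.
Qed.

Lemma Y_modulus s r t t' : Rabs (Y s r t - Y s r t') <= 4 * x * om t t'.
Proof.
assert (HYt := Y_bound s r t). assert (HYt' := Y_bound s r t'). assert (HO := om_pos t t').
unfold Y, flow_t in HYt, HYt' |- *. fold X in HYt, HYt' |- *.
set (I := RInt (fun z => a_t z (X z r t)) r s) in *.
set (I' := RInt (fun z => a_t z (X z r t')) r s) in *.
assert (HI : Rabs (I - I') <= W * (s0 * ((1 + 2 * x) * om t t'))).
{ unfold I, I'. rewrite RInt_minus_cont by (intros; cts_flow).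
  apply (abs_RInt_le_weight chi); auto. intros; cts_flow.
  apply Rmult_le_pos; auto. apply Rmult_le_pos; lra.
  intros z _. rewrite <- Rmult_assoc. apply (modulus_flow (fun r => chi r * s0)); auto. }
destruct (MVT_real exp exp I' I is_derive_exp) as [c [Hc1 Hc2]].
rewrite Hc2, Rabs_mult.
assert (Hec : exp c <= 1 + 2 * x).
{ assert (Hm' : c <= Rmax I' I) by lra. unfold Rmax in Hm'. destruct Rle_dec.
  - assert (exp c <= exp I) by (destruct Hm' as [Hl| ->]; [left; apply exp_increasing; auto | right; auto]). lra.
  - assert (exp c <= exp I') by (destruct Hm' as [Hl| ->]; [left; apply exp_increasing; auto | right; auto]). lra. }
rewrite (Rabs_pos_eq (exp c)) by (left; apply exp_pos).
apply Rle_trans with ((1 + 2 * x) * (W * (s0 * ((1 + 2 * x) * om t t')))).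
{ apply Rmult_le_compat; auto. left; apply exp_pos. apply Rabs_pos. }
replace ((1 + 2 * x) * (W * (s0 * ((1 + 2 * x) * om t t')))) with ((W * s0) * ((1 + 2 * x) * (1 + 2 * x)) * om t t') by ring.
apply Rmult_le_compat_r; auto. rewrite (Rmult_comm 4).
apply Rmult_le_compat; auto. apply Rmult_le_pos; auto. nra. nra.
Qed.

(** Every term of [transport_ut] is a product of bounded factors with known
    moduli, and the flow distorts these by [1 + 2 x] at most; the total factor
    is [be + W de + O(x)], which [Hclose] keeps below 1. *)
Lemma transport_ut_modulus : modulus (fun _ => 1) e b transport_ut.
Proof.
intros r t t'. rewrite Rmult_1_l. fold (om t t').
assert (HO := om_pos t t'). set (O := om t t') in *.
assert (HWW : W * s0 = W * s0) by reflexivity.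
assert (T1 : Rabs (phi' (X a0 r t) * Y a0 r t - phi' (X a0 r t') * Y a0 r t') <= (be * (1 + 5 * x) + 4 * x) * O).
{ replace (phi' (X a0 r t) * Y a0 r t - phi' (X a0 r t') * Y a0 r t') with
   ((phi' (X a0 r t) - phi' (X a0 r t')) * Y a0 r t + phi' (X a0 r t') * (Y a0 r t - Y a0 r t')) by ring.
  eapply Rle_trans. apply Rabs_triang. rewrite !Rabs_mult.
  assert (A1 : Rabs (phi' (X a0 r t) - phi' (X a0 r t')) <= be * ((1 + 2 * x) * O)).
  { eapply Rle_trans. apply Mphi'. apply Rmult_le_compat_l; try lra. apply om_flow. }
  assert (A2 := Y_modulus a0 r t t'). fold O in A2. assert (A3 := Y_bound a0 r t).
  assert (Rabs (phi' (X a0 r t) - phi' (X a0 r t')) * Rabs (Y a0 r t) <= be * ((1 + 2 * x) * O) * (1 + 2 * x)).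
  { apply Rmult_le_compat; auto; try apply Rabs_pos. rewrite Rabs_pos_eq; lra. }
  assert (Rabs (phi' (X a0 r t')) * Rabs (Y a0 r t - Y a0 r t') <= be * (4 * x * O)).
  { apply Rmult_le_compat; auto; apply Rabs_pos. }
  assert (be * O * ((1 + 2 * x) * (1 + 2 * x)) <= be * O * (1 + 5 * x)).
  { apply Rmult_le_compat_l. apply Rmult_le_pos; lra. nra. }
  assert (be * (4 * x * O) <= 1 * (4 * x * O)). { apply Rmult_le_compat_r. apply Rmult_le_pos; lra. lra. }
  lra. }
assert (Q : modulus (fun _ => s0 * 1 + s0 * 1) e b (fun r t => m r t * v_t r t)).
{ apply (modulus_mult (fun _ => s0) (fun _ => 1) (fun _ => s0) (fun _ => 1)); auto; try (intros; lra). apply modulus_m. }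
assert (Bmv : forall r t, Rabs (m r t * v_t r t) <= s0).
{ intros. rewrite <- (Rmult_1_r s0). apply abs_mult_le; auto. }
assert (T2 : Rabs (m a0 (X a0 r t) * v_t a0 (X a0 r t) * Y a0 r t - m a0 (X a0 r t') * v_t a0 (X a0 r t') * Y a0 r t') <= 8 * x * O).
{ replace (m a0 (X a0 r t) * v_t a0 (X a0 r t) * Y a0 r t - m a0 (X a0 r t') * v_t a0 (X a0 r t') * Y a0 r t') with
   ((m a0 (X a0 r t) * v_t a0 (X a0 r t) - m a0 (X a0 r t') * v_t a0 (X a0 r t')) * Y a0 r t
     + m a0 (X a0 r t') * v_t a0 (X a0 r t') * (Y a0 r t - Y a0 r t')) by ring.
  eapply Rle_trans. apply Rabs_triang. rewrite (Rabs_mult (_ - _)), (Rabs_mult (m a0 (X a0 r t') * v_t a0 (X a0 r t'))).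
  assert (A1 := modulus_flow (fun _ => s0 * 1 + s0 * 1) (fun r t => m r t * v_t r t) a0 r t t' ltac:(simpl; lra) Q). fold O in A1. simpl in A1.
  assert (A2 := Y_modulus a0 r t t'). fold O in A2. assert (A3 := Y_bound a0 r t).
  assert (A4 : Rabs (m a0 (X a0 r t) * v_t a0 (X a0 r t) - m a0 (X a0 r t') * v_t a0 (X a0 r t')) * Rabs (Y a0 r t)
    <= (s0 * 1 + s0 * 1) * ((1 + 2 * x) * O) * (1 + 2 * x)).
  { apply Rmult_le_compat; auto; try apply Rabs_pos. rewrite Rabs_pos_eq; lra. }
  assert (A5 : Rabs (m a0 (X a0 r t') * v_t a0 (X a0 r t')) * Rabs (Y a0 r t - Y a0 r t') <= s0 * (4 * x * O)).
  { apply Rmult_le_compat; auto; try apply Rabs_pos. }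
  assert (A6 : s0 * O * (2 * ((1 + 2 * x) * (1 + 2 * x)) + 4 * x) <= x * O * 8).
  { apply Rmult_le_compat. apply Rmult_le_pos; auto. nra. apply Rmult_le_compat_r; auto. nra. }
  lra. }
assert (T3 := Q r t t'). fold (om t t') in T3. fold O in T3.
assert (Cs := cont2_src).
assert (T4 : Rabs (RInt (fun s => Y s r t * transport_src s (X s r t)) a0 r - RInt (fun s => Y s r t' * transport_src s (X s r t')) a0 r)
   <= W * ((4 * x * (de + 2 * (N * s0) + s0) + (1 + 2 * x) * ((de + 5 * (N * s0) + 3 * s0) * (1 + 2 * x))) * O)).
{ rewrite RInt_minus_cont by (intros; cts_flow).
  apply (abs_RInt_le_weight chi); auto. 
  intros; cts_flow.
  { apply Rmult_le_pos; auto. apply Rplus_le_le_0_compat; repeat apply Rmult_le_pos; lra. }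
  intros s _.
  replace (Y s r t * transport_src s (X s r t) - Y s r t' * transport_src s (X s r t')) with
   ((Y s r t - Y s r t') * transport_src s (X s r t) + Y s r t' * (transport_src s (X s r t) - transport_src s (X s r t'))) by ring.
  eapply Rle_trans. apply Rabs_triang. rewrite !Rabs_mult.
  assert (A0 := chi0 s).
  assert (K : 0 <= chi s * (de + 5 * (N * s0) + 3 * s0)) by (apply Rmult_le_pos; lra).
  assert (A1 := modulus_flow (fun r => chi r * (de + 5 * (N * s0) + 3 * s0)) transport_src s r t t' K modulus_src). fold O in A1. simpl in A1.
  assert (A2 := Y_modulus s r t t'). fold O in A2. assert (A3 := Y_bound s r t').
  assert (A4 := transport_src_bound s (X s r t)).
  assert (Rabs (Y s r t - Y s r t') * Rabs (transport_src s (X s r t)) <= 4 * x * O * (chi s * (de + 2 * (N * s0) + s0))).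
  { apply Rmult_le_compat; auto; apply Rabs_pos. }
  assert (Rabs (Y s r t') * Rabs (transport_src s (X s r t) - transport_src s (X s r t'))
     <= (1 + 2 * x) * (chi s * (de + 5 * (N * s0) + 3 * s0) * ((1 + 2 * x) * O))).
  { apply Rmult_le_compat; auto; try apply Rabs_pos. rewrite Rabs_pos_eq; lra. }
  lra. }
assert (T4' : W * ((4 * x * (de + 2 * (N * s0) + s0) + (1 + 2 * x) * ((de + 5 * (N * s0) + 3 * s0) * (1 + 2 * x))) * O)
   <= (W * de + 30 * x) * O).
{ rewrite <- Rmult_assoc. apply Rmult_le_compat_r; auto.
  replace (W * (4 * x * (de + 2 * (N * s0) + s0) + (1 + 2 * x) * ((de + 5 * (N * s0) + 3 * s0) * (1 + 2 * x))))
   with (4 * x * (W * de + 2 * (W * (N * s0)) + W * s0) + (1 + 2 * x) * (1 + 2 * x) * (W * de + 5 * (W * (N * s0)) + 3 * (W * s0))) by ring.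
  apply Rle_trans with (4 * x * (W * de + 3 * x) + (1 + 5 * x) * (W * de + 8 * x)).
  - apply Rplus_le_compat.
    + apply Rmult_le_compat_l; lra.
    + assert (0 <= W * (N * s0)) by (apply Rmult_le_pos; auto).
      assert (0 <= W * s0) by (apply Rmult_le_pos; auto).
      apply Rmult_le_compat; try nra.
  - nra. }
unfold transport_ut.
set (I1 := RInt (fun s => Y s r t * _) a0 r) in *. set (I2 := RInt (fun s => Y s r t' * _) a0 r) in *.
match goal with |- Rabs ?z <= _ => replace z with
  ((phi' (X a0 r t) * Y a0 r t - phi' (X a0 r t') * Y a0 r t')
   + (m a0 (X a0 r t) * v_t a0 (X a0 r t) * Y a0 r t - m a0 (X a0 r t') * v_t a0 (X a0 r t') * Y a0 r t')
   + - (m r t * v_t r t - m r t' * v_t r t') + (I1 - I2)) by ring end.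
eapply Rle_trans. apply Rabs_triang.
eapply Rle_trans. apply Rplus_le_compat_r, Rabs_triang.
eapply Rle_trans. apply Rplus_le_compat_r, Rplus_le_compat_r, Rabs_triang.
rewrite Rabs_Ropp.
assert (s0 * O <= x * O) by (apply Rmult_le_compat_r; auto).
assert ((be * (1 + 5 * x) + 4 * x + 8 * x + 2 * x + (W * de + 30 * x)) * O <= 1 * O).
{ apply Rmult_le_compat_r; auto. nra. }
lra.
Qed.

Lemma transport_ur_modulus : modulus (fun r => chi r * N) e b transport_ur.
Proof.
assert (K1 : forall r, 0 <= chi r * (3 * N)) by (intros; apply Rmult_le_pos; auto; lra).
assert (M0 : modulus (fun r => chi r * de) e b g).
{ apply (modulus_of_derive _ e b g g_t); auto. intros; apply Rmult_le_pos; auto. }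
assert (M1 := modulus_mult (fun _ => s0) (fun r => chi r * (3 * N)) (fun _ => s0) (fun r => chi r * (2 * N)) e b _ _ ltac:(auto) ltac:(auto) He b0 modulus_m Mvv Bm Bvv).
assert (Ma : modulus (fun r => chi r * s0) e b a).
{ apply (modulus_of_derive _ e b a a_t); auto; apply Ha. }
assert (M2 := modulus_mult (fun r => chi r * s0) (fun _ => 1) (fun r => chi r * Na) (fun _ => 1) e b _ _ ltac:(auto) ltac:(intros; lra) He b0 Ma transport_ut_modulus
   (sp_bound _ _ _ _ _ Ha) transport_ut_bound).
assert (M := modulus_minus _ _ e b _ _ (modulus_minus _ _ e b _ _ M0 M1) M2).
apply (modulus_weaken _ _ e b _ He b0) with (2 := M).
intros r. simpl. assert (H := chi0 r).
assert (chi r * (de + 5 * (N * s0) + s0 + Na) <= chi r * N) by (apply Rmult_le_compat_l; auto; lra).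
lra.
Qed.

End Transport.

(** The solution of the transport problem
    [u_r + a u_t + m (v_r + a v_t) = g], [u = phi] at [a0], with its estimates.
    Although [v_t] enters the source, no derivative is lost: the source is
    [m] times the derivative of [v] along the orbits.  The pairs [mods] are
    those for which the data have the affine modulus [(e, b)]; the conclusion
    returns the same pairs, so the statement can be iterated. *)
Lemma transport_solution chi W Na N s0 x de be a a_t m m_t m_r v v_t v_r g g_t phi phi' a0
    (mods : R -> R -> Prop) :
  weight chi W -> 0 <= Na -> 0 <= s0 -> speed chi Na s0 a a_t ->
  C1f m m_t m_r -> C1f v v_t v_r -> cont2 g -> cont2 g_t ->
  (forall r t, is_derive (fun t => g r t) t (g_t r t)) ->
  (forall t, is_derive phi t (phi' t)) -> (forall t, continuous phi' t) ->
  0 <= be <= 1 -> 0 <= de -> Na + de + 1 <= N ->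
  s0 <= x -> W * s0 <= x -> N * s0 <= x -> W * (N * s0) <= x ->
  be + W * de + 100 * x <= 1 ->
  (forall t, Rabs (phi t) <= be) -> (forall t, Rabs (phi' t) <= be) ->
  (forall r t, Rabs (g r t) <= chi r * de) -> (forall r t, Rabs (g_t r t) <= chi r * de) ->
  (forall r t, Rabs (m r t) <= s0) -> (forall r t, Rabs (m_t r t) <= s0) ->
  (forall r t, Rabs (along a m_t m_r r t) <= chi r * s0) ->
  (forall r t, Rabs (v_t r t) <= 1) ->
  (forall r t, Rabs (along a v_t v_r r t) <= chi r * (2 * N)) ->
  (forall e b, mods e b -> 0 <= e /\ 1 <= b /\
     modulus (fun r => chi r * s0) e b a_t /\ modulus (fun _ => s0) e b m_t /\
     modulus (fun r => chi r * s0) e b (along a m_t m_r) /\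
     modulus (fun r => chi r * (de + s0)) e b g_t /\ modulus (fun _ => 1) e b v_t /\
     modulus (fun r => chi r * (3 * N)) e b (along a v_t v_r) /\
     forall t t', Rabs (phi' t - phi' t') <= be * (e + b * Rabs (t - t'))) ->
  exists u u_t u_r, C1f u u_t u_r /\
    (forall r t, Rabs (u r t) <= 1) /\ (forall r t, Rabs (u_t r t) <= 1) /\
    (forall r t, Rabs (u_r r t) <= chi r * N) /\
    (forall e b, mods e b -> modulus (fun _ => 1) e b u_t /\ modulus (fun r => chi r * N) e b u_r) /\
    (forall r t, u_r r t + a r t * u_t r t + m r t * (v_r r t + a r t * v_t r t) = g r t) /\
    (forall t, u a0 t = phi t).
Proof.
intros HW HNa Hs0 Ha Hm Hv Cg Cgt Dg Dphi Cphi' Hbe Hde HNN Hx1 Hx2 Hx3 Hx4 Hclose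
  Bphi Bphi' Bg Bgt Bm Bmt Bmm Bvt Bvv HM.
assert (HW0 := weight_pos _ _ HW).
assert (HWd : 0 <= W * de) by (apply Rmult_le_pos; auto).
assert (HWde : W * de <= 1) by lra.
assert (Hsmall : W * s0 <= 1 / 2) by lra.
exists (transport_u chi W Na s0 a a_t HW HNa Hs0 Ha Hsmall m v_t v_r g phi a0).
exists (transport_ut chi W Na s0 a a_t HW HNa Hs0 Ha Hsmall m m_t m_r v_t v_r g_t phi' a0).
exists (transport_ur chi W Na s0 a a_t HW HNa Hs0 Ha Hsmall m m_t m_r v_t v_r g g_t phi' a0).
refine (conj _ (conj _ (conj _ (conj _ (conj _ (conj _ _)))))).
- eapply transport_C1; eauto.
- intros r t. eapply transport_bound with (be := be) (de := de) (x := x) (N := N); eauto.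
- intros r t. eapply transport_ut_bound with (be := be) (de := de) (x := x) (N := N); eauto.
- intros r t. eapply transport_ur_bound with (be := be) (de := de) (x := x) (N := N); eauto.
- intros e b Heb. destruct (HM e b Heb) as [He [Hb [M1 [M2 [M3 [M4 [M5 [M6 M7]]]]]]]]. split.
  + eapply transport_ut_modulus with (be := be) (de := de) (x := x) (N := N); eauto.
  + eapply transport_ur_modulus with (be := be) (de := de) (x := x) (N := N); eauto.
- intros r t. apply transport_pde.
- intros t. apply transport_trace; auto.
Qed.

(** Integrating along the orbits: the maximum principle for transport. *)
Lemma transport_max chi W Na s0 a a_t z z_t z_r a0 A B :
  weight chi W -> 0 <= Na -> 0 <= s0 -> speed chi Na s0 a a_t -> W * s0 <= 1 / 2 ->
  C1f z z_t z_r -> 0 <= B -> (forall t, Rabs (z a0 t) <= A) ->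
  (forall r t, Rabs (along a z_t z_r r t) <= chi r * B) ->
  forall r t, Rabs (z r t) <= A + W * B.
Proof.
intros HW HNa Hs0 Ha Hsmall Hz HB HA HD r t.
set (X := flow chi W Na s0 a a_t HW HNa Hs0 Ha Hsmall).
assert (Ca := sp_cont _ _ _ _ _ Ha).
assert (Cz := cont2_along chi Na s0 a a_t Ha z_t z_r (proj1 (proj2 (proj2 Hz))) (proj2 (proj2 (proj2 Hz)))).
assert (Cx : forall s, continuous (fun s => X s r t) s) by (intros; apply flow_cont_s).
assert (E : is_RInt (fun s => along a z_t z_r s (X s r t)) a0 r (z r (X r r t) - z a0 (X a0 r t))).
{ apply (is_RInt_derive (V := R_CompleteNormedModule) (fun s => z s (X s r t))).
  - intros s _. apply (C1f_chain z z_t z_r (fun s => X s r t) s (a s (X s r t))); auto. apply flow_der.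
  - intros s _. cts. }
apply (is_RInt_unique (V := R_CompleteNormedModule)) in E.
assert (Xr : X r r t = t) by apply flow_start. rewrite Xr in E.
assert (I : Rabs (RInt (fun s => along a z_t z_r s (X s r t)) a0 r) <= W * B).
{ apply (abs_RInt_le_weight chi); auto. intros; cts. }
assert (E' : z r t = z a0 (X a0 r t) + RInt (fun s => along a z_t z_r s (X s r t)) a0 r).
{ transitivity (z a0 (X a0 r t) + (z r t - z a0 (X a0 r t))). ring. f_equal. symmetry. exact E. }
rewrite E'. apply abs_plus_le; auto.
Qed.

(** * Coefficients depending on the unknown *)

Definition vec : Type := idx4 -> R.

Definition near (p q : vec) (d : R) : Prop := forall j, Rabs (p j - q j) <= d.

Definition cube (p : vec) (d : R) : Prop := forall j, Rabs (p j) <= d.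

(** Continuity in [r] and a Lipschitz directional derivative in [p], on the unit
    cube; the quadratic remainder gives the chain rule.  The slope bound [L] is
    kept apart from [E], which measures the nonlinearity: for the source only
    the latter tends to 0 with the data. *)
Record field (f : R -> vec -> R) (df : R -> vec -> vec -> R) (L E : R) : Prop := {
  fd_cont : forall p, cube p 1 -> forall r, continuous (fun r => f r p) r;
  fd_dcont : forall p w, cube p 1 -> forall r, continuous (fun r => df r p w) r;
  fd_lip : forall r p q d, cube p 1 -> cube q 1 -> near p q d ->
    Rabs (f r p - f r q) <= L * d;
  fd_dbound : forall r p w c, cube p 1 -> cube w c -> Rabs (df r p w) <= L * c;
  fd_dlip : forall r p q w d c, cube p 1 -> cube q 1 -> near p q d -> cube w c ->
    Rabs (df r p w - df r q w) <= E * d * c;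
  fd_taylor : forall r p q d, cube p 1 -> cube q 1 -> near q p d ->
    Rabs (f r q - f r p - df r p (fun j => q j - p j)) <= E * d * d;
  fd_sub : forall r p w w', df r p (fun j => w j - w' j) = df r p w - df r p w';
  fd_scal : forall r p c w, df r p (fun j => c * w j) = c * df r p w }.

Lemma filter_idx4 {U : UniformSpace} (x : U) (P : idx4 -> U -> Prop) :
  (forall j, locally x (P j)) -> locally x (fun y => forall j, P j y).
Proof.
intros H. generalize (filter_and _ _ (filter_and _ _ (H i1) (H i2)) (filter_and _ _ (H i3) (H i4))).
apply filter_imp. intros y [[A B] [C D]] [ | | | ]; auto.
Qed.

Section Field.
Context (f : R -> vec -> R) (df : R -> vec -> vec -> R) (L E : R).
Context (HL : 0 <= L) (HE : 0 <= E) (Hf : field f df L E).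

Lemma field_chain (P P' : R -> vec) (r t : R) :
  (forall t, cube (P t) 1) -> (forall t, cube (P' t) 1) ->
  (forall j t, is_derive (fun t => P t j) t (P' t j)) ->
  is_derive (fun t => f r (P t)) t (df r (P t) (P' t)).
Proof.
intros HP HP' HD. apply is_derive_eps. intros eps He.
set (e1 := eps / (2 * (L + 1))). assert (He1 : 0 < e1) by (apply Rdiv_lt_0_compat; lra).
assert (HE2 : 0 < eps / (2 * (E + 1))) by (apply Rdiv_lt_0_compat; lra).
assert (N1 : locally t (fun y => forall j, Rabs (P y j - P t j - (y - t) * P' t j) <= e1 * Rabs (y - t))).
{ apply filter_idx4. intros j. apply (is_derive_eps_inv (fun t => P t j)); auto. }
assert (N2 : locally t (fun y => Rabs (y - t) < eps / (2 * (E + 1)))).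
{ exists (mkposreal _ HE2). intros y Hy. exact Hy. }
generalize (filter_and _ _ N1 N2). apply filter_imp. intros y [H1 H2].
set (h := y - t) in *.
assert (Hn : near (P y) (P t) (Rabs h)).
{ intros j. 
  eapply Rle_trans. apply (lipschitz_of_derive (fun t => P t j) (fun t => P' t j) 1); auto.
  intros z; apply (HP' z j). fold h. lra. }
assert (HT := fd_taylor _ _ _ _ Hf r (P t) (P y) (Rabs h) (HP t) (HP y) Hn).
assert (HB := fd_dbound _ _ _ _ Hf r (P t) (fun j => (P y j - P t j) - h * P' t j) (e1 * Rabs h) (HP t) H1).
rewrite (fd_sub _ _ _ _ Hf r (P t) (fun j => P y j - P t j) (fun j => h * P' t j)) in HB.
rewrite (fd_scal _ _ _ _ Hf) in HB.
replace (f r (P y) - f r (P t) - h * df r (P t) (P' t)) with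
 ((f r (P y) - f r (P t) - df r (P t) (fun j => P y j - P t j))
  + (df r (P t) (fun j => P y j - P t j) - h * df r (P t) (P' t))) by ring.
eapply Rle_trans. apply Rabs_triang.
assert (Hh := Rabs_pos h).
assert (A1 : E * Rabs h * Rabs h <= eps / 2 * Rabs h).
{ apply Rmult_le_compat_r; auto. apply Rle_trans with ((E + 1) * (eps / (2 * (E + 1)))).
  apply Rmult_le_compat; lra. right; field; lra. }
assert (A2 : L * (e1 * Rabs h) <= eps / 2 * Rabs h).
{ rewrite <- Rmult_assoc. apply Rmult_le_compat_r; auto. apply Rle_trans with ((L + 1) * e1).
  apply Rmult_le_compat_r; lra. right; unfold e1; field; lra. }
lra.
Qed.

Lemma field_cont (Phi : idx4 -> R -> R -> R) :
  (forall j, cont2 (Phi j)) -> (forall r t, cube (fun j => Phi j r t) 1) ->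
  cont2 (fun r t => f r (fun j => Phi j r t)).
Proof.
intros HC HB r t. apply continuous_eps. intros eps He.
assert (He1 : 0 < eps / (2 * (L + 1))) by (apply Rdiv_lt_0_compat; lra).
assert (N1 : locally (r, t) (fun z : R * R => forall j, Rabs (Phi j (fst z) (snd z) - Phi j r t) < eps / (2 * (L + 1)))).
{ apply filter_idx4. intros j. apply (continuous_eps_inv (fun z : R * R => Phi j (fst z) (snd z)) (r, t)); auto. apply HC. }
assert (C1 : continuous (fun z : R * R => f (fst z) (fun j => Phi j r t)) (r, t)).
{ apply (continuous_comp fst (fun r' => f r' (fun j => Phi j r t))). apply continuous_fst.
  apply (fd_cont _ _ _ _ Hf). apply HB. }
assert (N2 := continuous_eps_inv _ _ (eps / 2) C1 ltac:(lra)).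
generalize (filter_and _ _ N1 N2). apply filter_imp. intros [r' t'] [H1 H2]. simpl in *.
assert (HLp := fd_lip _ _ _ _ Hf r' (fun j => Phi j r' t') (fun j => Phi j r t) (eps / (2 * (L + 1)))
  (HB r' t') (HB r t) ltac:(intros j; left; apply H1)).
assert (A : L * (eps / (2 * (L + 1))) <= eps / 2).
{ apply Rle_trans with ((L + 1) * (eps / (2 * (L + 1)))). apply Rmult_le_compat_r; lra. right; field; lra. }
replace (f r' (fun j => Phi j r' t') - f r (fun j => Phi j r t)) with
 ((f r' (fun j => Phi j r' t') - f r' (fun j => Phi j r t)) + (f r' (fun j => Phi j r t) - f r (fun j => Phi j r t))) by ring.
eapply Rle_lt_trans. apply Rabs_triang. lra.
Qed.

Lemma field_dcont (Phi Phit : idx4 -> R -> R -> R) :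
  (forall j, cont2 (Phi j)) -> (forall j, cont2 (Phit j)) ->
  (forall r t, cube (fun j => Phi j r t) 1) -> (forall r t, cube (fun j => Phit j r t) 1) ->
  cont2 (fun r t => df r (fun j => Phi j r t) (fun j => Phit j r t)).
Proof.
intros HC HC' HB HB' r t. apply continuous_eps. intros eps He.
set (d := Rmin (eps / (4 * (L + 1))) (eps / (4 * (E + 1)))).
assert (He1 : 0 < d) by (apply Rmin_pos; apply Rdiv_lt_0_compat; lra).
assert (N1 : locally (r, t) (fun z : R * R => forall j, Rabs (Phi j (fst z) (snd z) - Phi j r t) < d)).
{ apply filter_idx4. intros j. apply (continuous_eps_inv (fun z : R * R => Phi j (fst z) (snd z)) (r, t)); auto. apply HC. }
assert (N1' : locally (r, t) (fun z : R * R => forall j, Rabs (Phit j (fst z) (snd z) - Phit j r t) < d)).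
{ apply filter_idx4. intros j. apply (continuous_eps_inv (fun z : R * R => Phit j (fst z) (snd z)) (r, t)); auto. apply HC'. }
assert (C1 : continuous (fun z : R * R => df (fst z) (fun j => Phi j r t) (fun j => Phit j r t)) (r, t)).
{ apply (continuous_comp fst (fun r' => df r' (fun j => Phi j r t) (fun j => Phit j r t))). apply continuous_fst.
  apply (fd_dcont _ _ _ _ Hf). apply HB. }
assert (N2 := continuous_eps_inv _ _ (eps / 4) C1 ltac:(lra)).
generalize (filter_and _ _ (filter_and _ _ N1 N1') N2). apply filter_imp. intros [r' t'] [[H1 H1'] H2]. simpl in *.
assert (HLp := fd_dlip _ _ _ _ Hf r' (fun j => Phi j r' t') (fun j => Phi j r t) (fun j => Phit j r' t') d 1
  (HB r' t') (HB r t) ltac:(intros j; left; apply H1) (HB' r' t')).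
assert (HLb := fd_dbound _ _ _ _ Hf r' (fun j => Phi j r t) (fun j => Phit j r' t' - Phit j r t) d (HB r t) ltac:(intros j; left; apply H1')).
rewrite (fd_sub _ _ _ _ Hf r' (fun j => Phi j r t) (fun j => Phit j r' t') (fun j => Phit j r t)) in HLb.
assert (A : L * d <= eps / 4).
{ apply Rle_trans with ((L + 1) * (eps / (4 * (L + 1)))). apply Rmult_le_compat; try lra. apply Rmin_l. right; field; lra. }
assert (A' : E * d <= eps / 4).
{ apply Rle_trans with ((E + 1) * (eps / (4 * (E + 1)))). apply Rmult_le_compat; try lra. apply Rmin_r. right; field; lra. }
match goal with |- Rabs (?a - ?b) < _ => replace (a - b) with
  ((a - df r' (fun j => Phi j r t) (fun j => Phit j r' t')) +
   (df r' (fun j => Phi j r t) (fun j => Phit j r' t') - df r' (fun j => Phi j r t) (fun j => Phit j r t)) +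
   (df r' (fun j => Phi j r t) (fun j => Phit j r t) - b)) by ring end.
eapply Rle_lt_trans. apply Rabs_triang. eapply Rle_lt_trans. apply Rplus_le_compat_r, Rabs_triang. lra.
Qed.

Lemma field_dmodulus (Phi Phit : idx4 -> R -> R -> R) e b :
  0 <= e -> 1 <= b -> (forall r t, cube (fun j => Phi j r t) 1) -> (forall r t, cube (fun j => Phit j r t) 1) ->
  (forall j, modulus (fun _ => 1) e b (Phi j)) -> (forall j, modulus (fun _ => 1) e b (Phit j)) ->
  modulus (fun _ => L + E) e b (fun r t => df r (fun j => Phi j r t) (fun j => Phit j r t)).
Proof.
intros He Hb HB HB' M M' r t t'.
set (O := e + b * Rabs (t - t')).
assert (HO : near (fun j => Phi j r t) (fun j => Phi j r t') O).
{ intros j. eapply Rle_trans. apply M. fold O. lra. }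
assert (HLp := fd_dlip _ _ _ _ Hf r _ _ (fun j => Phit j r t) O 1 (HB r t) (HB r t') HO (HB' r t)).
assert (HLb := fd_dbound _ _ _ _ Hf r (fun j => Phi j r t') (fun j => Phit j r t - Phit j r t') O (HB r t')
   ltac:(intros j; eapply Rle_trans; [apply M'|fold O; lra])).
rewrite (fd_sub _ _ _ _ Hf r (fun j => Phi j r t') (fun j => Phit j r t) (fun j => Phit j r t')) in HLb.
match goal with |- Rabs (?a - ?b) <= _ => replace (a - b) with
  ((a - df r (fun j => Phi j r t') (fun j => Phit j r t)) + (df r (fun j => Phi j r t') (fun j => Phit j r t) - b)) by ring end.
eapply Rle_trans. apply Rabs_triang. lra.
Qed.

End Field.

(** * The nonlinear periodic problem in normalized form *)

Definition sum4 (f : idx4 -> R) : R := f i1 + f i2 + f i3 + f i4.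

Lemma abs_sum4 (f : idx4 -> R) B : (forall j, Rabs (f j) <= B) -> Rabs (sum4 f) <= 4 * B.
Proof.
intros H. unfold sum4. assert (H1 := H i1). assert (H2 := H i2). assert (H3 := H i3). assert (H4 := H i4).
eapply Rle_trans. apply Rabs_triang. eapply Rle_trans. apply Rplus_le_compat_r, Rabs_triang.
eapply Rle_trans. apply Rplus_le_compat_r, Rplus_le_compat_r, Rabs_triang. lra.
Qed.

(** The partial derivatives are carried as separate functions because the
    limit of the iteration is taken in each of the three. *)
Record state : Type := State { su : idx4 -> R -> R -> R; st : idx4 -> R -> R -> R; sr : idx4 -> R -> R -> R }.

Definition at_ (u : idx4 -> R -> R -> R) (r t : R) : vec := fun j => u j r t.

(** [d_mu] are the inverse speeds and [d_g] the sources over the speeds; [d_c i]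
    are the coefficients of the linear form that multiplies the transport of the
    third component; on the line [r = d_base i], component [i] equals [d_h i]
    plus [d_k i] times component [d_part i].  [d_dmu], [d_dg], [d_c'] and [d_h'] are
    derivatives. *)
Record data : Type := Data {
  d_mu : idx4 -> R -> vec -> R; d_dmu : idx4 -> R -> vec -> vec -> R;
  d_g : idx4 -> R -> vec -> R; d_dg : idx4 -> R -> vec -> vec -> R;
  d_c : idx4 -> idx4 -> R -> R; d_c' : idx4 -> idx4 -> R -> R;
  d_h : idx4 -> R -> R; d_h' : idx4 -> R -> R;
  d_base : idx4 -> R; d_k : idx4 -> R; d_part : idx4 -> idx4 }.

Definition mcoef (D : data) (P : state) (i : idx4) (r t : R) : R :=
  sum4 (fun j => d_c D i j r * su P j r t).
Definition mcoef_t (D : data) (P : state) (i : idx4) (r t : R) : R :=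
  sum4 (fun j => d_c D i j r * st P j r t).
Definition mcoef_r (D : data) (P : state) (i : idx4) (r t : R) : R :=
  sum4 (fun j => d_c' D i j r * su P j r t + d_c D i j r * sr P j r t).

Section Iteration.
Context (chi : R -> R) (W Na N ep de ka eta : R) (D : data).

Definition spd (P : state) (i : idx4) (r t : R) : R := chi r * d_mu D i r (at_ (su P) r t).
Definition spd_t (P : state) (i : idx4) (r t : R) : R :=
  chi r * d_dmu D i r (at_ (su P) r t) (at_ (st P) r t).

(** [Q] solves the problem linearized by freezing the coefficients at [P]. *)
Definition solves (P Q : state) : Prop :=
  (forall i r t, sr Q i r t + spd P i r t * st Q i r t
     + mcoef D P i r t * (sr Q i3 r t + spd P i r t * st Q i3 r t)
     = chi r * d_g D i r (at_ (su P) r t)) /\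
  (forall i t, su Q i (d_base D i) t = d_h D i t + d_k D i * su P (d_part D i) (d_base D i) t).

Definition C1_bounded (P : state) : Prop :=
  (forall i, C1f (su P i) (st P i) (sr P i)) /\
  (forall i r t, Rabs (su P i r t) <= 1) /\ (forall i r t, Rabs (st P i r t) <= 1) /\
  (forall i r t, Rabs (sr P i r t) <= chi r * N).

(** The affine moduli of the boundary data; the iterates share all of them. *)
Definition admissible (e b : R) : Prop :=
  0 <= e /\ 1 <= b /\ forall i t t', Rabs (d_h' D i t - d_h' D i t') <= eta * (e + b * Rabs (t - t')).

Definition equicontinuous (P : state) : Prop :=
  forall e b, admissible e b -> forall i,
    modulus (fun _ => 1) e b (st P i) /\ modulus (fun r => chi r * N) e b (sr P i).

(** [ka] bounds the reflection coefficients, [de] the slope of the source, and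
    [ep] all nonlinear effects.  [wp_small] makes the unit ball of C^1 invariant
    under the iteration and [wp_contract] makes it contract in the uniform norm. *)
Record well_posed : Prop := {
  wp_chi : weight chi W;
  wp_Na : 0 <= Na;
  wp_ep : 0 <= ep <= 1;
  wp_de : 0 <= de;
  wp_ka : 0 <= ka;
  wp_eta : 0 <= eta;
  wp_N : Na + de + 1 <= N;
  wp_small : ka + eta + W * de + 1600 * ((1 + W) * N * (N * ep)) <= 1;
  wp_contract : ka + W * de + 1600 * ((1 + W) * N * (N * ep)) < 1;
  wp_mu : forall i, field (d_mu D i) (d_dmu D i) ep ep;
  wp_mu_b : forall i r p, cube p 1 -> Rabs (d_mu D i r p) <= Na;
  wp_g : forall i, field (d_g D i) (d_dg D i) de ep;
  wp_g0 : forall i r, d_g D i r (fun _ => 0) = 0;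
  wp_c : forall i j r, is_derive (d_c D i j) r (d_c' D i j r);
  wp_c'_cont : forall i j r, continuous (d_c' D i j) r;
  wp_c_b : forall i j r, Rabs (d_c D i j r) <= ep;
  wp_c'_b : forall i j r, Rabs (d_c' D i j r) <= chi r * ep;
  wp_c3 : forall j r, d_c D i3 j r = 0;
  wp_h : forall i t, is_derive (d_h D i) t (d_h' D i t);
  wp_h'_cont : forall i t, continuous (d_h' D i) t;
  wp_h_b : forall i t, Rabs (d_h D i t) <= eta;
  wp_h'_b : forall i t, Rabs (d_h' D i t) <= eta;
  wp_k : forall i, Rabs (d_k D i) <= ka }.

Context (WP : well_posed).

Let HW := wp_chi WP. Let HNa := wp_Na WP. Let Hep := wp_ep WP. Let Hde := wp_de WP.
Let HN := wp_N WP.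

(* [s0] bounds the [t]-slopes of the speeds and the coupling with its
   derivatives; [x] is the small number of [transport_solution] *)
Let s0 := 16 * (N * ep).
Let x := (1 + W) * N * s0.

Let HW0 : 0 <= W. Proof. apply (weight_pos chi); auto. Qed.
Let N1 : 1 <= N. Proof. lra. Qed.
Let Nep : 0 <= N * ep. Proof. apply Rmult_le_pos; lra. Qed.
Let ep_N : ep <= N * ep. Proof. assert (1 * ep <= N * ep) by (apply Rmult_le_compat_r; lra). lra. Qed.
Let s00 : 0 <= s0. Proof. unfold s0; lra. Qed.
Let ep_s0 : 16 * ep <= s0. Proof. unfold s0. assert (1 * ep <= N * ep) by (apply Rmult_le_compat_r; lra). lra. Qed.
Let Ns0 : s0 <= N * s0. Proof. assert (1 * s0 <= N * s0) by (apply Rmult_le_compat_r; lra). lra. Qed.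
Let x_eq : x = N * s0 + W * (N * s0). Proof. unfold x. ring. Qed.
Let WNs0 : 0 <= W * (N * s0). Proof. repeat apply Rmult_le_pos; lra. Qed.
Let Ws0 : W * s0 <= W * (N * s0). Proof. apply Rmult_le_compat_l; auto. Qed.
Let x1 : s0 <= x. Proof. lra. Qed.
Let x2 : W * s0 <= x. Proof. lra. Qed.
Let x3 : N * s0 <= x. Proof. lra. Qed.
Let x4 : W * (N * s0) <= x. Proof. lra. Qed.
Let xsmall : ka + eta + W * de + 100 * x <= 1.
Proof. assert (H := wp_small WP). unfold x, s0. lra. Qed.
Let Wde0 : 0 <= W * de. Proof. apply Rmult_le_pos; auto. Qed.
Let chi0 : forall r, 0 <= chi r. Proof. apply HW. Qed.
Let Cchi : forall r, continuous chi r. Proof. apply HW. Qed.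
Let Wsmall : W * s0 <= 1 / 2.
Proof. assert (Hk := wp_ka WP). assert (He := wp_eta WP). lra. Qed.

Lemma chi_le r u v : u <= v -> chi r * u <= chi r * v.
Proof. intros; apply Rmult_le_compat_l; auto. Qed.

Lemma src_bound P i r t : cube (at_ (su P) r t) 1 ->
  Rabs (chi r * d_g D i r (at_ (su P) r t)) <= chi r * de.
Proof.
intros HP. apply abs_scal_le; auto.
replace (d_g D i r (at_ (su P) r t)) with (d_g D i r (at_ (su P) r t) - d_g D i r (fun _ => 0)) by (rewrite (wp_g0 WP); ring).
eapply Rle_trans. apply (fd_lip _ _ _ _ (wp_g WP i) r _ _ 1). exact HP.
intros j; rewrite Rabs_R0; lra. intros j. rewrite Rminus_0_r. apply HP. lra.
Qed.

Section Coefficients.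
Context (P : state) (BP : C1_bounded P).

Lemma bounded_cube r t : cube (at_ (su P) r t) 1.
Proof. intros j. apply BP. Qed.

Lemma bounded_cube_t r t : cube (at_ (st P) r t) 1.
Proof. intros j. apply BP. Qed.

Lemma bounded_cont j : cont2 (su P j) /\ cont2 (st P j) /\ cont2 (sr P j).
Proof.
destruct BP as [H _]. split; [eapply C1f_cont2; apply H|]. apply (proj2 (proj2 (H j))).
Qed.

Lemma spd_speed i : speed chi Na s0 (spd P i) (spd_t P i).
Proof.
assert (Hmu := wp_mu WP i).
split.
- intros r t. unfold spd. apply (continuous_Rmult (fun z : R * R => chi (fst z))). cts.
  apply (field_cont (d_mu D i) (d_dmu D i) ep ep ltac:(lra) Hmu (su P)). apply bounded_cont. apply bounded_cube.
- intros r t. unfold spd_t. apply (continuous_Rmult (fun z : R * R => chi (fst z))). cts.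
  apply (field_dcont (d_mu D i) (d_dmu D i) ep ep ltac:(lra) ltac:(lra) Hmu (su P) (st P)); try apply bounded_cont.
  apply bounded_cube. apply bounded_cube_t.
- intros r t. unfold spd, spd_t. apply (is_derive_scal (fun t => d_mu D i r (at_ (su P) r t))).
  apply (field_chain (d_mu D i) (d_dmu D i) ep ep ltac:(lra) ltac:(lra) Hmu (fun t => at_ (su P) r t) (fun t => at_ (st P) r t)).
  intros; apply bounded_cube. intros; apply bounded_cube_t.
  intros j y. apply BP.
- intros r t. unfold spd. apply abs_scal_le; auto. apply (wp_mu_b WP). apply bounded_cube.
- intros r t. unfold spd_t. apply abs_scal_le; auto. eapply Rle_trans.
  apply (fd_dbound _ _ _ _ Hmu r _ _ 1). apply bounded_cube. apply bounded_cube_t. lra.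
Qed.

Lemma src_cont i : cont2 (fun r t => chi r * d_g D i r (at_ (su P) r t)).
Proof.
intros r t. apply (continuous_Rmult (fun z : R * R => chi (fst z))). cts.
apply (field_cont (d_g D i) (d_dg D i) de ep Hde (wp_g WP i) (su P)). apply bounded_cont. apply bounded_cube.
Qed.

Lemma src_cont_t i : cont2 (fun r t => chi r * d_dg D i r (at_ (su P) r t) (at_ (st P) r t)).
Proof.
intros r t. apply (continuous_Rmult (fun z : R * R => chi (fst z))). cts.
apply (field_dcont (d_g D i) (d_dg D i) de ep Hde ltac:(lra) (wp_g WP i) (su P) (st P)); try apply bounded_cont.
apply bounded_cube. apply bounded_cube_t.
Qed.

Lemma src_der i r t : is_derive (fun t => chi r * d_g D i r (at_ (su P) r t)) t
  (chi r * d_dg D i r (at_ (su P) r t) (at_ (st P) r t)).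
Proof.
apply (is_derive_scal (fun t => d_g D i r (at_ (su P) r t))).
apply (field_chain (d_g D i) (d_dg D i) de ep Hde ltac:(lra) (wp_g WP i) (fun t => at_ (su P) r t) (fun t => at_ (st P) r t)).
intros; apply bounded_cube. intros; apply bounded_cube_t.
intros j y. apply BP.
Qed.

Lemma src_bound_t i r t : Rabs (chi r * d_dg D i r (at_ (su P) r t) (at_ (st P) r t)) <= chi r * de.
Proof.
apply abs_scal_le; auto.
eapply Rle_trans. apply (fd_dbound _ _ _ _ (wp_g WP i) r _ _ 1). apply bounded_cube. apply bounded_cube_t. lra.
Qed.

Lemma abs_mult_ep c v B : Rabs c <= ep -> Rabs v <= B -> Rabs (c * v) <= ep * B.
Proof. intros. apply abs_mult_le; auto. Qed.

Lemma mcoef_C1 i : C1f (mcoef D P i) (mcoef_t D P i) (mcoef_r D P i).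
Proof.
assert (CC : forall j r, continuous (d_c D i j) r).
{ intros j r. apply (is_derive_continuous _ _ _ (wp_c WP i j r)). }
assert (CC' := wp_c'_cont WP i).
refine (conj _ (conj _ (conj _ _))).
- intros r t. unfold mcoef, mcoef_t, sum4. repeat match goal with |- is_derive (fun _ => _ + _) _ _ => apply is_derive_Rplus end;
  match goal with |- is_derive (fun t => d_c D i ?j r * _) _ _ => apply (is_derive_scal (fun t => su P j r t)); apply BP end.
- intros r t. unfold mcoef, mcoef_r, sum4. repeat match goal with |- is_derive (fun _ => _ + _) _ _ => apply is_derive_Rplus end;
  match goal with |- is_derive (fun r => d_c D i ?j r * _) _ _ =>
    apply (is_derive_Rmult (d_c D i j) (fun r => su P j r t)); [apply (wp_c WP) | apply BP] end.
- intros r t. unfold mcoef_t, sum4. 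
  assert (C1 := CC i1). assert (C2 := CC i2). assert (C3 := CC i3). assert (C4 := CC i4).
  assert (B1 := proj1 (proj2 (bounded_cont i1))). assert (B2 := proj1 (proj2 (bounded_cont i2))).
  assert (B3 := proj1 (proj2 (bounded_cont i3))). assert (B4 := proj1 (proj2 (bounded_cont i4))).
  cts.
- intros r t. unfold mcoef_r, sum4. 
  assert (C1 := CC i1). assert (C2 := CC i2). assert (C3 := CC i3). assert (C4 := CC i4).
  assert (C1' := CC' i1). assert (C2' := CC' i2). assert (C3' := CC' i3). assert (C4' := CC' i4).
  destruct (bounded_cont i1) as [A1 [_ B1]]. destruct (bounded_cont i2) as [A2 [_ B2]].
  destruct (bounded_cont i3) as [A3 [_ B3]]. destruct (bounded_cont i4) as [A4 [_ B4]].
  cts.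
Qed.

Lemma mcoef_bound i r t : Rabs (mcoef D P i r t) <= 4 * ep.
Proof.
apply abs_sum4. intros j. rewrite <- (Rmult_1_r ep). apply abs_mult_ep. apply WP. apply BP.
Qed.

Lemma mcoef_t_bound i r t : Rabs (mcoef_t D P i r t) <= 4 * ep.
Proof.
apply abs_sum4. intros j. rewrite <- (Rmult_1_r ep). apply abs_mult_ep. apply WP. apply BP.
Qed.

Lemma mcoef_along_bound i i' r t :
  Rabs (along (spd P i') (mcoef_t D P i) (mcoef_r D P i) r t) <= chi r * s0.
Proof.
unfold along. eapply Rle_trans. apply Rabs_triang.
assert (H1 : Rabs (mcoef_r D P i r t) <= 4 * (chi r * (ep + ep * N))).
{ apply abs_sum4. intros j. eapply Rle_trans. apply Rabs_triang.
  assert (A1 : Rabs (d_c' D i j r * su P j r t) <= chi r * ep * 1).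
  { apply abs_mult_le. apply WP. apply BP. }
  assert (A2 : Rabs (d_c D i j r * sr P j r t) <= ep * (chi r * N)).
  { apply abs_mult_ep. apply WP. apply BP. }
  lra. }
assert (H2 : Rabs (spd P i' r t * mcoef_t D P i r t) <= chi r * Na * (4 * ep)).
{ apply abs_mult_le. apply (spd_speed i'). apply mcoef_t_bound. }
apply Rle_trans with (chi r * (4 * ep + 4 * (N * ep) + 4 * (Na * ep))); [lra|].
apply chi_le. unfold s0. assert (Na * ep <= N * ep) by (apply Rmult_le_compat_r; lra). lra.
Qed.

Context (EP : equicontinuous P) (e b : R) (Hadm : admissible e b).

Let He : 0 <= e. Proof. apply Hadm. Qed.
Let Hb : 1 <= b. Proof. apply Hadm. Qed.
Let b0 : 0 <= b. Proof. lra. Qed.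

Lemma su_modulus j : modulus (fun _ => 1) e b (su P j).
Proof.
apply (modulus_of_derive (fun _ => 1) e b (su P j) (st P j)); auto. intros; lra. apply BP. intros; apply BP.
Qed.

Lemma spd_modulus i : modulus (fun r => chi r * ep) e b (spd P i).
Proof.
apply (modulus_of_derive _ e b (spd P i) (spd_t P i)); auto. intros; apply Rmult_le_pos; auto; lra.
apply (spd_speed i). intros r t. unfold spd_t. apply abs_scal_le; auto. eapply Rle_trans.
apply (fd_dbound _ _ _ _ (wp_mu WP i) r _ _ 1). apply bounded_cube. apply bounded_cube_t. lra.
Qed.

Lemma chi_modulus w f : modulus (fun _ => w) e b f -> modulus (fun r => chi r * w) e b (fun r t => chi r * f r t).
Proof.
intros H r t t'. rewrite <- Rmult_minus_distr_l, Rabs_mult, (Rabs_pos_eq (chi r)) by auto.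
rewrite Rmult_assoc. apply Rmult_le_compat_l; auto.
Qed.

Lemma spd_t_modulus i : modulus (fun r => chi r * s0) e b (spd_t P i).
Proof.
apply (modulus_weaken (fun r => chi r * (ep + ep)) _ e b _ He b0).
intros r; apply chi_le; lra.
apply (chi_modulus (ep + ep) (fun r t => d_dmu D i r (at_ (su P) r t) (at_ (st P) r t))).
apply (field_dmodulus (d_mu D i)); auto; try apply (wp_mu WP); try (intros; apply bounded_cube); try (intros; apply bounded_cube_t).
apply su_modulus. intros j. apply (EP e b Hadm j).
Qed.

Lemma src_t_modulus i :
  modulus (fun r => chi r * (de + s0)) e b (fun r t => chi r * d_dg D i r (at_ (su P) r t) (at_ (st P) r t)).
Proof.
apply (modulus_weaken (fun r => chi r * (de + ep)) _ e b _ He b0).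
intros r; apply chi_le; lra.
apply (chi_modulus (de + ep) (fun r t => d_dg D i r (at_ (su P) r t) (at_ (st P) r t))).
apply (field_dmodulus (d_g D i)); auto; try apply (wp_g WP); try (intros; apply bounded_cube); try (intros; apply bounded_cube_t).
apply su_modulus. intros j. apply (EP e b Hadm j).
Qed.

Lemma modulus_sum4 w (f : idx4 -> R -> R -> R) :
  (forall j, modulus w e b (f j)) -> modulus (fun r => 4 * w r) e b (fun r t => sum4 (fun j => f j r t)).
Proof.
intros H r t t'. unfold sum4.
replace (f i1 r t + f i2 r t + f i3 r t + f i4 r t - (f i1 r t' + f i2 r t' + f i3 r t' + f i4 r t')) with
 (sum4 (fun j => f j r t - f j r t')) by (unfold sum4; ring).
rewrite Rmult_assoc. apply (abs_sum4 (fun j => f j r t - f j r t')). intros j. apply H.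
Qed.

Lemma scal_modulus c w B f : (forall r, Rabs (c r) <= B r) -> modulus w e b f ->
  modulus (fun r => B r * w r) e b (fun r t => c r * f r t).
Proof.
intros Hc Hf r t t'. rewrite <- Rmult_minus_distr_l, Rabs_mult, Rmult_assoc.
apply Rmult_le_compat; try apply Rabs_pos; auto.
Qed.

Lemma mcoef_t_modulus i : modulus (fun _ => 4 * ep) e b (mcoef_t D P i).
Proof.
apply (modulus_weaken (fun _ => 4 * (ep * 1)) _ e b _ He b0). intros; lra.
apply (modulus_sum4 (fun _ => ep * 1) (fun j r t => d_c D i j r * st P j r t)).
intros j. apply (scal_modulus (d_c D i j) (fun _ => 1) (fun _ => ep)). apply WP. apply (EP e b Hadm).
Qed.

Lemma mcoef_along_modulus i i' :
  modulus (fun r => chi r * s0) e b (along (spd P i') (mcoef_t D P i) (mcoef_r D P i)).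
Proof.
assert (M1 : modulus (fun r => 4 * (chi r * ep * 1 + ep * (chi r * N))) e b (mcoef_r D P i)).
{ apply (modulus_sum4 (fun r => chi r * ep * 1 + ep * (chi r * N)) (fun j r t => d_c' D i j r * su P j r t + d_c D i j r * sr P j r t)).
  intros j. apply modulus_plus.
  apply (scal_modulus (d_c' D i j) (fun _ => 1) (fun r => chi r * ep)). apply WP. apply su_modulus.
  apply (scal_modulus (d_c D i j) (fun r => chi r * N) (fun _ => ep)). apply WP. apply (EP e b Hadm). }
assert (M2 := modulus_mult (fun r => chi r * ep) (fun _ => 4 * ep) (fun r => chi r * Na) (fun _ => 4 * ep) e b _ _
   ltac:(intros; apply Rmult_le_pos; auto; lra) ltac:(intros; lra) He b0 (spd_modulus i') (mcoef_t_modulus i)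
   (sp_bound _ _ _ _ _ (spd_speed i')) (mcoef_t_bound i)).
apply (modulus_weaken _ _ e b _ He b0) with (2 := modulus_plus _ _ e b _ _ M1 M2).
intros r. simpl. 
apply Rle_trans with (chi r * (4 * ep + 4 * (N * ep) + 4 * (ep * ep) + 4 * (Na * ep))); [lra|].
apply chi_le. unfold s0. assert (Na * ep <= N * ep) by (apply Rmult_le_compat_r; lra).
assert (ep * ep <= N * ep) by (apply Rmult_le_compat_r; lra). lra.
Qed.

End Coefficients.

Definition zero_state : state := State (fun _ _ _ => 0) (fun _ _ _ => 0) (fun _ _ _ => 0).

Lemma C1f_zero : C1f (fun _ _ => 0) (fun _ _ => 0) (fun _ _ => 0).
Proof.
refine (conj _ (conj _ (conj _ _))); intros; try apply is_derive_Rconst; intros r t; cts.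
Qed.

Lemma zero_bounded : C1_bounded zero_state.
Proof.
split; [intros; apply C1f_zero|]. simpl. 
repeat split; intros; rewrite Rabs_R0; try lra. apply Rmult_le_pos; auto; lra.
Qed.

Lemma zero_equicontinuous : equicontinuous zero_state.
Proof.
intros e b [He [Hb _]] i. simpl.
assert (H : forall t t', 0 <= e + b * Rabs (t - t')).
{ intros t t'. assert (0 <= b * Rabs (t - t')) by (apply Rmult_le_pos; [lra|apply Rabs_pos]). lra. }
split; intros r t t'; rewrite Rminus_0_r, Rabs_R0.
- rewrite Rmult_1_l. apply H.
- apply Rmult_le_pos. apply Rmult_le_pos; auto; lra. apply H.
Qed.

(** One component of the linearized problem, with the third component [v]
    already known. *)
Lemma solve_component P i v v_t v_r :
  C1_bounded P -> equicontinuous P -> C1f v v_t v_r ->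
  (forall r t, Rabs (v_t r t) <= 1) ->
  (forall r t, Rabs (v_r r t) <= chi r * N) ->
  (forall e b, admissible e b -> modulus (fun _ => 1) e b v_t /\ modulus (fun r => chi r * N) e b v_r) ->
  exists u u_t u_r, C1f u u_t u_r /\
    (forall r t, Rabs (u r t) <= 1) /\ (forall r t, Rabs (u_t r t) <= 1) /\
    (forall r t, Rabs (u_r r t) <= chi r * N) /\
    (forall e b, admissible e b -> modulus (fun _ => 1) e b u_t /\ modulus (fun r => chi r * N) e b u_r) /\
    (forall r t, u_r r t + spd P i r t * u_t r t + mcoef D P i r t * (v_r r t + spd P i r t * v_t r t)
       = chi r * d_g D i r (at_ (su P) r t)) /\
    (forall t, u (d_base D i) t = d_h D i t + d_k D i * su P (d_part D i) (d_base D i) t).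
Proof.
intros BP EP Cv Bvt Bvr Mv.
assert (Hka := wp_ka WP). assert (Heta := wp_eta WP).
assert (Sp := spd_speed P BP i).
apply (transport_solution chi W Na N s0 x de (ka + eta) (spd P i) (spd_t P i)
  (mcoef D P i) (mcoef_t D P i) (mcoef_r D P i) v v_t v_r
  (fun r t => chi r * d_g D i r (at_ (su P) r t))
  (fun r t => chi r * d_dg D i r (at_ (su P) r t) (at_ (st P) r t))
  (fun t => d_h D i t + d_k D i * su P (d_part D i) (d_base D i) t)
  (fun t => d_h' D i t + d_k D i * st P (d_part D i) (d_base D i) t)
  (d_base D i) admissible); auto; try lra.
- apply mcoef_C1; auto.
- apply src_cont; auto.
- apply src_cont_t; auto.
- apply src_der; auto.
- intros t. apply is_derive_Rplus. apply WP. apply (is_derive_scal (fun t => su P (d_part D i) (d_base D i) t)). apply BP.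
- intros t. assert (C1 := proj1 (proj2 (bounded_cont P BP (d_part D i)))). assert (C2 := wp_h'_cont WP i). cts.
- intros t. eapply Rle_trans. apply Rabs_triang. rewrite Rplus_comm. apply Rplus_le_compat. 
  rewrite <- (Rmult_1_r ka). apply abs_mult_le. apply WP. apply BP. apply WP.
- intros t. eapply Rle_trans. apply Rabs_triang. rewrite Rplus_comm. apply Rplus_le_compat. 
  rewrite <- (Rmult_1_r ka). apply abs_mult_le. apply WP. apply BP. apply WP.
- intros r t. apply src_bound. apply bounded_cube; auto.
- apply src_bound_t; auto.
- intros r t. eapply Rle_trans. apply mcoef_bound; auto. lra.
- intros r t. eapply Rle_trans. apply mcoef_t_bound; auto. lra.
- intros r t. apply mcoef_along_bound; auto.
- intros r t. unfold along. eapply Rle_trans. apply Rabs_triang.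
  assert (Rabs (spd P i r t * v_t r t) <= chi r * Na * 1).
  { apply abs_mult_le; auto. apply Sp. }
  assert (chi r * (N + Na) <= chi r * (2 * N)) by (apply chi_le; lra).
  assert (H2 := Bvr r t). lra.
- intros e b Hadm. destruct (Mv e b Hadm) as [Mv1 Mv2]. destruct Hadm as [He [Hb Hh]].
  assert (Hadm : admissible e b) by (split; auto).
  assert (b0 : 0 <= b) by lra.
  refine (conj He (conj Hb (conj _ (conj _ (conj _ (conj _ (conj _ (conj _ _)))))))); auto.
  + apply spd_t_modulus; auto.
  + apply (modulus_weaken (fun _ => 4 * ep) _ e b _ He b0). intros; lra. apply mcoef_t_modulus; auto.
  + apply mcoef_along_modulus; auto.
  + apply src_t_modulus; auto.
  + assert (M2 := modulus_mult (fun r => chi r * ep) (fun _ => 1) (fun r => chi r * Na) (fun _ => 1) e b _ _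
      ltac:(intros; apply Rmult_le_pos; auto; lra) ltac:(intros; lra) He b0 (spd_modulus P BP e b Hadm i) Mv1
      (sp_bound _ _ _ _ _ Sp) Bvt).
    apply (modulus_weaken _ _ e b _ He b0) with (2 := modulus_plus _ _ e b _ _ Mv2 M2).
    intros r. simpl. apply Rle_trans with (chi r * (N + ep + Na)); [lra|]. apply chi_le. lra.
  + intros t t'. rewrite Rplus_sub_swap. eapply Rle_trans. apply Rabs_triang.
    rewrite (Rplus_comm ka), Rmult_plus_distr_r. apply Rplus_le_compat; auto.
    rewrite <- Rmult_minus_distr_l, Rabs_mult.
    apply Rmult_le_compat; try apply Rabs_pos. apply WP.
    eapply Rle_trans. apply (proj1 (EP e b Hadm (d_part D i))). lra.
Qed.

Lemma mcoef_3 P r t : mcoef D P i3 r t = 0.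
Proof. unfold mcoef, sum4. rewrite !(wp_c3 WP). ring. Qed.

(** The third component is solved first: its own coupling vanishes, and it is
    the only component of the new state that the other equations involve. *)
Lemma linear_step P : C1_bounded P -> equicontinuous P ->
  exists Q, C1_bounded Q /\ equicontinuous Q /\ solves P Q.
Proof.
intros BP EP.
destruct (solve_component P i3 (fun _ _ => 0) (fun _ _ => 0) (fun _ _ => 0) BP EP C1f_zero) as
  [v [v_t [v_r [V1 [V2 [V3 [V4 [V5 [V6 V7]]]]]]]]].
{ exact (proj1 (proj2 (proj2 zero_bounded)) i1). }
{ exact (proj2 (proj2 (proj2 zero_bounded)) i1). }
{ intros e b H. apply (zero_equicontinuous e b H i1). }
assert (HS := fun i => solve_component P i v v_t v_r BP EP V1 V3 V4 V5).
assert (HQ : forall i, exists w : (R -> R -> R) * (R -> R -> R) * (R -> R -> R),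
   C1f (fst (fst w)) (snd (fst w)) (snd w) /\
    (forall r t, Rabs (fst (fst w) r t) <= 1) /\ (forall r t, Rabs (snd (fst w) r t) <= 1) /\
    (forall r t, Rabs (snd w r t) <= chi r * N) /\
    (forall e b, admissible e b -> modulus (fun _ => 1) e b (snd (fst w)) /\ modulus (fun r => chi r * N) e b (snd w)) /\
    (forall r t, snd w r t + spd P i r t * snd (fst w) r t + mcoef D P i r t * (v_r r t + spd P i r t * v_t r t)
       = chi r * d_g D i r (at_ (su P) r t)) /\
    (forall t, fst (fst w) (d_base D i) t = d_h D i t + d_k D i * su P (d_part D i) (d_base D i) t) /\
    (i = i3 -> w = (v, v_t, v_r))).
{ intros i. assert (H3 : i = i3 \/ i <> i3) by (destruct i; auto; right; discriminate).
  destruct H3 as [->|H3].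
  - exists (v, v_t, v_r). simpl. refine (conj V1 (conj V2 (conj V3 (conj V4 (conj V5 (conj _ (conj V7 _))))))); auto.
    intros r t. rewrite <- V6, !mcoef_3. ring.
  - destruct (HS i) as [u [u_t [u_r [U1 [U2 [U3 [U4 [U5 [U6 U7]]]]]]]]].
    exists (u, u_t, u_r). simpl. refine (conj U1 (conj U2 (conj U3 (conj U4 (conj U5 (conj U6 (conj U7 _))))))); auto.
    intros; contradiction. }
set (w := fun i => proj1_sig (constructive_indefinite_description _ (HQ i))).
assert (Hw := fun i => proj2_sig (constructive_indefinite_description _ (HQ i))).
fold w in Hw. cbv beta in Hw. change (fun i => proj1_sig (constructive_indefinite_description _ (HQ i))) with w in Hw.
assert (w3 : w i3 = (v, v_t, v_r)) by (apply (Hw i3); reflexivity).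
exists (State (fun i => fst (fst (w i))) (fun i => snd (fst (w i))) (fun i => snd (w i))).
split; [|split].
- refine (conj _ (conj _ (conj _ _))); simpl; intros; apply (Hw i).
- intros e b Hadm i. simpl. apply (Hw i); auto.
- split; simpl.
  + intros i r t. rewrite w3. simpl. apply (Hw i).
  + intros i t. apply (Hw i).
Qed.

Section FrozenDifference.
Context (P P' : state) (d : R).
Context (BP : forall r t, cube (at_ (su P) r t) 1) (BP' : forall r t, cube (at_ (su P') r t) 1).
Context (Hd : forall i r t, Rabs (su P i r t - su P' i r t) <= d).

Lemma spd_diff i r t : Rabs (spd P i r t - spd P' i r t) <= chi r * (ep * d).
Proof.
unfold spd. rewrite <- Rmult_minus_distr_l. apply abs_scal_le; auto.
apply (fd_lip _ _ _ _ (wp_mu WP i)); auto. intros j; apply Hd.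
Qed.

Lemma src_diff i r t :
  Rabs (chi r * d_g D i r (at_ (su P) r t) - chi r * d_g D i r (at_ (su P') r t)) <= chi r * (de * d).
Proof.
rewrite <- Rmult_minus_distr_l. apply abs_scal_le; auto.
apply (fd_lip _ _ _ _ (wp_g WP i)); auto. intros j; apply Hd.
Qed.

Lemma mcoef_diff i r t : Rabs (mcoef D P i r t - mcoef D P' i r t) <= 4 * (ep * d).
Proof.
unfold mcoef.
replace (_ - _) with (sum4 (fun j => d_c D i j r * (su P j r t - su P' j r t))) by (unfold sum4; ring).
apply abs_sum4. intros j. apply abs_mult_ep. apply WP. apply Hd.
Qed.

End FrozenDifference.

Definition rate : R := ka + W * de + 100 * x.

Lemma rate_range : 0 <= rate < 1.
Proof.
unfold rate. assert (H := wp_ka WP). split; [lra|].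
assert (H2 := wp_contract WP). unfold x, s0. lra.
Qed.

(** The linearized problem depends on the frozen state as a contraction for
    the uniform norm; the nonlinear loss of one derivative only concerns the
    C1_bounded factors [st Q'], [sr Q']. *)
Lemma contraction P Q P' Q' d :
  C1_bounded P -> C1_bounded Q -> C1_bounded P' -> C1_bounded Q' -> solves P Q -> solves P' Q' ->
  (forall i r t, Rabs (su P i r t - su P' i r t) <= d) ->
  forall i r t, Rabs (su Q i r t - su Q' i r t) <= rate * d.
Proof.
intros BP BQ BP' BQ' [S1 S2] [S1' S2'] Hd.
assert (Hka := wp_ka WP). assert (Heta := wp_eta WP).
assert (Hd0 : 0 <= d) by (eapply Rle_trans; [apply Rabs_pos|apply (Hd i1 0 0)]).
assert (CP := bounded_cube P BP). assert (CP' := bounded_cube P' BP').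
assert (Ha := spd_diff P P' d CP CP' Hd). assert (Hg := src_diff P P' d CP CP' Hd).
assert (Hm := mcoef_diff P P' d Hd).
set (e_ := fun i r t => su Q i r t - su Q' i r t).
set (et := fun i r t => st Q i r t - st Q' i r t).
set (er := fun i r t => sr Q i r t - sr Q' i r t).
assert (Ce : forall i, C1f (e_ i) (et i) (er i)).
{ intros i. destruct (proj1 BQ i) as [A1 [A2 [A3 A4]]]. destruct (proj1 BQ' i) as [A1' [A2' [A3' A4']]].
  refine (conj _ (conj _ (conj _ _))); intros r t.
  apply is_derive_Rminus; auto. apply is_derive_Rminus; auto. unfold et; cts. unfold er; cts. }
assert (PDE : forall i r t, er i r t + spd P i r t * et i r t + mcoef D P i r t * (er i3 r t + spd P i r t * et i3 r t)
  = (chi r * d_g D i r (at_ (su P) r t) - chi r * d_g D i r (at_ (su P') r t))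
    - (spd P i r t - spd P' i r t) * st Q' i r t
    - (mcoef D P i r t - mcoef D P' i r t) * (sr Q' i3 r t + spd P' i r t * st Q' i3 r t)
    - mcoef D P i r t * ((spd P i r t - spd P' i r t) * st Q' i3 r t)).
{ intros i r t. unfold er, et. rewrite <- S1, <- S1'. ring. }
assert (BC : forall i t, Rabs (e_ i (d_base D i) t) <= ka * d).
{ intros i t. unfold e_. rewrite S2, S2'. rewrite Rplus_sub_cancel, <- Rmult_minus_distr_l, Rabs_mult.
  apply Rmult_le_compat; try apply Rabs_pos. apply WP. apply Hd. }
assert (Hst : forall i r t, Rabs ((spd P i r t - spd P' i r t) * st Q' i r t) <= chi r * (ep * d)).
{ intros i r t. rewrite <- (Rmult_1_r (chi r * (ep * d))). apply abs_mult_le; auto. apply BQ'. }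
assert (Hst3 : forall i r t, Rabs ((spd P i r t - spd P' i r t) * st Q' i3 r t) <= chi r * (ep * d)).
{ intros i r t. rewrite <- (Rmult_1_r (chi r * (ep * d))). apply abs_mult_le; auto. apply BQ'. }
assert (epd : 16 * (ep * d) <= s0 * d).
{ rewrite <- Rmult_assoc. apply Rmult_le_compat_r; auto. }
assert (epd0 : 0 <= ep * d) by (apply Rmult_le_pos; lra).
assert (ded0 : 0 <= de * d) by (apply Rmult_le_pos; lra).
assert (s0d : 0 <= s0 * d) by (apply Rmult_le_pos; lra).
assert (Ws0d : W * (s0 * d) <= x * d) by (rewrite <- Rmult_assoc; apply Rmult_le_compat_r; auto).
assert (s0xd : s0 * d <= x * d) by (apply Rmult_le_compat_r; auto).
assert (rt : rate * d = ka * d + W * (de * d) + 100 * (x * d)) by (unfold rate; ring).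
assert (rd : rate * d <= 1 * d) by (apply Rmult_le_compat_r; auto; left; apply rate_range).
assert (E3 : forall r t, Rabs (e_ i3 r t) <= d).
{ intros r t. apply Rle_trans with (ka * d + W * (de * d + s0 * d)).
  2:{ rewrite Rmult_plus_distr_l. lra. }
  apply (transport_max chi W Na s0 (spd P i3) (spd_t P i3) (e_ i3) (et i3) (er i3) (d_base D i3)); auto.
  apply spd_speed; auto. lra.
  intros r' t'. unfold along. assert (Q3 := PDE i3 r' t'). rewrite !mcoef_3 in Q3.
  replace (er i3 r' t' + spd P i3 r' t' * et i3 r' t') with
   ((chi r' * d_g D i3 r' (at_ (su P) r' t') - chi r' * d_g D i3 r' (at_ (su P') r' t'))
    - (spd P i3 r' t' - spd P' i3 r' t') * st Q' i3 r' t') by lra.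
  unfold Rminus at 1. eapply Rle_trans. apply Rabs_triang. rewrite Rabs_Ropp.
  rewrite Rmult_plus_distr_l. apply Rplus_le_compat; auto.
  eapply Rle_trans. apply Hst. apply chi_le. lra. }
intros i r t.
(* along the orbits of component [i] the sum [e_i + m e_3] has a derivative
   without derivatives of the difference [e_] *)
set (Z := fun r t => e_ i r t + mcoef D P i r t * e_ i3 r t).
set (Zt := fun r t => et i r t + (mcoef_t D P i r t * e_ i3 r t + mcoef D P i r t * et i3 r t)).
set (Zr := fun r t => er i r t + (mcoef_r D P i r t * e_ i3 r t + mcoef D P i r t * er i3 r t)).
assert (Cm := mcoef_C1 P BP i). assert (Cm0 := C1f_cont2 _ _ _ Cm).
assert (Ce3 := C1f_cont2 _ _ _ (Ce i3)).
assert (CZ : C1f Z Zt Zr).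
{ destruct (Ce i) as [A1 [A2 [A3 A4]]]. destruct (Ce i3) as [B1 [B2 [B3 B4]]]. destruct Cm as [M1 [M2 [M3 M4]]].
  refine (conj _ (conj _ (conj _ _))); intros r' t'.
  - apply is_derive_Rplus; auto. apply (is_derive_Rmult (fun t => mcoef D P i r' t) (fun t => e_ i3 r' t)); auto.
  - apply is_derive_Rplus; auto. apply (is_derive_Rmult (fun r => mcoef D P i r t') (fun r => e_ i3 r t')); auto.
  - unfold Zt. cts.
  - unfold Zr. cts. }
assert (me3 : forall r t, Rabs (mcoef D P i r t * e_ i3 r t) <= s0 * d).
{ intros r' t'. apply abs_mult_le; auto.
  eapply Rle_trans. apply mcoef_bound; auto. lra. }
assert (HZ : Rabs (Z r t) <= (ka * d + s0 * d) + W * (de * d + 2 * (s0 * d))).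
{ apply (transport_max chi W Na s0 (spd P i) (spd_t P i) Z Zt Zr (d_base D i)); auto.
  - apply spd_speed; auto.
  - lra.
  - intros t'. unfold Z. apply abs_plus_le; auto.
  - intros r' t'. unfold along, Zt, Zr.
    replace (er i r' t' + (mcoef_r D P i r' t' * e_ i3 r' t' + mcoef D P i r' t' * er i3 r' t') +
      spd P i r' t' * (et i r' t' + (mcoef_t D P i r' t' * e_ i3 r' t' + mcoef D P i r' t' * et i3 r' t'))) with
     ((er i r' t' + spd P i r' t' * et i r' t' + mcoef D P i r' t' * (er i3 r' t' + spd P i r' t' * et i3 r' t'))
      + along (spd P i) (mcoef_t D P i) (mcoef_r D P i) r' t' * e_ i3 r' t') by (unfold along; ring).
    rewrite PDE.
    assert (T1 : Rabs ((mcoef D P i r' t' - mcoef D P' i r' t') * (sr Q' i3 r' t' + spd P' i r' t' * st Q' i3 r' t')) <= chi r' * (8 * (N * ep * d))).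
    { rewrite Rabs_mult. apply Rle_trans with (4 * (ep * d) * (chi r' * (2 * N))); [|right; ring].
      apply Rmult_le_compat; try apply Rabs_pos; auto.
      eapply Rle_trans. apply Rabs_triang.
      assert (Rabs (spd P' i r' t' * st Q' i3 r' t') <= chi r' * Na * 1).
      { apply abs_mult_le. apply (spd_speed P' BP' i). apply BQ'. }
      assert (Rabs (sr Q' i3 r' t') <= chi r' * N) by apply BQ'.
      assert (chi r' * (N + Na) <= chi r' * (2 * N)) by (apply chi_le; lra). lra. }
    assert (T2 : Rabs (mcoef D P i r' t' * ((spd P i r' t' - spd P' i r' t') * st Q' i3 r' t')) <= chi r' * (4 * (ep * d))).
    { rewrite Rabs_mult. apply Rle_trans with (4 * (chi r' * (ep * d))); [|lra].
      apply Rmult_le_compat; try apply Rabs_pos; auto.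
      eapply Rle_trans. apply mcoef_bound; auto. lra. }
    assert (T3 : Rabs (along (spd P i) (mcoef_t D P i) (mcoef_r D P i) r' t' * e_ i3 r' t') <= chi r' * (s0 * d)).
    { rewrite Rabs_mult, <- Rmult_assoc. apply Rmult_le_compat; try apply Rabs_pos; auto.
      apply mcoef_along_bound; auto. }
    eapply Rle_trans. apply Rabs_triang.
    unfold Rminus at 1. eapply Rle_trans. apply Rplus_le_compat_r, Rabs_triang. rewrite Rabs_Ropp.
    unfold Rminus at 1. eapply Rle_trans. apply Rplus_le_compat_r, Rplus_le_compat_r, Rabs_triang. rewrite Rabs_Ropp.
    unfold Rminus at 1. eapply Rle_trans. apply Rplus_le_compat_r, Rplus_le_compat_r, Rplus_le_compat_r, Rabs_triang. rewrite Rabs_Ropp.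
    assert (G1 := Hg i r' t'). assert (G2 := Hst i r' t').
    apply Rle_trans with (chi r' * (de * d + ep * d + 8 * (N * ep * d) + 4 * (ep * d) + s0 * d)); [lra|].
    apply chi_le. assert (s0 * d = 16 * (N * ep * d)) by (unfold s0; ring). lra. }
replace (su Q i r t - su Q' i r t) with (Z r t + - (mcoef D P i r t * e_ i3 r t)) by (unfold Z, e_; ring).
eapply Rle_trans. apply Rabs_triang. rewrite Rabs_Ropp.
assert (M := me3 r t). rewrite rt. rewrite Rmult_plus_distr_l in HZ. lra.
Qed.

(** The [r]-derivative read off from the equations: it makes convergence of the
    [r]-derivatives a consequence of that of the functions and [t]-derivatives. *)
Definition explicit_sr (P Q : state) (i : idx4) (r t : R) : R :=
  chi r * d_g D i r (at_ (su P) r t) - spd P i r t * st Q i r t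
  - mcoef D P i r t * ((chi r * d_g D i3 r (at_ (su P) r t) - spd P i3 r t * st Q i3 r t)
                       + spd P i r t * st Q i3 r t).

Lemma solves_sr P Q : solves P Q -> forall i r t, sr Q i r t = explicit_sr P Q i r t.
Proof.
intros [S _] i r t. unfold explicit_sr. rewrite <- (S i), <- (S i3), mcoef_3. ring.
Qed.

Lemma sr_solves P Q :
  (forall i r t, sr Q i r t = explicit_sr P Q i r t) ->
  (forall i t, su Q i (d_base D i) t = d_h D i t + d_k D i * su P (d_part D i) (d_base D i) t) ->
  solves P Q.
Proof.
intros H1 H2. split; auto. intros i r t. rewrite (H1 i), (H1 i3). unfold explicit_sr. rewrite mcoef_3. ring.
Qed.

Context (chi1 : forall r, chi r <= 1).

Lemma explicit_sr_diff P Q P' Q' d :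
  (forall r t, cube (at_ (su P) r t) 1) -> (forall r t, cube (at_ (su P') r t) 1) ->
  (forall i r t, Rabs (st Q i r t) <= 1) -> (forall i r t, Rabs (st Q' i r t) <= 1) ->
  (forall i r t, Rabs (su P i r t - su P' i r t) <= d) ->
  (forall i r t, Rabs (st Q i r t - st Q' i r t) <= d) ->
  forall i r t, Rabs (explicit_sr P Q i r t - explicit_sr P' Q' i r t) <= 60 * N * d.
Proof.
intros BP BP' BQ BQ' Hd Hd' i r t.
assert (Hd0 : 0 <= d) by (eapply Rle_trans; [apply Rabs_pos|apply (Hd i r t)]).
assert (Hx : forall u, 0 <= u -> chi r * u <= u).
{ intros u Hu. rewrite <- (Rmult_1_l u) at 2. apply Rmult_le_compat_r; auto. }
assert (epd : 0 <= ep * d) by (apply Rmult_le_pos; lra).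
assert (epd1 : ep * d <= 1 * d) by (apply Rmult_le_compat_r; lra).
assert (ded : 0 <= de * d) by (apply Rmult_le_pos; lra).
assert (Nad : 0 <= Na * d) by (apply Rmult_le_pos; lra).
assert (Nd : Na * d + de * d + d <= N * d).
{ assert ((Na + de + 1) * d <= N * d) by (apply Rmult_le_compat_r; auto). lra. }
assert (Ha : forall i, Rabs (spd P i r t - spd P' i r t) <= ep * d).
{ intros j. eapply Rle_trans; [apply (spd_diff P P' d)|]; auto. }
assert (Ba' : forall i, Rabs (spd P' i r t) <= Na).
{ intros j. eapply Rle_trans; [|apply Hx; auto]. apply abs_scal_le; auto. apply (wp_mu_b WP). auto. }
assert (Hg : forall i, Rabs (chi r * d_g D i r (at_ (su P) r t) - chi r * d_g D i r (at_ (su P') r t)) <= de * d).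
{ intros j. eapply Rle_trans; [apply (src_diff P P' d)|]; auto. }
assert (Bg : Rabs (chi r * d_g D i3 r (at_ (su P') r t)) <= de).
{ eapply Rle_trans; [apply src_bound; auto|auto]. }
assert (Hm := mcoef_diff P P' d Hd i r t).
assert (Bm : Rabs (mcoef D P i r t) <= 4 * ep).
{ apply abs_sum4. intros j. rewrite <- (Rmult_1_r ep). apply abs_mult_ep. apply WP. apply BP. }
assert (Prod : forall j k, Rabs (spd P j r t * st Q k r t - spd P' j r t * st Q' k r t) <= ep * d + Na * d).
{ intros j k. replace (_ - _) with ((spd P j r t - spd P' j r t) * st Q k r t + spd P' j r t * (st Q k r t - st Q' k r t)) by ring.
  eapply Rle_trans. apply Rabs_triang. rewrite !Rabs_mult. rewrite <- (Rmult_1_r (ep * d)).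
  apply Rplus_le_compat; apply Rmult_le_compat; try apply Rabs_pos; auto. }
assert (B1 : forall j k, Rabs (spd P' j r t * st Q' k r t) <= Na).
{ intros j k. rewrite <- (Rmult_1_r Na). apply abs_mult_le; auto. }
unfold explicit_sr.
set (K := chi r * d_g D i3 r (at_ (su P) r t) - spd P i3 r t * st Q i3 r t + spd P i r t * st Q i3 r t).
set (K' := chi r * d_g D i3 r (at_ (su P') r t) - spd P' i3 r t * st Q' i3 r t + spd P' i r t * st Q' i3 r t).
assert (HK : Rabs (K - K') <= 4 * (N * d)).
{ unfold K, K'. assert (P1 := Prod i3 i3). assert (P2 := Prod i i3). assert (P3 := Hg i3).
  revert P1 P2 P3. abs_lra. }
assert (BK : Rabs K' <= 3 * N).
{ unfold K'. assert (P1 := B1 i3 i3). assert (P2 := B1 i i3).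
  revert P1 P2 Bg. abs_lra. }
assert (HmK : Rabs (mcoef D P i r t * K - mcoef D P' i r t * K') <= 40 * (N * d)).
{ replace (_ - _) with (mcoef D P i r t * (K - K') + (mcoef D P i r t - mcoef D P' i r t) * K') by ring.
  eapply Rle_trans. apply Rabs_triang. rewrite !Rabs_mult.
  assert (Rabs (mcoef D P i r t) * Rabs (K - K') <= 4 * (4 * (N * d))).
  { apply Rmult_le_compat; try apply Rabs_pos; auto. lra. }
  assert (Rabs (mcoef D P i r t - mcoef D P' i r t) * Rabs K' <= 4 * d * (3 * N)).
  { apply Rmult_le_compat; try apply Rabs_pos; auto. lra. }
  lra. }
assert (G1 := Hg i). assert (G2 := Prod i i).
match goal with |- Rabs ?z <= _ => replace z with
  ((chi r * d_g D i r (at_ (su P) r t) - chi r * d_g D i r (at_ (su P') r t))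
   - (spd P i r t * st Q i r t - spd P' i r t * st Q' i r t)
   - (mcoef D P i r t * K - mcoef D P' i r t * K')) by ring end.
revert G1 G2 HmK. abs_lra.
Qed.

Context (Hequi : forall e, 0 < e -> exists b, admissible e b).

Definition good (P : state) : Prop := C1_bounded P /\ equicontinuous P.

Definition next_state (P : {P | good P}) : {P | good P} :=
  let H := constructive_indefinite_description _
    (linear_step (proj1_sig P) (proj1 (proj2_sig P)) (proj2 (proj2_sig P))) in
  exist _ (proj1_sig H) (conj (proj1 (proj2_sig H)) (proj1 (proj2 (proj2_sig H)))).

Fixpoint iterate (n : nat) : {P | good P} :=
  match n with
  | O => exist _ zero_state (conj zero_bounded zero_equicontinuous)
  | S n => next_state (iterate n)
  end.

Definition approx (n : nat) : state := proj1_sig (iterate n).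

Lemma approx_bounded n : C1_bounded (approx n).
Proof. exact (proj1 (proj2_sig (iterate n))). Qed.

Lemma approx_equicontinuous n : equicontinuous (approx n).
Proof. exact (proj2 (proj2_sig (iterate n))). Qed.

Lemma approx_solves n : solves (approx n) (approx (S n)).
Proof.
unfold approx. simpl. unfold next_state. simpl.
destruct constructive_indefinite_description as [Q [H1 [H2 H3]]]. exact H3.
Qed.

Definition point : Type := (idx4 * R * R)%type.
Definition eval (f : idx4 -> R -> R -> R) (z : point) : R := f (fst (fst z)) (snd (fst z)) (snd z).

Lemma approx_step n : forall i r t, Rabs (su (approx (S n)) i r t - su (approx n) i r t) <= 1 * rate ^ n.
Proof.
induction n as [|n IH]; intros i r t.
- change (su (approx 0) i r t) with 0. rewrite Rminus_0_r. simpl (rate ^ 0). rewrite Rmult_1_r.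
  apply approx_bounded.
- replace (1 * rate ^ S n) with (rate * (1 * rate ^ n)) by (simpl; ring).
  apply (contraction (approx (S n)) (approx (S (S n))) (approx n) (approx (S n))); auto using approx_bounded, approx_solves.
Qed.

Definition uniform_cauchy (f : nat -> point -> R) : Prop :=
  forall eps, 0 < eps -> exists M, forall n m, (M <= n)%nat -> (M <= m)%nat ->
     forall z, Rabs (f n z - f m z) <= eps.

Lemma approx_cauchy : uniform_cauchy (fun n => eval (su (approx n))).
Proof.
intros eps He. apply (geometric_cauchy (fun n => eval (su (approx n))) 1 rate); auto. lra. apply rate_range.
intros n [[i r] t]. apply approx_step.
Qed.

(** A common modulus of continuity of the derivatives turns uniform
    convergence of the functions into that of the derivatives: compare with a
    difference quotient of fixed small step. *)
Lemma approx_cauchy_t : uniform_cauchy (fun n => eval (st (approx n))).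
Proof.
intros eps He. destruct (Hequi (eps / 8)) as [b Hb]; [lra|].
assert (Hb1 : 1 <= b) by apply Hb.
set (h := eps / (8 * b)). assert (Hh : 0 < h) by (apply Rdiv_lt_0_compat; lra).
assert (Hbh : b * h = eps / 8) by (unfold h; field; lra).
assert (Heh : 0 < eps * h / 4) by (apply Rdiv_lt_0_compat; [apply Rmult_lt_0_compat|]; lra).
destruct (approx_cauchy (eps * h / 4) Heh) as [M HM]. exists M. intros n m Hn Hm [[i r] t].
unfold eval; simpl.
assert (Q : forall k, exists c, Rabs (st (approx k) i r t - c) <= eps / 4 /\
   su (approx k) i r (t + h) - su (approx k) i r t = c * h).
{ intros k. destruct (MVT_real (fun t => su (approx k) i r t) (fun t => st (approx k) i r t) t (t + h)) as [c [Hc1 Hc2]].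
  { intros; apply approx_bounded. }
  exists (st (approx k) i r c). split.
  - eapply Rle_trans. apply (approx_equicontinuous k (eps / 8) b Hb i). rewrite Rmult_1_l.
    assert (Rabs (t - c) <= h).
    { rewrite Rmin_left, Rmax_right in Hc1 by lra. abs_lra. }
    assert (b * Rabs (t - c) <= b * h) by (apply Rmult_le_compat_l; lra). lra.
  - rewrite Hc2. ring. }
destruct (Q n) as [c [C1 C2]]. destruct (Q m) as [c' [C1' C2']].
assert (H1 := HM n m Hn Hm (i, r, t)). assert (H2 := HM n m Hn Hm (i, r, t + h)). unfold eval in H1, H2; simpl in H1, H2.
assert (Hcc : Rabs (c - c') * h <= eps / 2 * h).
{ rewrite <- (Rabs_pos_eq h) at 1 by lra. rewrite <- Rabs_mult.
  replace ((c - c') * h) with (c * h - c' * h) by ring. rewrite <- C2, <- C2'.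
  revert H1 H2. abs_lra. }
apply Rmult_le_reg_r in Hcc; auto.
revert C1 C1' Hcc. abs_lra.
Qed.

Lemma is_derive_uniform_limit (f df : nat -> R -> R) (F G : R -> R) x0 :
  (forall n y, is_derive (f n) y (df n y)) ->
  (forall eps, 0 < eps -> exists M, forall n, (M <= n)%nat -> forall y, Rabs (f n y - F y) <= eps) ->
  (forall eps, 0 < eps -> exists M, forall n, (M <= n)%nat -> forall y, Rabs (df n y - G y) <= eps) ->
  (forall n y, continuous (df n) y) ->
  is_derive F x0 (G x0).
Proof.
intros HD HF HG HC.
assert (CG : continuous G x0) by (apply (continuous_uniform_limit df); auto).
apply is_derive_eps. intros eps He.
destruct (continuous_eps_inv G x0 (eps / 2) CG ltac:(lra)) as [d Hd].
destruct (HG (eps / 2)) as [M1 HM1]; [lra|].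
exists d. intros y Hy.
apply le_epsilon. intros eta' Heta'.
destruct (HF (eta' / 2)) as [M2 HM2]; [lra|].
set (n := max M1 M2).
destruct (MVT_real (f n) (df n) x0 y (HD n)) as [c [Hc1 Hc2]].
assert (Hc : ball x0 d c).
{ apply Rle_lt_trans with (Rabs (y - x0)); [|exact Hy].
  change (Rabs (c - x0) <= Rabs (y - x0)).
  revert Hc1. abs_lra. }
assert (A1 := Hd c Hc). assert (A2 := HM1 n (Nat.le_max_l _ _) c).
assert (A3 := HM2 n (Nat.le_max_r _ _) y). assert (A4 := HM2 n (Nat.le_max_r _ _) x0).
assert (A5 : Rabs (f n y - f n x0 - (y - x0) * G x0) <= eps * Rabs (y - x0)).
{ rewrite Hc2. replace (df n c * (y - x0) - (y - x0) * G x0) with ((df n c - G x0) * (y - x0)) by ring.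
  rewrite Rabs_mult. apply Rmult_le_compat_r. apply Rabs_pos.
  revert A1 A2. abs_lra. }
replace (F y - F x0 - (y - x0) * G x0) with
  ((f n y - f n x0 - (y - x0) * G x0) + (- (f n y - F y) + (f n x0 - F x0))) by ring.
apply abs_plus_le; auto.
eapply Rle_trans. apply Rabs_triang. rewrite Rabs_Ropp. lra.
Qed.

(** The functions converge by contraction, their [t]-derivatives by the common
    modulus, their [r]-derivatives by the equations. *)
Theorem fixed_state_exists : exists P, C1_bounded P /\ solves P P.
Proof.
destruct (uniform_cauchy_limit (fun n => eval (su (approx n))) approx_cauchy) as [u Hu].
destruct (uniform_cauchy_limit (fun n => eval (st (approx n))) approx_cauchy_t) as [ut Hut].
set (P0 := State (fun i r t => u (i, r, t)) (fun i r t => ut (i, r, t)) (fun _ _ _ => 0)).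
set (P := State (fun i r t => u (i, r, t)) (fun i r t => ut (i, r, t)) (explicit_sr P0 P0)).
assert (Lu : forall eps, 0 < eps -> exists M, forall n, (M <= n)%nat -> forall i r t, Rabs (su (approx n) i r t - su P i r t) <= eps).
{ intros eps He. destruct (Hu eps He) as [M HM]. exists M. intros n Hn i r t. apply (HM n Hn (i, r, t)). }
assert (Lt : forall eps, 0 < eps -> exists M, forall n, (M <= n)%nat -> forall i r t, Rabs (st (approx n) i r t - st P i r t) <= eps).
{ intros eps He. destruct (Hut eps He) as [M HM]. exists M. intros n Hn i r t. apply (HM n Hn (i, r, t)). }
assert (Bu : forall i r t, Rabs (su P i r t) <= 1).
{ intros i r t. apply le_epsilon. intros eps He. destruct (Lu eps He) as [M HM].
  assert (A1 := HM M (le_n M) i r t). assert (A2 : Rabs (su (approx M) i r t) <= 1) by apply approx_bounded.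
  revert A1 A2. abs_lra. }
assert (Bt : forall i r t, Rabs (st P i r t) <= 1).
{ intros i r t. apply le_epsilon. intros eps He. destruct (Lt eps He) as [M HM].
  assert (A1 := HM M (le_n M) i r t). assert (A2 : Rabs (st (approx M) i r t) <= 1) by apply approx_bounded.
  revert A1 A2. abs_lra. }
assert (Lr : forall eps, 0 < eps -> exists M, forall n, (M <= n)%nat -> forall i r t, Rabs (sr (approx (S n)) i r t - sr P i r t) <= eps).
{ intros eps He. set (d := eps / (60 * N)). assert (Hd : 0 < d) by (apply Rdiv_lt_0_compat; lra).
  destruct (Lu d Hd) as [M1 HM1]. destruct (Lt d Hd) as [M2 HM2]. exists (max M1 M2). intros n Hn i r t.
  rewrite (solves_sr _ _ (approx_solves n)).
  replace eps with (60 * N * d) by (unfold d; field; lra).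
  apply explicit_sr_diff.
  - intros r' t' j. apply approx_bounded.
  - intros r' t' j. apply Bu.
  - apply approx_bounded.
  - apply Bt.
  - intros; apply HM1; lia.
  - intros; apply HM2; lia. }
exists P. split.
- refine (conj _ (conj Bu (conj Bt _))).
  + intros i. refine (conj _ (conj _ (conj _ _))).
    * intros r t. apply (is_derive_uniform_limit (fun n t => su (approx n) i r t) (fun n t => st (approx n) i r t)
        (fun t => su P i r t) (fun t => st P i r t)).
      -- intros; apply approx_bounded.
      -- intros eps He. destruct (Lu eps He) as [M HM]. exists M; auto.
      -- intros eps He. destruct (Lt eps He) as [M HM]. exists M; auto.
      -- intros n. apply cont2_t. apply (bounded_cont _ (approx_bounded n) i).
    * intros r t. apply (is_derive_uniform_limit (fun n r => su (approx (S n)) i r t) (fun n r => sr (approx (S n)) i r t)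
        (fun r => su P i r t) (fun r => sr P i r t)).
      -- intros; apply approx_bounded.
      -- intros eps He. destruct (Lu eps He) as [M HM]. exists M; intros; apply HM; lia.
      -- intros eps He. destruct (Lr eps He) as [M HM]. exists M; auto.
      -- intros n. apply cont2_r. apply (bounded_cont _ (approx_bounded (S n)) i).
    * intros r t. apply (continuous_uniform_limit (fun n (p : R * R) => st (approx n) i (fst p) (snd p))).
      -- intros eps He. destruct (Lt eps He) as [M HM]. exists M; intros; apply HM; lia.
      -- intros n. apply (bounded_cont _ (approx_bounded n) i).
    * intros r t. apply (continuous_uniform_limit (fun n (p : R * R) => sr (approx (S n)) i (fst p) (snd p))).
      -- intros eps He. destruct (Lr eps He) as [M HM]. exists M; intros; apply HM; lia.
      -- intros n. apply (bounded_cont _ (approx_bounded (S n)) i).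
  + intros i r t. apply le_epsilon. intros eps He. destruct (Lr eps He) as [M HM].
    assert (A1 := HM M (le_n M) i r t). assert (A2 : Rabs (sr (approx (S M)) i r t) <= chi r * N) by apply approx_bounded.
    revert A1 A2. abs_lra.
- apply sr_solves.
  + reflexivity.
  + intros i t. apply cond_eq. intros eps He.
    destruct (Lu (eps / 4)) as [M HM]; [lra|].
    assert (A1 := HM (S M) ltac:(lia) i (d_base D i) t). assert (A2 := HM M ltac:(lia) (d_part D i) (d_base D i) t).
    rewrite (proj2 (approx_solves M)) in A1.
    assert (A3 : Rabs (d_k D i * su (approx M) (d_part D i) (d_base D i) t - d_k D i * su P (d_part D i) (d_base D i) t) <= eps / 4).
    { rewrite <- Rmult_minus_distr_l, Rabs_mult. rewrite <- (Rmult_1_l (eps / 4)).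
      assert (Hk := wp_k WP i). assert (Hrt := rate_range). unfold rate in Hrt.
      apply Rmult_le_compat; try apply Rabs_pos; auto. lra. }
    revert A1 A3. abs_lra.
Qed.

(** Bounded solutions are unique, so they inherit the period of the data. *)
Lemma fixed_state_periodic P T : C1_bounded P -> solves P P ->
  (forall i t, d_h D i (t + T) = d_h D i t) ->
  forall i r t, su P i r (t + T) = su P i r t.
Proof.
intros BP SP HT.
set (P' := State (fun i r t => su P i r (t + T)) (fun i r t => st P i r (t + T)) (fun i r t => sr P i r (t + T))).
assert (CT : forall f, cont2 f -> cont2 (fun r t => f r (t + T))).
{ intros f Hf r t. cts. }
assert (BP' : C1_bounded P').
{ destruct BP as [B1 [B2 [B3 B4]]]. refine (conj _ (conj _ (conj _ _))); simpl; auto.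
  intros i. destruct (B1 i) as [A1 [A2 [A3 A4]]]. refine (conj _ (conj _ (conj _ _))); auto.
  intros r t. apply is_derive_eq with (1 * st P i r (t + T)); [|ring].
  apply (is_derive_comp (fun t => su P i r t) (fun t => t + T)). apply A1.
  apply is_derive_eq with (1 + 0); [|ring]. apply is_derive_Rplus. apply is_derive_Rid. apply is_derive_Rconst. }
assert (SP' : solves P' P').
{ destruct SP as [S1 S2]. split.
  - intros i r t. apply (S1 i r (t + T)).
  - intros i t. simpl. rewrite S2, HT. reflexivity. }
intros i r t.
assert (A := absorb (fun _ : point => True) (fun z => Rabs (eval (su P') z - eval (su P) z)) 2 0 rate rate_range).
assert (A1 : Rabs (eval (su P') (i, r, t) - eval (su P) (i, r, t)) <= 0 / (1 - rate)).
{ apply A; auto.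
  - intros [[i' r'] t'] _. unfold eval; simpl.
    assert (B1 := proj1 (proj2 BP') i' r' t'). assert (B2 := proj1 (proj2 BP) i' r' t'). simpl in B1.
    revert B1 B2. abs_lra.
  - intros d Hd [[i' r'] t'] _. rewrite Rplus_0_l. unfold eval; simpl fst; simpl snd.
    apply (contraction P' P' P P); auto.
    intros i'' r'' t''. apply (Hd (i'', r'', t'') I). }
unfold Rdiv in A1. rewrite Rmult_0_l in A1. unfold eval in A1; simpl in A1.
apply Rminus_diag_uniq. apply Rabs_eq_0. apply Rle_antisym; auto. apply Rabs_pos.
Qed.

End Iteration.

(** * Algebra of smooth coefficients *)

(** The analogue of [field] on the cube of size [rho].  One constant suffices,
    because rescaling to the unit cube makes it small wherever this matters. *)
Record smooth_field (rho : R) (f : R -> vec -> R) (df : R -> vec -> vec -> R) (B : R) : Prop := {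
  sf_B : 0 <= B;
  sf_cont : forall p, cube p rho -> forall r, continuous (fun r => f r p) r;
  sf_dcont : forall p w, cube p rho -> forall r, continuous (fun r => df r p w) r;
  sf_bound : forall r p, cube p rho -> Rabs (f r p) <= B;
  sf_lip : forall r p q d, cube p rho -> cube q rho -> near p q d -> Rabs (f r p - f r q) <= B * d;
  sf_dbound : forall r p w c, cube p rho -> cube w c -> Rabs (df r p w) <= B * c;
  sf_dlip : forall r p q w d c, cube p rho -> cube q rho -> near p q d -> cube w c ->
    Rabs (df r p w - df r q w) <= B * d * c;
  sf_taylor : forall r p q d, cube p rho -> cube q rho -> near q p d ->
    Rabs (f r q - f r p - df r p (fun j => q j - p j)) <= B * d * d;
  sf_sub : forall r p w w', df r p (fun j => w j - w' j) = df r p w - df r p w';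
  sf_scal : forall r p c w, df r p (fun j => c * w j) = c * df r p w }.

Definition smooth_coef (rho : R) (f : R -> vec -> R) : Prop :=
  exists df B, smooth_field rho f df B.

Lemma near_pos p q d : near p q d -> 0 <= d.
Proof. intros H. eapply Rle_trans; [apply Rabs_pos | apply (H i1)]. Qed.

Lemma cube_pos p d : cube p d -> 0 <= d.
Proof. intros H. eapply Rle_trans; [apply Rabs_pos | apply (H i1)]. Qed.

Lemma near_sym p q d : near p q d -> near q p d.
Proof. intros H j. rewrite Rabs_minus_sym. apply H. Qed.

Lemma smooth_coef_r rho (c : R -> R) C :
  (forall r, continuous c r) -> (forall r, Rabs (c r) <= C) -> smooth_coef rho (fun r _ => c r).
Proof.
intros Hc HC. exists (fun _ _ _ => 0), C.
assert (HC0 : 0 <= C) by (eapply Rle_trans; [apply Rabs_pos | apply (HC 0)]).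
assert (Z : forall u v, 0 <= u -> 0 <= v -> 0 <= C * u * v).
{ intros; repeat apply Rmult_le_pos; auto. }
split; intros; auto; try ring.
- apply continuous_const.
- rewrite Rminus_eq_0, Rabs_R0. apply Rmult_le_pos; auto. eapply near_pos; eauto.
- rewrite Rabs_R0. apply Rmult_le_pos; auto. eapply cube_pos; eauto.
- rewrite Rminus_eq_0, Rabs_R0. apply Z. eapply near_pos; eauto. eapply cube_pos; eauto.
- rewrite !Rminus_eq_0, Rabs_R0. apply Z; eapply near_pos; eauto.
Qed.

Lemma smooth_coef_var rho j : 0 <= rho -> smooth_coef rho (fun _ p => p j).
Proof.
intros Hr. exists (fun _ _ w => w j), (Rmax 1 rho).
assert (H1 : 1 <= Rmax 1 rho) by apply Rmax_l.
assert (H2 : rho <= Rmax 1 rho) by apply Rmax_r.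
assert (Z : forall u, 0 <= u -> u <= Rmax 1 rho * u).
{ intros u Hu. rewrite <- (Rmult_1_l u) at 1. apply Rmult_le_compat_r; auto. }
split; intros; auto; try ring; try lra.
- apply continuous_const.
- apply continuous_const.
- eapply Rle_trans; [apply H|]; lra.
- eapply Rle_trans; [apply H3|]. apply Z. eapply near_pos; eauto.
- eapply Rle_trans; [apply H0|]. apply Z. eapply cube_pos; eauto.
- rewrite Rminus_eq_0, Rabs_R0. repeat apply Rmult_le_pos; try lra. eapply near_pos; eauto. eapply cube_pos; eauto.
- rewrite Rminus_eq_0, Rabs_R0. repeat apply Rmult_le_pos; try lra; eapply near_pos; eauto.
Qed.

Lemma smooth_coef_plus rho f g : smooth_coef rho f -> smooth_coef rho g ->
  smooth_coef rho (fun r p => f r p + g r p).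
Proof.
intros [df [B Hf]] [dg [B' Hg]]. exists (fun r p w => df r p w + dg r p w), (B + B').
destruct Hf as [B0 F1 F2 F3 F4 F5 F6 F7 F8 F9]. destruct Hg as [B0' G1 G2 G3 G4 G5 G6 G7 G8 G9].
split.
- lra.
- intros; apply continuous_Rplus; auto.
- intros; apply continuous_Rplus; auto.
- intros r p Hp. eapply abs_plus_le; auto.
- intros. rewrite Rplus_sub_swap, Rmult_plus_distr_r.
  eapply abs_plus_le; auto.
- intros. rewrite Rmult_plus_distr_r.
  eapply abs_plus_le; auto.
- intros. rewrite Rplus_sub_swap, !Rmult_plus_distr_r.
  eapply abs_plus_le; auto.
- intros r p q d Hp Hq Hn. rewrite !Rmult_plus_distr_r.
  replace (_ - _) with ((f r q - f r p - df r p (fun j => q j - p j)) + (g r q - g r p - dg r p (fun j => q j - p j))) by ring.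
  eapply abs_plus_le; auto.
- intros. rewrite F8, G8. ring.
- intros. rewrite F9, G9. ring.
Qed.

Lemma smooth_coef_mult rho f g : smooth_coef rho f -> smooth_coef rho g ->
  smooth_coef rho (fun r p => f r p * g r p).
Proof.
intros [df [B Hf]] [dg [B' Hg]]. exists (fun r p w => df r p w * g r p + f r p * dg r p w), (4 * (B * B')).
destruct Hf as [B0 F1 F2 F3 F4 F5 F6 F7 F8 F9]. destruct Hg as [B0' G1 G2 G3 G4 G5 G6 G7 G8 G9].
assert (BB : 0 <= B * B') by (apply Rmult_le_pos; auto).
assert (BBu : forall u, 0 <= u -> 0 <= B * B' * u) by (intros; apply Rmult_le_pos; auto).
split.
- lra.
- intros; apply continuous_Rmult; auto.
- intros; apply continuous_Rplus; apply continuous_Rmult; auto.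
- intros r p Hp. eapply Rle_trans. eapply abs_mult_le; eauto. lra.
- intros r p q d Hp Hq Hn. 
  replace (_ - _) with ((f r p - f r q) * g r p + f r q * (g r p - g r q)) by ring.
  eapply Rle_trans. apply Rabs_triang.
  assert (Hd := near_pos _ _ _ Hn). assert (P1 := BBu d Hd).
  assert (Q1 := abs_mult_le (F4 r p q d Hp Hq Hn) (G3 r p Hp)).
  assert (Q2 := abs_mult_le (F3 r q Hq) (G4 r p q d Hp Hq Hn)). lra.
- intros r p w c Hp Hw. eapply Rle_trans. apply Rabs_triang.
  assert (Hd := cube_pos _ _ Hw). assert (P1 := BBu c Hd).
  assert (Q1 := abs_mult_le (F5 r p w c Hp Hw) (G3 r p Hp)).
  assert (Q2 := abs_mult_le (F3 r p Hp) (G5 r p w c Hp Hw)). lra.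
- intros r p q w d c Hp Hq Hn Hw.
  replace (_ - _) with ((df r p w - df r q w) * g r p + df r q w * (g r p - g r q)
     + ((f r p - f r q) * dg r p w + f r q * (dg r p w - dg r q w))) by ring.
  assert (Hd := near_pos _ _ _ Hn). assert (Hc := cube_pos _ _ Hw).
  assert (P1 := Rmult_le_pos _ _ (BBu d Hd) Hc).
  assert (Q1 := abs_mult_le (F6 r p q w d c Hp Hq Hn Hw) (G3 r p Hp)).
  assert (Q2 := abs_mult_le (F5 r q w c Hq Hw) (G4 r p q d Hp Hq Hn)).
  assert (Q3 := abs_mult_le (F4 r p q d Hp Hq Hn) (G5 r p w c Hp Hw)).
  assert (Q4 := abs_mult_le (F3 r q Hq) (G6 r p q w d c Hp Hq Hn Hw)).
  eapply Rle_trans. apply Rabs_triang. eapply Rle_trans. apply Rplus_le_compat; apply Rabs_triang. lra.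
- intros r p q d Hp Hq Hn.
  replace (_ - _) with ((f r q - f r p - df r p (fun j => q j - p j)) * g r p
     + f r p * (g r q - g r p - dg r p (fun j => q j - p j)) + (f r q - f r p) * (g r q - g r p)) by ring.
  assert (Hd := near_pos _ _ _ Hn).
  assert (P1 := Rmult_le_pos _ _ (BBu d Hd) Hd).
  assert (Q1 := abs_mult_le (F7 r p q d Hp Hq Hn) (G3 r p Hp)).
  assert (Q2 := abs_mult_le (F3 r p Hp) (G7 r p q d Hp Hq Hn)).
  assert (Q3 := abs_mult_le (F4 r q p d Hq Hp Hn) (G4 r q p d Hq Hp Hn)).
  eapply Rle_trans. apply Rabs_triang. eapply Rle_trans. apply Rplus_le_compat_r, Rabs_triang. lra.
- intros. rewrite F8, G8. ring.
- intros. rewrite F9, G9. ring.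
Qed.

(** The remainder of the quotient rule is that of [f], divided by two values of
    [f], plus a product of two increments. *)
Lemma smooth_coef_inv rho f l : 0 < l -> (forall r p, cube p rho -> l <= Rabs (f r p)) ->
  smooth_coef rho f -> smooth_coef rho (fun r p => / f r p).
Proof.
intros Hl Hfl [df [B Hf]].
destruct Hf as [B0 F1 F2 F3 F4 F5 F6 F7 F8 F9].
set (k := / l). assert (Hk : 0 < k) by (apply Rinv_0_lt_compat; auto).
assert (Nz : forall r p, cube p rho -> f r p <> 0).
{ intros r p Hp E. specialize (Hfl r p Hp). rewrite E, Rabs_R0 in Hfl. lra. }
assert (Bi : forall r p, cube p rho -> Rabs (/ f r p) <= k).
{ intros r p Hp. rewrite Rabs_inv. apply Rinv_le_contravar; auto. }
set (C := k + B * (k * k) + 2 * (B * B * (k * k * k)) + B * (k * k)).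
assert (K2 : 0 <= k * k) by (apply Rmult_le_pos; lra).
assert (T1 : 0 <= B * (k * k)) by (apply Rmult_le_pos; auto).
assert (T2 : 0 <= B * B * (k * k * k)) by (repeat apply Rmult_le_pos; lra).
exists (fun r p w => - (df r p w * (/ f r p * / f r p))), C.
split.
- unfold C; lra.
- intros p Hp r. apply (continuous_comp (fun r => f r p) Rinv). auto.
  apply continuity_pt_filterlim. apply (continuity_pt_inv (fun x => x)). apply continuity_pt_id. apply Nz; auto.
- intros p w Hp r. assert (Ci : continuous (fun r => / f r p) r).
  { apply (continuous_comp (fun r => f r p) Rinv). auto.
    apply continuity_pt_filterlim. apply (continuity_pt_inv (fun x => x)). apply continuity_pt_id. apply Nz; auto. }
  apply continuous_Ropp, continuous_Rmult; auto. apply continuous_Rmult; auto.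
- intros r p Hp. eapply Rle_trans. apply Bi; auto. unfold C; lra.
- intros r p q d Hp Hq Hn. 
  replace (/ f r p - / f r q) with ((f r q - f r p) * (/ f r p * / f r q)).
  2:{ field. split; apply Nz; auto. }
  assert (Hd := near_pos _ _ _ Hn).
  eapply Rle_trans. eapply abs_mult_le. apply (F4 r q p d Hq Hp (near_sym _ _ _ Hn)). eapply abs_mult_le; apply Bi; auto.
  replace (B * d * (k * k)) with (B * (k * k) * d) by ring. apply Rmult_le_compat_r; auto. unfold C; lra.
- intros r p w c Hp Hw. rewrite Rabs_Ropp.
  assert (Hc := cube_pos _ _ Hw).
  eapply Rle_trans. eapply abs_mult_le. apply (F5 r p w c Hp Hw). eapply abs_mult_le; apply Bi; auto.
  replace (B * c * (k * k)) with (B * (k * k) * c) by ring. apply Rmult_le_compat_r; auto. unfold C; lra.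
- intros r p q w d c Hp Hq Hn Hw.
  assert (Hd := near_pos _ _ _ Hn). assert (Hc := cube_pos _ _ Hw).
  replace (_ - _) with (- ((df r p w - df r q w) * (/ f r p * / f r p))
     + - (df r q w * ((f r q - f r p) * (/ f r p * / f r p * / f r q)))
     + - (df r q w * ((f r q - f r p) * (/ f r p * / f r q * / f r q)))).
  2:{ field. split; apply Nz; auto. }
  eapply Rle_trans. apply Rabs_triang. eapply Rle_trans. apply Rplus_le_compat_r, Rabs_triang.
  rewrite !Rabs_Ropp.
  assert (Q1 := abs_mult_le (F6 r p q w d c Hp Hq Hn Hw) (abs_mult_le (Bi r p Hp) (Bi r p Hp))).
  assert (Q2 := abs_mult_le (F5 r q w c Hq Hw) (abs_mult_le (F4 r q p d Hq Hp (near_sym _ _ _ Hn)) (abs_mult_le (abs_mult_le (Bi r p Hp) (Bi r p Hp)) (Bi r q Hq)))).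
  assert (Q3 := abs_mult_le (F5 r q w c Hq Hw) (abs_mult_le (F4 r q p d Hq Hp (near_sym _ _ _ Hn)) (abs_mult_le (abs_mult_le (Bi r p Hp) (Bi r q Hq)) (Bi r q Hq)))).
  assert (0 <= d * c) by (apply Rmult_le_pos; auto).
  apply Rle_trans with ((B * (k * k) + 2 * (B * B * (k * k * k))) * (d * c)); [lra|].
  rewrite (Rmult_assoc C). apply Rmult_le_compat_r; auto. unfold C; lra.
- intros r p q d Hp Hq Hn.
  assert (Hd := near_pos _ _ _ Hn).
  replace (_ - _) with (- ((f r q - f r p - df r p (fun j => q j - p j)) * (/ f r p * / f r q))
    + df r p (fun j => q j - p j) * ((f r q - f r p) * (/ f r p * / f r p * / f r q))).
  2:{ field. split; apply Nz; auto. }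
  eapply Rle_trans. apply Rabs_triang. rewrite Rabs_Ropp.
  assert (Q1 := abs_mult_le (F7 r p q d Hp Hq Hn) (abs_mult_le (Bi r p Hp) (Bi r q Hq))).
  assert (Q2 := abs_mult_le (F5 r p _ d Hp Hn) (abs_mult_le (F4 r q p d Hq Hp Hn) (abs_mult_le (abs_mult_le (Bi r p Hp) (Bi r p Hp)) (Bi r q Hq)))).
  assert (0 <= d * d) by (apply Rmult_le_pos; auto).
  apply Rle_trans with ((B * (k * k) + B * B * (k * k * k)) * (d * d)); [lra|].
  rewrite (Rmult_assoc C). apply Rmult_le_compat_r; auto. unfold C; lra.
- intros. rewrite F8. ring.
- intros. rewrite F9. ring.
Qed.

(** ** Rescaling to the unit cube *)

Definition scaled (nu : R) (p : vec) : vec := fun j => nu * p j.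

Lemma cube_scaled nu rho p : 0 <= nu -> nu <= rho -> cube p 1 -> cube (scaled nu p) rho.
Proof.
intros H1 H2 Hp j. unfold scaled. rewrite Rabs_mult, (Rabs_pos_eq nu) by auto.
specialize (Hp j). assert (nu * Rabs (p j) <= nu * 1) by (apply Rmult_le_compat_l; auto). lra.
Qed.

Lemma near_scaled nu p q d : 0 <= nu -> near p q d -> near (scaled nu p) (scaled nu q) (nu * d).
Proof.
intros H1 H j. unfold scaled. rewrite <- Rmult_minus_distr_l, Rabs_mult, (Rabs_pos_eq nu) by auto.
apply Rmult_le_compat_l; auto.
Qed.

Lemma cube_scaled_gen nu p d : 0 <= nu -> cube p d -> cube (scaled nu p) (nu * d).
Proof.
intros H1 H j. unfold scaled. rewrite Rabs_mult, (Rabs_pos_eq nu) by auto.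
apply Rmult_le_compat_l; auto.
Qed.

(** Each derivative in [p] gains a factor [nu]. *)
Lemma field_scaled_speed rho f df B nu ep :
  smooth_field rho f df B -> 0 < nu -> nu <= rho -> nu <= 1 -> B * nu <= ep ->
  field (fun r p => f r (scaled nu p)) (fun r p w => nu * df r (scaled nu p) w) ep ep.
Proof.
intros [B0 F1 F2 F3 F4 F5 F6 F7 F8 F9] Hn Hnr Hn1 Hep.
assert (Hn0 : 0 <= nu) by lra.
assert (Hn2 : B * nu * nu <= ep).
{ assert (B * nu * nu <= B * nu * 1). { apply Rmult_le_compat_l; auto. apply Rmult_le_pos; auto. } lra. }
assert (HC := fun p => cube_scaled nu rho p Hn0 Hnr).
split.
- intros p Hp r. apply F1; auto.
- intros p w Hp r. apply (continuous_Rmult (fun _ => nu)). apply continuous_const. apply F2; auto.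
- intros r p q d Hp Hq Hd. eapply Rle_trans. apply (F4 r _ _ (nu * d)); auto. apply near_scaled; auto.
  rewrite <- Rmult_assoc. apply Rmult_le_compat_r; auto. eapply near_pos; eauto.
- intros r p w c Hp Hw. rewrite Rabs_mult, (Rabs_pos_eq nu) by auto.
  assert (Hc := cube_pos _ _ Hw).
  assert (nu * Rabs (df r (scaled nu p) w) <= nu * (B * c)) by (apply Rmult_le_compat_l; auto).
  assert (B * nu * c <= ep * c) by (apply Rmult_le_compat_r; auto). lra.
- intros r p q w d c Hp Hq Hd Hw. rewrite <- Rmult_minus_distr_l, Rabs_mult, (Rabs_pos_eq nu) by auto.
  assert (Hc := cube_pos _ _ Hw). assert (Hd0 := near_pos _ _ _ Hd).
  assert (nu * Rabs (df r (scaled nu p) w - df r (scaled nu q) w) <= nu * (B * (nu * d) * c)).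
  { apply Rmult_le_compat_l; auto. apply F6; auto. apply near_scaled; auto. }
  assert (B * nu * nu * (d * c) <= ep * (d * c)). { apply Rmult_le_compat_r; auto. apply Rmult_le_pos; auto. } lra.
- intros r p q d Hp Hq Hd. assert (Hd0 := near_pos _ _ _ Hd).
  rewrite <- F9.
  assert (T := F7 r (scaled nu p) (scaled nu q) (nu * d) (HC p Hp) (HC q Hq) (near_scaled _ _ _ _ Hn0 Hd)).
  replace (df r (scaled nu p) (fun j => nu * (q j - p j))) with (df r (scaled nu p) (fun j => scaled nu q j - scaled nu p j)).
  2:{ rewrite F8, F9, F8. unfold scaled. rewrite !F9. ring. }
  assert (B * nu * nu * (d * d) <= ep * (d * d)). { apply Rmult_le_compat_r; auto. apply Rmult_le_pos; auto. } lra.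
- intros. rewrite F8. ring.
- intros. rewrite F9. ring.
Qed.

(** A source that vanishes at [0] with slope at most [de0] keeps that slope
    after rescaling, up to an error proportional to [nu]. *)
Lemma field_scaled_source rho f df B nu ep de0 :
  smooth_field rho f df B -> 0 < nu -> nu <= rho -> nu <= 1 -> B * nu <= ep -> 0 <= de0 ->
  (forall r p d, d <= rho -> cube p d -> Rabs (f r p) <= de0 * d) ->
  field (fun r p => f r (scaled nu p) / nu) (fun r p w => df r (scaled nu p) w) (de0 + 3 * ep) ep.
Proof.
intros [B0 F1 F2 F3 F4 F5 F6 F7 F8 F9] Hn Hnr Hn1 Hep Hde0 Hlin.
assert (Hn0 : 0 <= nu) by lra.
assert (Hep0 : 0 <= ep). { assert (0 <= B * nu) by (apply Rmult_le_pos; auto). lra. }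
assert (HC := fun p => cube_scaled nu rho p Hn0 Hnr).
assert (C0 : forall d, 0 <= d -> cube (fun _ => 0) d) by (intros d Hd j; rewrite Rabs_R0; auto).
assert (f0 : forall r, f r (fun _ => 0) = 0).
{ intros r. assert (H := Hlin r (fun _ => 0) 0 ltac:(lra) (C0 0 ltac:(lra))). rewrite Rmult_0_r in H.
  apply Rabs_eq_0. apply Rle_antisym; auto. apply Rabs_pos. }
(* the derivative at 0 is a limit of difference quotients [f r (h w) / h],
   and these are at most [de0 c] *)
assert (D0 : forall r w c, cube w c -> Rabs (df r (fun _ => 0) w) <= de0 * c).
{ intros r w c Hw. assert (Hc := cube_pos _ _ Hw).
  apply le_epsilon. intros eps He.
  set (h := Rmin (rho / (c + 1)) (eps / (B * c * c + 1))).
  assert (HBcc : 0 <= B * c * c) by (repeat apply Rmult_le_pos; auto).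
  assert (Hh : 0 < h) by (apply Rmin_pos; apply Rdiv_lt_0_compat; lra).
  assert (Hh1 : h * c <= rho).
  { apply Rle_trans with (rho / (c + 1) * (c + 1)). apply Rmult_le_compat; try lra. apply Rmin_l. right; field; lra. }
  assert (Hh2 : h * (B * c * c) <= eps).
  { apply Rle_trans with (eps / (B * c * c + 1) * (B * c * c + 1)). apply Rmult_le_compat; try lra. apply Rmin_r. right; field; lra. }
  assert (Hq : cube (scaled h w) (h * c)) by (apply cube_scaled_gen; auto; lra).
  assert (Hn' : near (scaled h w) (fun _ => 0) (h * c)) by (intros j; rewrite Rminus_0_r; apply Hq).
  assert (Hqr : cube (scaled h w) rho) by (intros j; eapply Rle_trans; [apply Hq|auto]).
  assert (T := F7 r (fun _ => 0) (scaled h w) (h * c) (C0 rho ltac:(lra)) Hqr Hn').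
  assert (L1 := Hlin r (scaled h w) (h * c) Hh1 Hq).
  rewrite f0 in T. rewrite F8 in T. unfold scaled in T at 2. rewrite F9 in T.
  assert (Z : df r (fun _ => 0) (fun _ => 0) = 0).
  { assert (E := F9 r (fun _ => 0) 0 (fun _ => 0)). rewrite !Rmult_0_l in E. exact E. }
  rewrite Z in T.
  assert (h * Rabs (df r (fun _ => 0) w) <= h * (de0 * c + eps)).
  { rewrite <- (Rabs_pos_eq h) at 1 by lra. rewrite <- Rabs_mult.
    assert (Hx : h * (h * (B * c * c)) <= h * eps) by (apply Rmult_le_compat_l; lra).
    revert T L1 Hx. abs_lra. }
  apply Rmult_le_reg_l with h; auto. }
assert (DB : forall r p w c, cube p 1 -> cube w c -> Rabs (df r (scaled nu p) w) <= (de0 + ep) * c).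
{ intros r p w c Hp Hw. assert (Hc := cube_pos _ _ Hw).
  assert (Hn' : near (scaled nu p) (fun _ => 0) (nu * 1)).
  { intros j; rewrite Rminus_0_r. apply cube_scaled_gen; auto. }
  assert (T := F6 r _ _ w (nu * 1) c (HC p Hp) (C0 rho ltac:(lra)) Hn' Hw).
  assert (T2 := D0 r w c Hw).
  assert (B * nu * c <= ep * c) by (apply Rmult_le_compat_r; auto).
  rewrite Rmult_1_r in T.
  revert T T2. abs_lra. }
assert (TY : forall r p q d, cube p 1 -> cube q 1 -> near q p d ->
  Rabs (f r (scaled nu q) / nu - f r (scaled nu p) / nu - df r (scaled nu p) (fun j => q j - p j)) <= ep * d * d).
{ intros r p q d Hp Hq Hd. assert (Hd0 := near_pos _ _ _ Hd).
  assert (T := F7 r (scaled nu p) (scaled nu q) (nu * d) (HC p Hp) (HC q Hq) (near_scaled _ _ _ _ Hn0 Hd)).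
  rewrite F8 in T. unfold scaled in T at 4 6. rewrite !F9 in T. rewrite F8.
  match goal with |- Rabs ?z <= _ => set (Z := z) end.
  assert (E : nu * Z = f r (scaled nu q) - f r (scaled nu p) -
       (nu * df r (scaled nu p) q - nu * df r (scaled nu p) p)) by (unfold Z; field; lra).
  apply Rmult_le_reg_l with nu; auto.
  rewrite <- (Rabs_pos_eq nu) at 1 by lra. rewrite <- Rabs_mult, E.
  eapply Rle_trans. exact T.
  assert (B * nu * (nu * (d * d)) <= ep * (nu * (d * d))).
  { apply Rmult_le_compat_r; auto. repeat apply Rmult_le_pos; auto. } lra. }
split; auto.
- intros p Hp r. apply (continuous_Rmult (fun r => f r (scaled nu p)) (fun _ => / nu)). apply F1; auto. apply continuous_const.
(* 2 is the diameter of the unit cube, so larger [d] give nothing new *)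
- assert (Small : forall r p q d, cube p 1 -> cube q 1 -> near p q d -> d <= 2 ->
    Rabs (f r (scaled nu p) / nu - f r (scaled nu q) / nu) <= (de0 + 3 * ep) * d).
  { intros r p q d Hp Hq Hd Hd2. assert (Hd0 := near_pos _ _ _ Hd).
    assert (T := TY r q p d Hq Hp Hd).
    assert (T2 := DB r q (fun j => p j - q j) d Hq Hd).
    assert (ep * d * d <= ep * d * 2). { apply Rmult_le_compat_l; auto. apply Rmult_le_pos; auto. }
    revert T T2. abs_lra. }
  intros r p q d Hp Hq Hd. destruct (Rle_lt_dec d 2) as [H2|H2]; auto.
  apply Rle_trans with ((de0 + 3 * ep) * 2). apply Small; auto; [|lra].
  intros j. specialize (Hp j). specialize (Hq j). revert Hp Hq. abs_lra.
  apply Rmult_le_compat_l; lra.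
- intros r p w c Hp Hw. eapply Rle_trans. apply DB; eauto. apply Rmult_le_compat_r. eapply cube_pos; eauto. lra.
- intros r p q w d c Hp Hq Hd Hw.
  assert (Hc := cube_pos _ _ Hw). assert (Hd0 := near_pos _ _ _ Hd).
  eapply Rle_trans. apply (F6 r _ _ w (nu * d) c); auto. apply near_scaled; auto.
  replace (B * (nu * d) * c) with (B * nu * (d * c)) by ring. rewrite (Rmult_assoc ep).
  apply Rmult_le_compat_r; auto. apply Rmult_le_pos; auto.
Qed.

(** * The perturbation system in normalized form *)

Lemma smooth_coef_const rho c : smooth_coef rho (fun _ _ => c).
Proof. apply (smooth_coef_r rho (fun _ => c) (Rabs c)). intros; apply continuous_const. intros; lra. Qed.

Lemma smooth_coef_ext rho f g : (forall r p, f r p = g r p) -> smooth_coef rho f -> smooth_coef rho g.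
Proof.
intros E H. replace g with f; auto.
apply functional_extensionality. intros r. apply functional_extensionality. intros p. apply E.
Qed.

Lemma smooth_coef_opp rho f : smooth_coef rho f -> smooth_coef rho (fun r p => - f r p).
Proof.
intros H. apply (smooth_coef_ext rho (fun r p => -1 * f r p)). intros; ring.
apply (smooth_coef_mult rho (fun _ _ => -1) f); auto. apply smooth_coef_const.
Qed.

Lemma smooth_coef_minus rho f g : smooth_coef rho f -> smooth_coef rho g ->
  smooth_coef rho (fun r p => f r p - g r p).
Proof. intros Hf Hg. apply (smooth_coef_plus rho f (fun r p => - g r p)); auto. apply smooth_coef_opp; auto. Qed.

Lemma smooth_coef_div rho f k : smooth_coef rho f -> smooth_coef rho (fun r p => f r p / k).
Proof. intros Hf. apply (smooth_coef_mult rho f (fun _ _ => / k)); auto. apply smooth_coef_const. Qed.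

Ltac smooth :=
  repeat match goal with
    | |- smooth_coef _ (fun _ _ => ?c) => apply smooth_coef_const
    | H : smooth_coef ?rho ?f |- smooth_coef ?rho ?f => exact H
    | |- smooth_coef ?rho (fun r p => @?f r p + @?g r p) => apply (smooth_coef_plus rho f g)
    | |- smooth_coef ?rho (fun r p => @?f r p - @?g r p) => apply (smooth_coef_minus rho f g)
    | |- smooth_coef ?rho (fun r p => @?f r p * @?g r p) => apply (smooth_coef_mult rho f g)
    | |- smooth_coef ?rho (fun r p => @?f r p / ?k) => apply (smooth_coef_div rho f k)
    | |- smooth_coef ?rho (fun r p => - @?f r p) => apply (smooth_coef_opp rho f)
    | |- smooth_coef _ (fun _ p => p ?j) => apply smooth_coef_var
    end.

(** The coefficients of the system as functions on all of [R]: [bg1], [bg2],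
    [bg4] stand for the background, [bg1'], [bg4'] for the derivatives, [cf] and
    [cf'] for frak_c and its derivative, [ri] for [1 / r]. *)
Record profile : Type := Profile {
  bg1 : R -> R; bg2 : R -> R; bg4 : R -> R; bg1' : R -> R; bg4' : R -> R;
  cf : R -> R; cf' : R -> R; ri : R -> R }.

Record profile_bounds (B : profile) (C q : R) : Prop := {
  pb_cont : forall f, In f (bg1 B :: bg2 B :: bg4 B :: bg1' B :: bg4' B :: cf B :: cf' B :: ri B :: nil) ->
    forall r, continuous f r;
  pb_bound : forall f, In f (bg1 B :: bg2 B :: bg4 B :: cf B :: nil) -> forall r, Rabs (f r) <= C;
  pb_bound' : forall f, In f (bg1' B :: bg4' B :: cf' B :: nil) -> forall r, Rabs (f r) <= C * q;
  pb_ri : forall r, Rabs (ri B r) <= q }.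

Section System.
Context (gamma th : R) (B : profile).

(** The first component is weighted by [th], so that the boundary relations
    contract in the maximum norm. *)
Definition wt (i : idx4) : R := match i with i1 => th | _ => 1 end.

(** The physical unknown at [p] is [(p_1 / th, p_2, p_3, p_4)]. *)
Definition speed_at (i : idx4) (r : R) (p : vec) : R :=
  let P1 := p i1 / th in let P3 := p i3 in let P4 := p i4 in
  match i with
  | i1 => (gamma + 1) / 4 * (P1 + bg1 B r - cf B r * P3) + (3 - gamma) / 4 * (P4 + bg4 B r + cf B r * P3)
  | i2 | i3 => 1 / 2 * (P1 + bg1 B r + P4 + bg4 B r)
  | i4 => (3 - gamma) / 4 * (P1 + bg1 B r - cf B r * P3) + (gamma + 1) / 4 * (P4 + bg4 B r + cf B r * P3)
  end.

(** The terms of the system without derivatives of the unknown. *)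
Definition source_at (i : idx4) (r : R) (p : vec) : R :=
  let P1 := p i1 / th in let P2 := p i2 in let P3 := p i3 in let P4 := p i4 in
  match i with
  | i1 => (- ((gamma + 1) / 4) * bg1' B r - (gamma - 1) / 4 * ri B r * bg1 B r) * P1
      + 2 * bg2 B r * ri B r * P2
      + (- ((3 - gamma) / 4) * bg1' B r + (gamma - 1) / 4 * ri B r * bg4 B r) * P4
      + ri B r * (P2 * P2)
      + (gamma - 1) / 8 * ri B r * (P4 * P4 - P1 * P1)
      + (gamma - 1) / 4 * cf B r * ri B r * (P3 * (P1 + P4))
      + ((gamma - 1) / 2 * bg1' B r + (gamma - 1) / 4 * ri B r * (bg1 B r + bg4 B r)) * cf B r * P3
      + speed_at i1 r p * cf' B r * P3
  | i2 => - (speed_at i2 r p * ri B r) * P2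
  | i3 => 0
  | i4 => (- ((3 - gamma) / 4) * bg4' B r + (gamma - 1) / 4 * ri B r * bg1 B r) * P1
      + 2 * bg2 B r * ri B r * P2
      + (- ((gamma + 1) / 4) * bg4' B r - (gamma - 1) / 4 * ri B r * bg4 B r) * P4
      + ri B r * (P2 * P2)
      - (gamma - 1) / 8 * ri B r * (P4 * P4 - P1 * P1)
      - (gamma - 1) / 4 * cf B r * ri B r * (P3 * (P1 + P4))
      - ((gamma - 1) / 2 * bg4' B r + (gamma - 1) / 4 * ri B r * (bg1 B r + bg4 B r)) * cf B r * P3
      - speed_at i4 r p * cf' B r * P3
  end.

Definition reduced_source (i : idx4) (r : R) (p : vec) : R :=
  wt i * (/ speed_at i r p * source_at i r p).

Section Bounds.
Context (C q l0 : R).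
Context (Hth : 0 < th < 1) (Hgam : 1 < gamma) (HC1 : 1 <= C) (HCg : gamma + 3 <= C) (HCth : / th <= C).
Context (Hq : 0 < q) (HB : profile_bounds B C q) (Hl0 : 0 < l0).
Context (Hl : forall i r, l0 <= Rabs (speed_at i r (fun _ => 0))).

Let Bb1 r : Rabs (bg1 B r) <= C. Proof. apply (pb_bound _ _ _ HB). simpl; tauto. Qed.
Let Bb2 r : Rabs (bg2 B r) <= C. Proof. apply (pb_bound _ _ _ HB). simpl; tauto. Qed.
Let Bb4 r : Rabs (bg4 B r) <= C. Proof. apply (pb_bound _ _ _ HB). simpl; tauto. Qed.
Let Bcf r : Rabs (cf B r) <= C. Proof. apply (pb_bound _ _ _ HB). simpl; tauto. Qed.
Let Bb1' r : Rabs (bg1' B r) <= C * q. Proof. apply (pb_bound' _ _ _ HB). simpl; tauto. Qed.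
Let Bb4' r : Rabs (bg4' B r) <= C * q. Proof. apply (pb_bound' _ _ _ HB). simpl; tauto. Qed.
Let Bcf' r : Rabs (cf' B r) <= C * q. Proof. apply (pb_bound' _ _ _ HB). simpl; tauto. Qed.
Let Bri r : Rabs (ri B r) <= q. Proof. apply HB. Qed.

Lemma smooth_speed rho i : 0 <= rho -> smooth_coef rho (speed_at i).
Proof.
intros Hr.
assert (S1 : smooth_coef rho (fun r _ => bg1 B r)) by (apply (smooth_coef_r rho _ C); auto; apply HB; simpl; tauto).
assert (S4 : smooth_coef rho (fun r _ => bg4 B r)) by (apply (smooth_coef_r rho _ C); auto; apply HB; simpl; tauto).
assert (Sc : smooth_coef rho (fun r _ => cf B r)) by (apply (smooth_coef_r rho _ C); auto; apply HB; simpl; tauto).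
destruct i; unfold speed_at; cbv zeta; smooth; auto.
Qed.

Lemma smooth_source rho i : 0 <= rho -> smooth_coef rho (source_at i).
Proof.
intros Hr.
assert (S1 : smooth_coef rho (fun r _ => bg1 B r)) by (apply (smooth_coef_r rho _ C); auto; apply HB; simpl; tauto).
assert (S2 : smooth_coef rho (fun r _ => bg2 B r)) by (apply (smooth_coef_r rho _ C); auto; apply HB; simpl; tauto).
assert (S4 : smooth_coef rho (fun r _ => bg4 B r)) by (apply (smooth_coef_r rho _ C); auto; apply HB; simpl; tauto).
assert (Sc : smooth_coef rho (fun r _ => cf B r)) by (apply (smooth_coef_r rho _ C); auto; apply HB; simpl; tauto).
assert (S1' : smooth_coef rho (fun r _ => bg1' B r)) by (apply (smooth_coef_r rho _ (C * q)); auto; apply HB; simpl; tauto).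
assert (S4' : smooth_coef rho (fun r _ => bg4' B r)) by (apply (smooth_coef_r rho _ (C * q)); auto; apply HB; simpl; tauto).
assert (Sc' : smooth_coef rho (fun r _ => cf' B r)) by (apply (smooth_coef_r rho _ (C * q)); auto; apply HB; simpl; tauto).
assert (Si : smooth_coef rho (fun r _ => ri B r)) by (apply (smooth_coef_r rho _ q); auto; apply HB; simpl; tauto).
assert (L := fun i => smooth_speed rho i Hr).
assert (L1 : smooth_coef rho (fun r p => speed_at i1 r p)) by apply L.
assert (L2 : smooth_coef rho (fun r p => speed_at i2 r p)) by apply L.
assert (L4 : smooth_coef rho (fun r p => speed_at i4 r p)) by apply L.
destruct i; unfold source_at; cbv zeta; smooth; auto.
Qed.


#[local] Hint Resolve abs_mult_le abs_plus_le abs_minus_le : core.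

Let gp : Rabs ((gamma + 1) / 4) <= C. Proof. rewrite Rabs_pos_eq; lra. Qed.
Let gm : Rabs ((gamma - 1) / 4) <= C. Proof. rewrite Rabs_pos_eq; lra. Qed.
Let gm8 : Rabs ((gamma - 1) / 8) <= C. Proof. rewrite Rabs_pos_eq; lra. Qed.
Let gm2 : Rabs ((gamma - 1) / 2) <= C. Proof. rewrite Rabs_pos_eq; lra. Qed.
Let g3 : Rabs ((3 - gamma) / 4) <= C. Proof. apply Rabs_le; lra. Qed.
Let half : Rabs (1 / 2) <= C. Proof. rewrite Rabs_pos_eq; lra. Qed.

Let C2 : C <= C * C. Proof. assert (C * 1 <= C * C) by (apply Rmult_le_compat_l; lra). lra. Qed.
Let C3 : C * C <= C * C * C. Proof. assert (C * C * 1 <= C * C * C) by (apply Rmult_le_compat_l; lra). lra. Qed.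
Let C4 : C * C * C <= C * C * C * C. Proof. assert (C * C * C * 1 <= C * C * C * C) by (apply Rmult_le_compat_l; lra). lra. Qed.
Let C5 : C * C * C * C <= C * C * C * C * C. Proof. assert (C * C * C * C * 1 <= C * C * C * C * C) by (apply Rmult_le_compat_l; lra). lra. Qed.

Lemma first_bound p d : cube p d -> Rabs (p i1 / th) <= C * d.
Proof.
intros Hp. unfold Rdiv. rewrite Rmult_comm. eapply abs_mult_le; auto. rewrite Rabs_pos_eq; auto.
left; apply Rinv_0_lt_compat; lra.
Qed.

Lemma other_bound p d j : cube p d -> Rabs (p j) <= C * d.
Proof.
intros Hp. assert (Hd := cube_pos _ _ Hp). assert (1 * d <= C * d) by (apply Rmult_le_compat_r; auto).
specialize (Hp j). lra.
Qed.

Lemma speed_variation i r p d : cube p d ->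
  Rabs (speed_at i r p - speed_at i r (fun _ => 0)) <= 4 * (C * C * C) * d.
Proof.
intros Hp. assert (Hd := cube_pos _ _ Hp).
assert (P1 := first_bound p d Hp). assert (P3 := other_bound p d i3 Hp). assert (P4 := other_bound p d i4 Hp).
assert (Hcd : C * C * d <= C * C * C * d) by (apply Rmult_le_compat_r; auto).
assert (Hcd1 : C * d <= C * C * d) by (apply Rmult_le_compat_r; auto).
assert (0 <= C * C * C * d) by (repeat apply Rmult_le_pos; lra).
destruct i; unfold speed_at; cbv zeta.
- replace (_ - _) with ((gamma + 1) / 4 * (p i1 / th - cf B r * p i3) + (3 - gamma) / 4 * (p i4 + cf B r * p i3)) by (field; lra).
  eapply Rle_trans. eapply abs_plus_le; (eapply abs_mult_le; [eassumption|]). eapply abs_minus_le; eauto. eapply abs_plus_le; eauto. lra.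
- replace (_ - _) with (1 / 2 * (p i1 / th + p i4)) by (field; lra).
  eapply Rle_trans. eapply abs_mult_le; eauto. lra.
- replace (_ - _) with (1 / 2 * (p i1 / th + p i4)) by (field; lra).
  eapply Rle_trans. eapply abs_mult_le; eauto. lra.
- replace (_ - _) with ((3 - gamma) / 4 * (p i1 / th - cf B r * p i3) + (gamma + 1) / 4 * (p i4 + cf B r * p i3)) by (field; lra).
  eapply Rle_trans. eapply abs_plus_le; (eapply abs_mult_le; [eassumption|]). eapply abs_minus_le; eauto. eapply abs_plus_le; eauto. lra.
Qed.

Lemma speed_upper i r p d : d <= 1 -> cube p d -> Rabs (speed_at i r p) <= 6 * (C * C * C).
Proof.
intros Hd1 Hp. assert (Hd := cube_pos _ _ Hp).
assert (V := speed_variation i r p d Hp).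
assert (Hcd : C * C * C * d <= C * C * C * 1) by (apply Rmult_le_compat_l; lra).
assert (Z : Rabs (speed_at i r (fun _ => 0)) <= 2 * (C * C)).
{ assert (b1 := Bb1 r). assert (b4 := Bb4 r).
  destruct i; unfold speed_at; cbv zeta.
  - replace (_ + _) with ((gamma + 1) / 4 * bg1 B r + (3 - gamma) / 4 * bg4 B r) by (field; lra).
    eapply Rle_trans. eapply abs_plus_le; eapply abs_mult_le; eauto. lra.
  - replace (_ * _) with (1 / 2 * bg1 B r + 1 / 2 * bg4 B r) by (field; lra).
    eapply Rle_trans. eapply abs_plus_le; eapply abs_mult_le; eauto. lra.
  - replace (_ * _) with (1 / 2 * bg1 B r + 1 / 2 * bg4 B r) by (field; lra).
    eapply Rle_trans. eapply abs_plus_le; eapply abs_mult_le; eauto. lra.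
  - replace (_ + _) with ((3 - gamma) / 4 * bg1 B r + (gamma + 1) / 4 * bg4 B r) by (field; lra).
    eapply Rle_trans. eapply abs_plus_le; eapply abs_mult_le; eauto. lra. }
revert V Z. abs_lra.
Qed.

(** Every term contains a derivative of the background or [1 / r], hence a
    factor [q], and at least one component of [p]. *)
Lemma source_bound i r p d : d <= 1 -> cube p d ->
  Rabs (source_at i r p) <= 20 * (C * C * C * C * C) * (q * d).
Proof.
intros Hd1 Hp. assert (Hd := cube_pos _ _ Hp).
assert (P1 := first_bound p d Hp). assert (P2 := other_bound p d i2 Hp).
assert (P3 := other_bound p d i3 Hp). assert (P4 := other_bound p d i4 Hp).
assert (u0 : 0 <= q * d) by (apply Rmult_le_pos; lra).
assert (D2 : C * d * (C * d) <= C * C * d).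
{ replace (C * d * (C * d)) with (C * C * d * d) by ring. rewrite <- (Rmult_1_r (C * C * d)) at 2.
  apply Rmult_le_compat_l; auto. repeat apply Rmult_le_pos; lra. }
assert (U2 := Rmult_le_compat_r _ _ _ u0 C2). assert (U3 := Rmult_le_compat_r _ _ _ u0 C3).
assert (U4 := Rmult_le_compat_r _ _ _ u0 C4). assert (U5 := Rmult_le_compat_r _ _ _ u0 C5).
assert (U1 : 0 <= C * (q * d)) by (apply Rmult_le_pos; lra).
assert (V := speed_upper i r p d Hd1 Hp).
assert (b1 := Bb1 r). assert (b2 := Bb2 r). assert (b4 := Bb4 r). assert (bc := Bcf r).
assert (b1' := Bb1' r). assert (b4' := Bb4' r). assert (bc' := Bcf' r). assert (bi := Bri r).
assert (two : Rabs 2 <= 2) by (rewrite Rabs_pos_eq; lra).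
assert (On : forall a A, Rabs a <= A -> Rabs (- a) <= A) by (intros; rewrite Rabs_Ropp; auto).
assert (T4 : Rabs (ri B r * (p i2 * p i2)) <= C * C * (q * d)).
{ eapply Rle_trans. eapply abs_mult_le; [exact bi|]. eapply Rle_trans. eapply abs_mult_le; eauto. exact D2. right; ring. }
assert (Sq : Rabs (p i4 * p i4 - p i1 / th * (p i1 / th)) <= C * C * d + C * C * d).
{ eapply abs_minus_le; eapply Rle_trans; try (eapply abs_mult_le; eassumption); auto. }
assert (T5 : Rabs ((gamma - 1) / 8 * ri B r * (p i4 * p i4 - p i1 / th * (p i1 / th))) <= 2 * (C * C * C * (q * d))).
{ eapply Rle_trans. eapply abs_mult_le; [eapply abs_mult_le; eassumption|exact Sq]. right; ring. }
assert (T6 : Rabs ((gamma - 1) / 4 * cf B r * ri B r * (p i3 * (p i1 / th + p i4))) <= 2 * (C * C * C * C * (q * d))).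
{ eapply Rle_trans. eapply abs_mult_le; [eapply abs_mult_le; [eapply abs_mult_le; eassumption|exact bi]|].
  rewrite Rmult_plus_distr_l. eapply abs_plus_le; (eapply Rle_trans; [eapply abs_mult_le; eassumption|exact D2]). right; ring. }
assert (T2 : Rabs (2 * bg2 B r * ri B r * p i2) <= 2 * (C * C * (q * d))).
{ eapply Rle_trans. eapply abs_mult_le; [eapply abs_mult_le; [eapply abs_mult_le; eassumption|exact bi]|exact P2]. right; ring. }
assert (Bsum : Rabs (bg1 B r + bg4 B r) <= C + C) by (eapply abs_plus_le; auto).
assert (T7 : forall b', Rabs b' <= C * q ->
  Rabs (((gamma - 1) / 2 * b' + (gamma - 1) / 4 * ri B r * (bg1 B r + bg4 B r)) * cf B r * p i3) <= 3 * (C * C * C * C * (q * d))).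
{ intros b' Hb'. eapply Rle_trans. eapply abs_mult_le; [|exact P3]. eapply abs_mult_le; [|exact bc].
  eapply abs_plus_le; [eapply abs_mult_le; [exact gm2|exact Hb']|eapply abs_mult_le; [eapply abs_mult_le; [exact gm|exact bi]|exact Bsum]]. right; ring. }
assert (T8 : Rabs (speed_at i r p * cf' B r * p i3) <= 6 * (C * C * C * C * C * (q * d))).
{ eapply Rle_trans. eapply abs_mult_le; [eapply abs_mult_le; [exact V|exact bc']|exact P3]. right; ring. }
assert (T1 : forall k k' b b' P, Rabs k <= C -> Rabs k' <= C -> Rabs b' <= C * q -> Rabs b <= C -> Rabs P <= C * d ->
  Rabs ((- k * b' - k' * ri B r * b) * P) <= 2 * (C * C * C * (q * d))).
{ intros k k' b b' P H1 H2 H3 H4 H5. eapply Rle_trans. eapply abs_mult_le; [|exact H5].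
  eapply abs_minus_le; [eapply abs_mult_le; [apply On; exact H1|exact H3]|eapply abs_mult_le; [eapply abs_mult_le; [exact H2|exact bi]|exact H4]]. right; ring. }
assert (T1' : forall k k' b b' P, Rabs k <= C -> Rabs k' <= C -> Rabs b' <= C * q -> Rabs b <= C -> Rabs P <= C * d ->
  Rabs ((- k * b' + k' * ri B r * b) * P) <= 2 * (C * C * C * (q * d))).
{ intros k k' b b' P H1 H2 H3 H4 H5. eapply Rle_trans. eapply abs_mult_le; [|exact H5].
  eapply abs_plus_le; [eapply abs_mult_le; [apply On; exact H1|exact H3]|eapply abs_mult_le; [eapply abs_mult_le; [exact H2|exact bi]|exact H4]]. right; ring. }
destruct i; unfold source_at; cbv zeta.
- eapply Rle_trans. repeat first [eapply abs_plus_le; [|exact T8] | eapply abs_plus_le; [|apply T7; exact b1'] | eapply abs_plus_le; [|exact T6] | eapply abs_plus_le; [|exact T5]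
    | eapply abs_plus_le; [|exact T4] | eapply abs_plus_le; [|apply T1'; eassumption] | eapply abs_plus_le; [|exact T2] | apply T1; eassumption ]. lra.
- eapply Rle_trans. eapply abs_mult_le; [apply On; eapply abs_mult_le; [exact V|exact bi]|exact P2]. 
  replace (6 * (C * C * C) * q * (C * d)) with (6 * (C * C * C * C * (q * d))) by ring. lra.
- rewrite Rabs_R0. lra.
- eapply Rle_trans. repeat first [eapply abs_minus_le; [|exact T8] | eapply abs_minus_le; [|apply T7; exact b4'] | eapply abs_minus_le; [|exact T6] | eapply abs_minus_le; [|exact T5]
    | eapply abs_plus_le; [|exact T4] | eapply abs_plus_le; [|apply T1; eassumption] | eapply abs_plus_le; [|exact T2] | apply T1'; eassumption ]. lra.
Qed.

(** Perturbations of this size use up at most half of the distance of the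
    speeds to 0. *)
Definition radius : R := Rmin 1 (l0 / (8 * (C * C * C))).

Let CCC : 0 < C * C * C. Proof. repeat apply Rmult_lt_0_compat; lra. Qed.

Lemma radius_range : 0 < radius <= 1.
Proof.
split. apply Rmin_pos. lra. apply Rdiv_lt_0_compat; lra. apply Rmin_l.
Qed.

Lemma speed_lower i r p : cube p radius -> l0 / 2 <= Rabs (speed_at i r p).
Proof.
intros Hp. assert (V := speed_variation i r p _ Hp). assert (L := Hl i r).
assert (4 * (C * C * C) * radius <= l0 / 2).
{ apply Rle_trans with (4 * (C * C * C) * (l0 / (8 * (C * C * C)))).
  apply Rmult_le_compat_l. lra. apply Rmin_r. right; field. lra. }
revert V L. abs_lra.
Qed.

Lemma inv_speed_bound i r p : cube p radius -> Rabs (/ speed_at i r p) <= 2 / l0.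
Proof.
intros Hp. assert (H := speed_lower i r p Hp). rewrite Rabs_inv.
replace (2 / l0) with (/ (l0 / 2)) by (field; lra). apply Rinv_le_contravar; auto. lra.
Qed.

Lemma smooth_inv_speed i : smooth_coef radius (fun r p => / speed_at i r p).
Proof.
assert (H := radius_range).
apply (smooth_coef_inv radius (speed_at i) (l0 / 2)). lra. intros; apply speed_lower; auto.
apply smooth_speed; lra.
Qed.

Lemma smooth_reduced_source i : smooth_coef radius (reduced_source i).
Proof.
assert (H := radius_range).
apply (smooth_coef_mult radius (fun _ _ => wt i)). apply smooth_coef_const.
apply (smooth_coef_mult radius (fun r p => / speed_at i r p) (source_at i)). apply smooth_inv_speed.
apply smooth_source; lra.
Qed.

Lemma reduced_source_bound i r p d : d <= radius -> cube p d ->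
  Rabs (reduced_source i r p) <= 40 * (C * C * C * C * C) / l0 * q * d.
Proof.
intros Hd Hp. assert (H := radius_range). unfold reduced_source.
assert (Hw : Rabs (wt i) <= 1) by (destruct i; simpl; rewrite Rabs_pos_eq; lra).
assert (Hp' : cube p radius) by (intros j; eapply Rle_trans; [apply Hp|auto]).
eapply Rle_trans. eapply abs_mult_le; [exact Hw|]. eapply abs_mult_le; [apply inv_speed_bound; auto|]. apply (source_bound i r p d); auto. lra.
right. field. lra.
Qed.

End Bounds.
End System.

(** * Rescaling by the size of the data *)

Lemma exists_for_idx4 {A : Type} (Q : idx4 -> A -> Prop) :
  (forall i, exists a, Q i a) -> exists f : idx4 -> A, forall i, Q i (f i).
Proof.
intros H. exists (fun i => proj1_sig (constructive_indefinite_description _ (H i))).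
intros i. destruct constructive_indefinite_description; auto.
Qed.

Lemma abs_le_sum4 (f : idx4 -> R) i : (forall j, 0 <= f j) -> f i <= sum4 f.
Proof.
intros H. assert (H1 := H i1). assert (H2 := H i2). assert (H3 := H i3). assert (H4 := H i4).
unfold sum4; destruct i; lra.
Qed.

Section Rescaled.
Context (gamma th r0 r1 : R) (B : profile) (chi : R -> R) (K : idx4 -> R).

(** The factor of the entropy transport term, as a linear form in the rescaled
    unknown [u] for which Psi_1 is [nu u_1 / th] and the others are [nu u_j]. *)
Definition coupling (nu : R) (i j : idx4) (r : R) : R :=
  match i, j with
  | i1, i1 => - nu / (4 * gamma)
  | i1, i3 => nu * th * ((gamma - 1) / 2) * cf B r
  | i1, i4 => nu * th / (4 * gamma)
  | i4, i1 => nu / (4 * gamma * th)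
  | i4, i3 => - nu * ((gamma - 1) / 2) * cf B r
  | i4, i4 => - nu / (4 * gamma)
  | _, _ => 0
  end.

Definition coupling' (nu : R) (i j : idx4) (r : R) : R :=
  match i, j with
  | i1, i3 => nu * th * ((gamma - 1) / 2) * (chi r * cf' B r)
  | i4, i3 => - nu * ((gamma - 1) / 2) * (chi r * cf' B r)
  | _, _ => 0
  end.

(** The line on which the boundary relations prescribe each component, the
    component they relate it to, and the factor after weighting the first
    component by [th]: -1 becomes [- th] and [K_j] becomes [K_j / th]. *)
Definition base_line (i : idx4) : R := match i with i1 => r1 | _ => r0 end.
Definition partner (i : idx4) : idx4 := match i with i1 => i4 | _ => i1 end.
Definition reflection (i : idx4) : R := match i with i1 => - th | _ => K i / th end.

Definition rescaled_data (nu : R) (dmu dg : idx4 -> R -> vec -> vec -> R) (H H' : idx4 -> R -> R) : data :=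
  Data (fun i r p => / speed_at gamma th B i r (scaled nu p))
       (fun i r p w => nu * dmu i r (scaled nu p) w)
       (fun i r p => reduced_source gamma th B i r (scaled nu p) / nu)
       (fun i r p w => dg i r (scaled nu p) w)
       (coupling nu) (coupling' nu)
       (fun i t => wt th i / nu * H i t) (fun i t => wt th i / nu * H' i t)
       base_line reflection partner.

Context (C q l0 W : R).
Context (Hth : 0 < th < 1) (Hgam : 1 < gamma) (HC1 : 1 <= C) (HCg : gamma + 3 <= C) (HCth : / th <= C).
Context (Hq : 0 < q) (HB : profile_bounds B C q) (Hl0 : 0 < l0).
Context (Hl : forall i r, l0 <= Rabs (speed_at gamma th B i r (fun _ => 0))).
Context (HW : weight chi W) (chi1 : forall r, chi r <= 1).
Context (Dcf : forall r, is_derive (cf B) r (chi r * cf' B r)).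
Context (HK : forall i, Rabs (K i) <= th * th).
Context (Hshort : W * (40 * (C * C * C * C * C) / l0 * q) <= (1 - th) / 4).

Let chi0 : forall r, 0 <= chi r. Proof. apply HW. Qed.
Let HW0 : 0 <= W. Proof. apply (weight_pos chi); auto. Qed.
Let C2 : C <= C * C. Proof. assert (C * 1 <= C * C) by (apply Rmult_le_compat_l; lra). lra. Qed.

Lemma inv_gamma : 0 < / (4 * gamma) <= 1.
Proof.
split. apply Rinv_0_lt_compat; lra. rewrite <- Rinv_1. apply Rinv_le_contravar; lra.
Qed.

Lemma coupling_bound nu i j r : 0 < nu -> Rabs (coupling nu i j r) <= C * C * nu.
Proof.
intros Hn. assert (I := inv_gamma).
assert (P : 0 <= C * C * nu) by (repeat apply Rmult_le_pos; lra).
assert (C1 : 1 * nu <= C * C * nu) by (apply Rmult_le_compat_r; lra).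
assert (A1 : nu * / (4 * gamma) <= nu * 1) by (apply Rmult_le_compat_l; lra).
assert (A0 : 0 <= nu * / (4 * gamma)) by (apply Rmult_le_pos; lra).
assert (B1 : Rabs (cf B r) <= C) by (apply (pb_bound _ _ _ HB); simpl; tauto).
assert (Hg : forall k, 0 <= k <= 1 -> Rabs (k * nu * ((gamma - 1) / 2) * cf B r) <= C * C * nu).
{ intros k Hk. rewrite Rabs_mult.
  assert (K1 : 0 <= k * nu <= nu). { split. apply Rmult_le_pos; lra. rewrite <- (Rmult_1_l nu) at 2. apply Rmult_le_compat_r; lra. }
  assert (K2 : 0 <= k * nu * ((gamma - 1) / 2) <= nu * C).
  { split. apply Rmult_le_pos; lra. apply Rmult_le_compat; lra. }
  rewrite (Rabs_pos_eq (k * nu * ((gamma - 1) / 2))) by lra.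
  apply Rle_trans with (nu * C * C). apply Rmult_le_compat; try lra. apply Rabs_pos. right; ring. }
destruct i, j; unfold coupling; try (rewrite Rabs_R0; exact P).
- unfold Rdiv. rewrite <- Ropp_mult_distr_l, Rabs_Ropp, Rabs_pos_eq; lra.
- replace (nu * th * ((gamma - 1) / 2) * cf B r) with (th * nu * ((gamma - 1) / 2) * cf B r) by ring. apply Hg; lra.
- replace (nu * th / (4 * gamma)) with (th * (nu * / (4 * gamma))) by (field; lra).
  assert (th * (nu * / (4 * gamma)) <= 1 * (nu * / (4 * gamma))) by (apply Rmult_le_compat_r; lra).
  rewrite Rabs_pos_eq; [lra|]. apply Rmult_le_pos; lra.
- replace (nu / (4 * gamma * th)) with (/ th * (nu * / (4 * gamma))) by (field; lra).
  assert (T : 0 < / th) by (apply Rinv_0_lt_compat; lra).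
  assert (/ th * (nu * / (4 * gamma)) <= C * (nu * 1)) by (apply Rmult_le_compat; lra).
  assert (C * nu <= C * C * nu) by (apply Rmult_le_compat_r; lra).
  rewrite Rabs_pos_eq; [lra|]. apply Rmult_le_pos; lra.
- replace (- nu * ((gamma - 1) / 2) * cf B r) with (- (1 * nu * ((gamma - 1) / 2) * cf B r)) by ring.
  rewrite Rabs_Ropp. apply Hg; lra.
- unfold Rdiv. rewrite <- Ropp_mult_distr_l, Rabs_Ropp, Rabs_pos_eq; lra.
Qed.

Lemma coupling'_bound nu i j r : 0 < nu -> Rabs (coupling' nu i j r) <= chi r * (C * C * q * nu).
Proof.
intros Hn.
assert (P : 0 <= chi r * (C * C * q * nu)) by (repeat apply Rmult_le_pos; auto; lra).
assert (B1 : Rabs (cf' B r) <= C * q) by (apply (pb_bound' _ _ _ HB); simpl; tauto).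
assert (Hg : forall k, 0 <= k <= 1 -> Rabs (k * nu * ((gamma - 1) / 2) * (chi r * cf' B r)) <= chi r * (C * C * q * nu)).
{ intros k Hk. rewrite !Rabs_mult, (Rabs_pos_eq (chi r)) by auto.
  rewrite (Rabs_pos_eq k), (Rabs_pos_eq nu), (Rabs_pos_eq ((gamma - 1) / 2)) by lra.
  assert (K1 : 0 <= k * nu <= nu). { split. apply Rmult_le_pos; lra. rewrite <- (Rmult_1_l nu) at 2. apply Rmult_le_compat_r; lra. }
  assert (K2 : 0 <= k * nu * ((gamma - 1) / 2) <= nu * C).
  { split. apply Rmult_le_pos; lra. apply Rmult_le_compat; lra. }
  apply Rle_trans with (nu * C * (chi r * (C * q))); [|right; ring].
  apply Rmult_le_compat; try lra. apply Rmult_le_pos; auto; apply Rabs_pos.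
  apply Rmult_le_compat_l; auto. }
destruct i, j; unfold coupling'; try (rewrite Rabs_R0; exact P).
- replace (nu * th * ((gamma - 1) / 2) * (chi r * cf' B r)) with (th * nu * ((gamma - 1) / 2) * (chi r * cf' B r)) by ring. apply Hg; lra.
- replace (- nu * ((gamma - 1) / 2) * (chi r * cf' B r)) with (- (1 * nu * ((gamma - 1) / 2) * (chi r * cf' B r))) by ring.
  rewrite Rabs_Ropp. apply Hg; lra.
Qed.

Lemma coupling_der nu i j r : is_derive (coupling nu i j) r (coupling' nu i j r).
Proof.
destruct i, j; unfold coupling, coupling'; try apply is_derive_Rconst;
match goal with |- is_derive (fun r => ?k * cf B r) _ _ => apply (is_derive_scal (cf B)) end; apply Dcf.
Qed.

Lemma coupling'_cont nu i j r : continuous (coupling' nu i j) r.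
Proof.
assert (C1 : forall r, continuous (cf' B) r) by (apply HB; simpl; tauto).
assert (C3 : forall r, continuous chi r) by apply HW.
destruct i, j; unfold coupling'; cts.
Qed.

Lemma reflection_bound i : Rabs (reflection i) <= th.
Proof.
assert (Hk : forall i, Rabs (K i / th) <= th).
{ intros j. unfold Rdiv. rewrite Rabs_mult, Rabs_inv, (Rabs_pos_eq th) by lra.
  apply Rmult_le_reg_r with th. lra. rewrite Rmult_assoc, Rinv_l by lra. rewrite Rmult_1_r. apply HK. }
destruct i; simpl; auto. rewrite Rabs_Ropp, Rabs_pos_eq; lra.
Qed.

(** After rescaling, all constants of the nonlinear problem are [O(nu)] except
    the slope of the source, which [Hshort] makes harmless because the segment is
    short, and the reflection coefficients, which are at most [th < 1]. *)
Theorem rescaled_solution : exists nu0 N : R, 0 < nu0 <= radius C l0 /\ 0 <= N /\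
  forall (nu : R) (H H' : idx4 -> R -> R), 0 < nu <= nu0 ->
  (forall i t, is_derive (H i) t (H' i t)) -> (forall i t, continuous (H' i) t) ->
  (forall i t, Rabs (H i t) <= (1 - th) / 4 * nu) ->
  (forall i t, Rabs (H' i t) <= (1 - th) / 4 * nu) ->
  (forall e, 0 < e -> exists b, forall i t t', Rabs (H' i t - H' i t') <= e + b * Rabs (t - t')) ->
  exists dmu dg P, C1_bounded chi N P /\ solves chi (rescaled_data nu dmu dg H H') P P /\
    forall T, (forall i t, H i (t + T) = H i t) -> forall i r t, su P i r (t + T) = su P i r t.
Proof.
set (de0 := 40 * (C * C * C * C * C) / l0 * q).
assert (Hde0 : 0 <= de0).
{ unfold de0. apply Rmult_le_pos; [|lra]. apply Rdiv_le_0_compat; auto. repeat apply Rmult_le_pos; lra. }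
set (rho := radius C l0).
assert (Hrho : 0 < rho <= 1) by (apply (radius_range gamma th C l0); auto).
assert (E1 : forall i, exists z : (R -> vec -> vec -> R) * R, smooth_field rho (fun r p => / speed_at gamma th B i r p) (fst z) (snd z)).
{ intros i. destruct (smooth_inv_speed gamma th B C q l0 Hth Hgam HC1 HCg HCth HB Hl0 Hl i) as [df [b Hb]]. exists (df, b). exact Hb. }
assert (E2 : forall i, exists z : (R -> vec -> vec -> R) * R, smooth_field rho (reduced_source gamma th B i) (fst z) (snd z)).
{ intros i. destruct (smooth_reduced_source gamma th B C q l0 Hth Hgam HC1 HCg HCth HB Hl0 Hl i) as [df [b Hb]]. exists (df, b). exact Hb. }
destruct (exists_for_idx4 _ E1) as [zm Hm]. destruct (exists_for_idx4 _ E2) as [zg Hg]. clear E1 E2.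
set (Na := 2 / l0). assert (HNa : 0 <= Na) by (apply Rdiv_le_0_compat; lra).
set (N := Na + de0 + 2).
set (A := 1 + sum4 (fun i => snd (zm i)) + sum4 (fun i => snd (zg i)) + C * C + C * C * q).
assert (Pm : forall i, 0 <= snd (zm i)) by (intros i; apply (sf_B _ _ _ _ (Hm i))).
assert (Pg : forall i, 0 <= snd (zg i)) by (intros i; apply (sf_B _ _ _ _ (Hg i))).
assert (Am := fun i => abs_le_sum4 (fun i => snd (zm i)) i Pm).
assert (Ag := fun i => abs_le_sum4 (fun i => snd (zg i)) i Pg).
assert (Am0 := Rle_trans _ _ _ (Pm i1) (Am i1)). assert (Ag0 := Rle_trans _ _ _ (Pg i1) (Ag i1)).
cbv beta in Am, Ag, Am0, Ag0.
assert (CC0 : 0 <= C * C) by lra.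
assert (CCq : 0 <= C * C * q) by (apply Rmult_le_pos; lra).
assert (HA : 1 <= A) by (unfold A; lra).
set (Kb := 3 * W + 1600 * ((1 + W) * N * N) + 1).
assert (HN : 0 <= N) by (unfold N; lra).
assert (HKb : 1 <= Kb).
{ unfold Kb. assert (0 <= (1 + W) * N * N) by (repeat apply Rmult_le_pos; lra). lra. }
assert (HKA : 0 < 8 * (A * Kb)).
{ apply Rmult_lt_0_compat; [lra|]. apply Rmult_lt_0_compat; lra. }
set (nu0 := Rmin rho (Rmin (1 / (3 * A)) ((1 - th) / (8 * (A * Kb))))).
exists nu0, N. split; [|split; auto].
{ split; [|apply Rmin_l]. apply Rmin_pos; [lra|]. apply Rmin_pos; apply Rdiv_lt_0_compat; lra. }
intros nu H H' Hnu DH CH' BH BH' MH.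
exists (fun i => fst (zm i)), (fun i => fst (zg i)).
set (D := rescaled_data nu (fun i => fst (zm i)) (fun i => fst (zg i)) H H').
set (ep := A * nu). set (de := de0 + 3 * ep). set (eta := (1 - th) / 4).
assert (N1 : nu <= rho) by (eapply Rle_trans; [apply Hnu|apply Rmin_l]).
assert (N2 : nu <= 1 / (3 * A)).
{ eapply Rle_trans; [apply Hnu|]. eapply Rle_trans; [apply Rmin_r|apply Rmin_l]. }
assert (N3 : nu <= (1 - th) / (8 * (A * Kb))).
{ eapply Rle_trans; [apply Hnu|]. eapply Rle_trans; [apply Rmin_r|apply Rmin_r]. }
assert (ep0 : 0 <= ep) by (apply Rmult_le_pos; lra).
assert (ep3 : 3 * ep <= 1).
{ unfold ep. replace 1 with (3 * (A * (1 / (3 * A)))) by (field; lra).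
  apply Rmult_le_compat_l; [lra|]. apply Rmult_le_compat_l; lra. }
assert (epK : Kb * ep <= (1 - th) / 8).
{ unfold ep. replace ((1 - th) / 8) with (Kb * (A * ((1 - th) / (8 * (A * Kb))))) by (field; lra).
  apply Rmult_le_compat_l; [lra|]. apply Rmult_le_compat_l; lra. }
assert (epA : forall b, b <= A -> b * nu <= ep) by (intros; apply Rmult_le_compat_r; lra).
assert (Hwt : forall i, 0 < wt th i <= 1) by (destruct i; simpl; lra).
assert (HH : forall (i : idx4) v X, Rabs v <= X * nu -> Rabs (wt th i / nu * v) <= X).
{ intros i v X Hv. assert (Hw := Hwt i). rewrite Rabs_mult. rewrite Rabs_pos_eq by (apply Rdiv_le_0_compat; lra).
  apply Rle_trans with (1 / nu * (X * nu)); [|right; field; lra].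
  apply Rmult_le_compat; auto. apply Rdiv_le_0_compat; lra. apply Rabs_pos.
  apply Rmult_le_compat_r; [|lra]. left; apply Rinv_0_lt_compat; lra. }
assert (Hbig : ep * (3 * W) + 1600 * ((1 + W) * N * (N * ep)) + ep <= (1 - th) / 8).
{ replace (_ + ep) with (Kb * ep) by (unfold Kb; ring). exact epK. }
assert (WP : well_posed chi W Na N ep de th eta D).
{ split; try (unfold D, rescaled_data; simpl).
  - exact HW.
  - exact HNa.
  - lra.
  - unfold de; lra.
  - lra.
  - unfold eta; lra.
  - unfold N, de; lra.
  - unfold de, eta. fold de0 in Hshort. lra.
  - unfold de. fold de0 in Hshort. lra.
  - intros i. apply (field_scaled_speed rho (fun r p => / speed_at gamma th B i r p) (fst (zm i)) (snd (zm i))); auto; try lra.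
    apply epA. unfold A. specialize (Am i). lra.
  - intros i r p Hp. apply (inv_speed_bound gamma th B C q l0); auto.
    apply cube_scaled; auto; lra.
  - intros i. apply (field_scaled_source rho (reduced_source gamma th B i) (fst (zg i)) (snd (zg i))); auto; try lra.
    apply epA. unfold A. specialize (Ag i). lra.
    intros r p d Hd Hp. unfold de0. apply (reduced_source_bound gamma th B C q l0); auto.
  - intros i r. 
    assert (Z : scaled nu (fun _ : idx4 => 0) = (fun _ => 0)) by (apply functional_extensionality; intros; unfold scaled; ring).
    rewrite Z. 
    assert (Z2 := reduced_source_bound gamma th B C q l0 Hth Hgam HC1 HCg HCth Hq HB Hl0 Hl i r (fun _ => 0) 0 ltac:(fold rho; lra)
      ltac:(intros j; rewrite Rabs_R0; lra)).
    rewrite Rmult_0_r in Z2. assert (Z3 : reduced_source gamma th B i r (fun _ => 0) = 0).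
    { apply Rabs_eq_0. apply Rle_antisym; auto. apply Rabs_pos. }
    rewrite Z3. unfold Rdiv; ring.
  - intros; apply coupling_der.
  - intros; apply coupling'_cont.
  - intros. eapply Rle_trans. apply coupling_bound; lra. apply epA. unfold A; lra.
  - intros. eapply Rle_trans. apply coupling'_bound; lra. apply Rmult_le_compat_l; auto. apply epA. unfold A; lra.
  - reflexivity.
  - intros i t. apply (is_derive_scal (H i)). apply DH.
  - intros i t. assert (Ci := CH' i). cts.
  - intros i t. apply HH. apply BH.
  - intros i t. apply HH. apply BH'.
  - intros i. apply reflection_bound. }
assert (Heq : forall e, 0 < e -> exists b, admissible eta D e b).
{ intros e He. assert (Heta : 0 < eta) by (unfold eta; lra).
  assert (Hen : 0 < eta * e * nu) by (repeat apply Rmult_lt_0_compat; lra).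
  destruct (MH (eta * e * nu) Hen) as [b Hb].
  exists (Rmax 1 (b / (eta * nu))). assert (M1 := Rmax_l 1 (b / (eta * nu))). assert (M2 := Rmax_r 1 (b / (eta * nu))).
  split; [lra|]. split; auto.
  intros i t t'. unfold D, rescaled_data; simpl. rewrite <- Rmult_minus_distr_l. apply HH.
  eapply Rle_trans. apply Hb. rewrite !Rmult_plus_distr_l, Rmult_plus_distr_r.
  apply Rplus_le_compat; [lra|].
  replace (eta * (Rmax 1 (b / (eta * nu)) * Rabs (t - t')) * nu) with ((eta * nu * Rmax 1 (b / (eta * nu))) * Rabs (t - t')) by ring.
  apply Rmult_le_compat_r. apply Rabs_pos.
  apply Rle_trans with (eta * nu * (b / (eta * nu))). right; field; lra.
  apply Rmult_le_compat_l; auto. apply Rmult_le_pos; lra. }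
destruct (fixed_state_exists chi W Na N ep de th eta D WP chi1 Heq) as [P [BP SP]].
exists P. split; auto. split; auto.
intros T HT. apply (fixed_state_periodic chi W Na N ep de th eta D WP P T); auto.
intros i t. unfold D, rescaled_data; simpl. rewrite HT. reflexivity.
Qed.

End Rescaled.

(** * Relative derivatives *)

Lemma is_derive_on_eps (A : R -> Prop) (f : R -> R) (x l : R) : A x ->
  (is_derive_on A f x l <->
   forall eps, 0 < eps -> locally x (fun y => A y -> Rabs (f y - f x - (y - x) * l) <= eps * Rabs (y - x))).
Proof.
intros Ax. split.
- intros [_ H] eps He.
  assert (Hx : is_filter_lim (within A (locally x)) x).
  { intros P HP. unfold within. apply (filter_imp P); [now intros|exact HP]. }
  destruct (H x Hx (mkposreal eps He)) as [d Hd]. exists d. intros y Hy Ay. exact (Hd y Hy Ay).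
- intros H. split. apply (is_linear_scal_l (K := R_AbsRing) (V := R_NormedModule)).
  intros x' Hx' eps.
  assert (E : x = x').
  { apply (eq_close (V := R_NormedModule)). intros d.
    assert (Hb : locally x' (ball x' d)) by (exists d; intros y Hy; exact Hy).
    destruct (Hx' _ Hb) as [d' Hd']. apply ball_sym. apply Hd'; [apply ball_center|exact Ax]. }
  subst x'. destruct (H eps (cond_pos eps)) as [d Hd]. exists d. intros y Hy Ay. exact (Hd y Hy Ay).
Qed.

Lemma is_derive_on_of_is_derive (A : R -> Prop) (f : R -> R) (x l : R) :
  A x -> is_derive f x l -> is_derive_on A f x l.
Proof.
intros Ax H. apply is_derive_on_eps; auto. intros eps He.
generalize (is_derive_eps_inv f x l eps H He). apply filter_imp. auto.
Qed.

Lemma is_derive_on_ext (A : R -> Prop) (f g : R -> R) (x l : R) :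
  A x -> (forall y, A y -> f y = g y) -> is_derive_on A f x l -> is_derive_on A g x l.
Proof.
intros Ax E H. apply is_derive_on_eps; auto. intros eps He.
generalize (proj1 (is_derive_on_eps A f x l Ax) H eps He). apply filter_imp.
intros y Hy Ay. rewrite <- !E; auto.
Qed.

Lemma half_line_limit_point a x : a <= x ->
  forall eps : posreal, exists y, half_line a y /\ y <> x /\ Rabs (y - x) < eps.
Proof.
intros H eps. exists (x + eps / 2). assert (He := cond_pos eps). unfold half_line.
split; [lra|]. split; [lra|]. rewrite Rabs_pos_eq; lra.
Qed.

Lemma segment_limit_point a b x : a < b -> a <= x <= b ->
  forall eps : posreal, exists y, segment a b y /\ y <> x /\ Rabs (y - x) < eps.
Proof.
intros Hab Hx eps. assert (He := cond_pos eps). unfold segment.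
destruct (Rlt_le_dec x b) as [H|H].
- exists (x + Rmin (eps / 2) (b - x)).
  assert (H1 := Rmin_l (eps / 2) (b - x)). assert (H2 := Rmin_r (eps / 2) (b - x)).
  assert (0 < Rmin (eps / 2) (b - x)) by (apply Rmin_pos; lra).
  split; [lra|]. split; [lra|]. rewrite Rabs_pos_eq; lra.
- exists (x - Rmin (eps / 2) (b - a)).
  assert (H1 := Rmin_l (eps / 2) (b - a)). assert (H2 := Rmin_r (eps / 2) (b - a)).
  assert (0 < Rmin (eps / 2) (b - a)) by (apply Rmin_pos; lra).
  split; [lra|]. split; [lra|]. rewrite Rabs_left; lra.
Qed.

Lemma Derive_on_half_line a f x l : a <= x -> is_derive_on (half_line a) f x l ->
  Derive_on (half_line a) f x = l.
Proof. intros H. apply Derive_on_unique. apply half_line_limit_point; auto. Qed.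

Lemma ex_derive_on_Derive_on a f x : a <= x -> ex_derive_on (half_line a) f x ->
  is_derive_on (half_line a) f x (Derive_on (half_line a) f x).
Proof. intros H [l Hl]. rewrite (Derive_on_half_line a f x l); auto. Qed.

(** The extension by its tangent to the left of [a] turns derivatives relative
    to the half line into ordinary ones. *)
Definition extend (a : R) (f : R -> R) (y : R) : R :=
  if Rlt_dec y a then f a + (y - a) * Derive_on (half_line a) f a else f y.

Lemma extend_eq a f y : a <= y -> extend a f y = f y.
Proof. intros H. unfold extend. destruct Rlt_dec; auto. lra. Qed.

Lemma extend_der a f x : a <= x -> ex_derive_on (half_line a) f x ->
  is_derive (extend a f) x (Derive_on (half_line a) f x).
Proof.
intros Hx Hf. assert (Hd := ex_derive_on_Derive_on a f x Hx Hf).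
apply is_derive_eps. intros eps He.
assert (L := proj1 (is_derive_on_eps (half_line a) f x _ Hx) Hd eps He).
assert (L2 : locally x (fun y => x = a \/ a <= y)).
{ destruct Hx as [Hx| ->].
  - assert (Hp : 0 < x - a) by lra. exists (mkposreal _ Hp). intros y Hy. right.
    assert (Hy' : Rabs (y - x) < x - a) by exact Hy. revert Hy'. abs_lra.
  - apply filter_forall. auto. }
generalize (filter_and _ _ L L2). apply filter_imp. intros y [H1 H2].
rewrite (extend_eq a f x Hx). destruct (Rle_lt_dec a y) as [Hy|Hy].
- rewrite extend_eq by auto. apply H1. exact Hy.
- destruct H2 as [-> |H2]; [|lra]. unfold extend. destruct Rlt_dec; [|lra].
  replace (_ - _ - _) with 0 by ring. rewrite Rabs_R0. apply Rmult_le_pos. lra. apply Rabs_pos.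
Qed.

Lemma mean_value_right (F dF : R -> R) a r : a <= r ->
  (forall x, a <= x -> is_derive F x (dF x)) ->
  exists c, a <= c <= r /\ F r - F a = dF c * (r - a).
Proof.
intros Har H. destruct (MVT_gen F a r dF) as [c [Hc E]].
- intros x Hx. apply H. rewrite Rmin_left in Hx by auto. lra.
- intros x Hx. apply continuity_pt_filterlim. apply (is_derive_continuous F x (dF x)). apply H.
  rewrite Rmin_left in Hx by auto. lra.
- rewrite Rmin_left, Rmax_right in Hc by auto. exists c; auto.
Qed.

Lemma constant_right (F dF : R -> R) a r : a <= r ->
  (forall x, a <= x -> is_derive F x (dF x)) -> (forall x, a <= x -> dF x = 0) -> F r = F a.
Proof.
intros Har H H0. destruct (mean_value_right F dF a r Har H) as [c [Hc E]].
rewrite H0 in E by lra. lra.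
Qed.

Lemma increasing_right (F dF : R -> R) a r : a <= r ->
  (forall x, a <= x -> is_derive F x (dF x)) -> (forall x, a <= x -> 0 <= dF x) -> F a <= F r.
Proof.
intros Har H H0. destruct (mean_value_right F dF a r Har H) as [c [Hc E]].
assert (0 <= dF c * (r - a)) by (apply Rmult_le_pos; [apply H0; lra|lra]). lra.
Qed.

(** * Cut-off in the radial variable *)

Lemma continuous_Rext {U : UniformSpace} (f g : U -> R) (x : U) :
  (forall y, f y = g y :> R) -> continuous f x -> continuous g x.
Proof. intros H. apply (continuous_ext f g x H). Qed.

Lemma continuous_Rmin {U : UniformSpace} (f g : U -> R) (x : U) :
  continuous f x -> continuous g x -> continuous (fun y => Rmin (f y) (g y)) x.
Proof.
intros Hf Hg. apply continuous_Rext with (fun y => (f y + g y - Rabs (f y - g y)) * / 2).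
{ intros y. unfold Rmin, Rabs; destruct Rle_dec; destruct Rcase_abs; lra. }
apply continuous_Rmult; [|apply continuous_const]. apply continuous_Rminus. apply continuous_Rplus; auto.
apply (continuous_comp (fun y => f y - g y) Rabs). apply continuous_Rminus; auto. apply continuous_Rabs.
Qed.

Lemma continuous_Rmax {U : UniformSpace} (f g : U -> R) (x : U) :
  continuous f x -> continuous g x -> continuous (fun y => Rmax (f y) (g y)) x.
Proof.
intros Hf Hg. apply continuous_Rext with (fun y => - Rmin (- f y) (- g y)).
{ intros y. rewrite <- Ropp_Rmax. ring. }
apply continuous_Ropp, continuous_Rmin; apply continuous_Ropp; auto.
Qed.

Definition clamp (r0 r1 s : R) : R := Rmax r0 (Rmin r1 s).

Lemma clamp_range r0 r1 s : r0 <= r1 -> r0 <= clamp r0 r1 s <= r1.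
Proof. intros H. unfold clamp, Rmax, Rmin; repeat destruct Rle_dec; lra. Qed.

Lemma clamp_eq r0 r1 s : r0 <= s <= r1 -> clamp r0 r1 s = s.
Proof. intros H. unfold clamp, Rmax, Rmin; repeat destruct Rle_dec; lra. Qed.

Lemma clamp_cont r0 r1 s : continuous (clamp r0 r1) s.
Proof.
unfold clamp. apply (continuous_Rmax (fun _ => r0) (fun s => Rmin r1 s)). apply continuous_const.
apply (continuous_Rmin (fun _ => r1) (fun s => s)). apply continuous_const. apply continuous_id.
Qed.

(** With the speeds multiplied by the cut-off, orbits are defined for all [r], and
    move in [t] only while [r] crosses an interval of three times the length. *)
Definition cutoff (r0 r1 s : R) : R :=
  Rmax 0 (Rmin 1 (Rmin ((s - r0) / (r1 - r0) + 1) ((r1 - s) / (r1 - r0) + 1))).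

Lemma cutoff_range r0 r1 s : 0 <= cutoff r0 r1 s <= 1.
Proof.
unfold cutoff. split. apply Rmax_l. apply Rmax_lub. lra. apply Rmin_l.
Qed.

Lemma cutoff_one r0 r1 s : r0 < r1 -> r0 <= s <= r1 -> cutoff r0 r1 s = 1.
Proof.
intros H Hs. unfold cutoff.
assert (0 <= (s - r0) / (r1 - r0)) by (apply Rdiv_le_0_compat; lra).
assert (0 <= (r1 - s) / (r1 - r0)) by (apply Rdiv_le_0_compat; lra).
rewrite Rmin_left. rewrite Rmax_right; lra. apply Rmin_glb; lra.
Qed.

Lemma cutoff_zero r0 r1 s : r0 < r1 -> s <= r0 - (r1 - r0) \/ r1 + (r1 - r0) <= s -> cutoff r0 r1 s = 0.
Proof.
intros H Hs. unfold cutoff. apply Rmax_left.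
assert (A : forall u, u <= - (r1 - r0) -> u / (r1 - r0) + 1 <= 0).
{ intros u Hu. assert (u / (r1 - r0) <= -1); [|lra].
  apply Rmult_le_reg_r with (r1 - r0). lra. unfold Rdiv. rewrite Rmult_assoc, Rinv_l; lra. }
eapply Rle_trans. apply Rmin_r. destruct Hs as [Hs|Hs].
- eapply Rle_trans. apply Rmin_l. apply A. lra.
- eapply Rle_trans. apply Rmin_r. apply A. lra.
Qed.

Lemma cutoff_cont r0 r1 s : continuous (cutoff r0 r1) s.
Proof.
unfold cutoff.
apply (continuous_Rmax (fun _ => 0) (fun s => Rmin 1 (Rmin ((s - r0) / (r1 - r0) + 1) ((r1 - s) / (r1 - r0) + 1)))).
apply continuous_const.
apply (continuous_Rmin (fun _ => 1) (fun s => Rmin ((s - r0) / (r1 - r0) + 1) ((r1 - s) / (r1 - r0) + 1))).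
apply continuous_const.
apply (continuous_Rmin (fun s => (s - r0) / (r1 - r0) + 1) (fun s => (r1 - s) / (r1 - r0) + 1)); unfold Rdiv; cts.
Qed.

Lemma weight_cutoff r0 r1 : r0 < r1 -> weight (cutoff r0 r1) (3 * (r1 - r0)).
Proof.
intros H. assert (Cc := cutoff_cont r0 r1).
split; [exact Cc|]. split. intros; apply cutoff_range.
set (p := r0 - (r1 - r0)). set (q := r1 + (r1 - r0)).
set (F := fun s => RInt (cutoff r0 r1) p s).
assert (Z : forall u v, (u <= p /\ v <= p) \/ (q <= u /\ q <= v) -> RInt (cutoff r0 r1) u v = 0 :> R).
{ intros u v Huv. apply Rabs_eq_0. apply Rle_antisym; [|apply Rabs_pos].
  apply Rle_trans with (0 * Rabs (v - u)); [|rewrite Rmult_0_l; apply Rle_refl]. apply abs_RInt_le_gen; auto.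
  intros y Hy. rewrite cutoff_zero; auto. rewrite Rabs_R0; lra.
  fold p q. revert Hy. unfold Rmin, Rmax; destruct Rle_dec; lra. }
assert (Hpq : forall s, p <= s <= q -> 0 <= F s <= 3 * (r1 - r0)).
{ intros s Hs. split.
  - apply RInt_ge_0. lra. apply ex_RInt_cont; auto. intros; apply cutoff_range.
  - eapply Rle_trans. apply Rle_abs. apply Rle_trans with (1 * Rabs (s - p)).
    apply abs_RInt_le_gen; auto. intros y _. rewrite Rabs_pos_eq; apply cutoff_range.
    rewrite Rabs_pos_eq by lra. unfold p, q in *; lra. }
assert (HF : forall s, 0 <= F s <= 3 * (r1 - r0)).
{ intros s. destruct (Rle_lt_dec s p) as [H1|H1].
  - unfold F. rewrite Z by lra. lra.
  - destruct (Rle_lt_dec s q) as [H2|H2]. apply Hpq; lra.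
    unfold F. rewrite <- (RInt_Chasles_cont _ p q s) by auto. rewrite (Z q s) by lra.
    rewrite Rplus_0_r. apply Hpq. unfold p, q; lra. }
intros a b. rewrite <- (Rplus_sub_l (RInt (cutoff r0 r1) p a) (RInt (cutoff r0 r1) a b)).
rewrite RInt_Chasles_cont by auto. change (Rabs (F b - F a) <= 3 * (r1 - r0)).
assert (Ha := HF a). assert (Hb := HF b). apply Rabs_le. lra.
Qed.

(** * Periodic boundary data on the whole line *)

Lemma periodic_nat (f : R -> R) T n t : (forall t, f (t + T) = f t) -> f (t + INR n * T) = f t.
Proof.
intros H. induction n as [|n IH]. f_equal; simpl; ring.
rewrite S_INR. replace (t + (INR n + 1) * T) with (t + INR n * T + T) by ring. rewrite H; auto.
Qed.

(** Uniform continuity on one period gives the modulus at distances below some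
    [d]; at larger distances boundedness does. *)
Lemma periodic_affine_modulus (f : R -> R) T M :
  0 < T -> (forall t, continuous f t) -> (forall t, f (t + T) = f t) -> (forall t, Rabs (f t) <= M) ->
  forall e, 0 < e -> exists b, 0 <= b /\ forall t t', Rabs (f t - f t') <= e + b * Rabs (t - t').
Proof.
intros HT Hc Hp HM e He.
assert (HM0 : 0 <= M) by (eapply Rle_trans; [apply Rabs_pos|apply (HM 0)]).
destruct (tube (fun s p => f (s + p)) 0 0 T e) as [d Hd]; auto.
{ intros s. apply (continuous_R1 f (fun z : R * R => fst z + snd z)); auto. cts. }
assert (d0 := cond_pos d).
exists (2 * M / d). assert (Hb : 0 <= 2 * M / d) by (apply Rdiv_le_0_compat; lra).
split; auto. intros t t'.
destruct (Rlt_le_dec (Rabs (t' - t)) d) as [Hs|Hs].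
- destruct (nfloor_ex (Rabs t / T)) as [n0 [Hn01 Hn02]].
  { apply Rdiv_le_0_compat; auto. apply Rabs_pos. }
  assert (Hpos : 0 <= (t + INR (S n0) * T) / T).
  { apply Rdiv_le_0_compat; auto. rewrite S_INR.
    assert (Rabs t < (INR n0 + 1) * T).
    { apply Rmult_lt_reg_r with (/ T). apply Rinv_0_lt_compat; auto.
      rewrite (Rmult_assoc (INR n0 + 1)), Rinv_r by lra. rewrite Rmult_1_r. exact Hn02. }
    assert (Ht := Rle_abs (- t)). rewrite Rabs_Ropp in Ht. lra. }
  destruct (nfloor_ex _ Hpos) as [m [Hm1 Hm2]].
  set (s := t + INR (S n0) * T - INR m * T).
  assert (Hs1 : 0 <= s <= T).
  { assert (E : (t + INR (S n0) * T) = (t + INR (S n0) * T) / T * T) by (field; lra).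
    unfold s. rewrite E. rewrite <- Rmult_minus_distr_r. split.
    apply Rmult_le_pos; lra. apply Rle_trans with (1 * T); [apply Rmult_le_compat_r; lra|lra]. }
  assert (E : forall u, f (t + u) = f (s + u)).
  { intros u. rewrite <- (periodic_nat f T (S n0) (t + u) Hp), <- (periodic_nat f T m (s + u) Hp).
    f_equal. unfold s. ring. }
  assert (Hball : ball 0 d (t' - t)).
  { change (Rabs (t' - t - 0) < d). rewrite Rminus_0_r. exact Hs. }
  assert (Q := Hd (t' - t) Hball s Hs1). cbv beta in Q. rewrite <- !E in Q.
  rewrite Rplus_0_r in Q. replace (t + (t' - t)) with t' in Q by ring.
  rewrite Rabs_minus_sym. assert (0 <= 2 * M / d * Rabs (t - t')) by (apply Rmult_le_pos; auto; apply Rabs_pos). lra.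
- assert (A1 := HM t). assert (A2 := HM t').
  assert (2 * M <= 2 * M / d * Rabs (t - t')).
  { apply Rle_trans with (2 * M / d * d). right; field; lra.
    apply Rmult_le_compat_l; auto. rewrite Rabs_minus_sym. auto. }
  unfold Rminus at 1. eapply Rle_trans. apply Rabs_triang. rewrite Rabs_Ropp. lra.
Qed.

Section PeriodicExtension.
Context (H : R -> R) (T sigma : R).
Context (HT : 0 < T) (HC : C1_on (half_line 0) H) (HP : forall t, 0 < t -> H (t + T) = H t).
Context (B0 : forall t, 0 <= t -> Rabs (H t) <= sigma).
Context (B1 : forall t, 0 <= t -> Rabs (Derive_on (half_line 0) H t) <= sigma).

Definition shift_index (t : R) : nat := Z.to_nat (up (Rabs t / T)).

(** The value at any positive time congruent to [t]; as [H] is periodic at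
    positive times only, the value at 0 is recovered by continuity. *)
Definition periodic_ext (t : R) : R := H (t + INR (shift_index t) * T).

Lemma shift_index_pos t : 0 < t + INR (shift_index t) * T.
Proof.
unfold shift_index. destruct (archimed (Rabs t / T)) as [A _].
assert (P : 0 <= Rabs t / T) by (apply Rdiv_le_0_compat; auto; apply Rabs_pos).
assert (Q : (0 <= up (Rabs t / T))%Z) by (apply le_IZR; lra).
rewrite INR_IZR_INZ, Z2Nat.id by auto.
assert (Rabs t < IZR (up (Rabs t / T)) * T).
{ apply Rmult_lt_reg_r with (/ T). apply Rinv_0_lt_compat; auto.
  rewrite (Rmult_assoc (IZR _)), Rinv_r by lra. rewrite Rmult_1_r. exact A. }
assert (Ht := Rle_abs (- t)). rewrite Rabs_Ropp in Ht. lra.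
Qed.

Lemma H_shift n t : 0 < t -> H (t + INR n * T) = H t.
Proof.
intros Ht. induction n as [|n IH]. f_equal; simpl; ring.
rewrite S_INR. replace (t + (INR n + 1) * T) with (t + INR n * T + T) by ring. rewrite HP; auto.
assert (0 <= INR n * T) by (apply Rmult_le_pos; [apply pos_INR|lra]). lra.
Qed.

Lemma periodic_ext_any n t : 0 < t + INR n * T -> periodic_ext t = H (t + INR n * T).
Proof.
intros Hn. unfold periodic_ext. assert (Hs := shift_index_pos t).
rewrite <- (H_shift n _ Hs), <- (H_shift (shift_index t) _ Hn). f_equal. ring.
Qed.

Lemma periodic_ext_periodic t : periodic_ext (t + T) = periodic_ext t.
Proof.
assert (Hs := shift_index_pos t). set (n := shift_index t) in *.
assert (Hs' : 0 < t + T + INR n * T) by lra.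
rewrite (periodic_ext_any n (t + T) Hs'), (periodic_ext_any n t Hs).
replace (t + T + INR n * T) with (t + INR n * T + T) by ring. apply HP; auto.
Qed.

Lemma locally_pos (u : R) : 0 < u -> locally u (fun y => 0 < y).
Proof.
intros Hu. exists (mkposreal u Hu). intros y Hy. assert (Hy' : Rabs (y - u) < u) by exact Hy.
revert Hy'. abs_lra.
Qed.

Lemma H_der_pos u : 0 < u -> is_derive H u (Derive_on (half_line 0) H u).
Proof.
intros Hu. assert (D := ex_derive_on_Derive_on 0 H u (Rlt_le _ _ Hu) (proj1 HC u (Rlt_le _ _ Hu))).
apply is_derive_eps. intros eps He.
generalize (filter_and _ _ (locally_pos u Hu) (proj1 (is_derive_on_eps (half_line 0) H u _ (Rlt_le _ _ Hu)) D eps He)).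
apply filter_imp. intros y [Y1 Y2]. apply Y2. unfold half_line; lra.
Qed.

Lemma locally_shift_pos n t : 0 < t + INR n * T -> locally t (fun y => 0 < y + INR n * T).
Proof.
intros Hn. exists (mkposreal _ Hn). intros y Hy. assert (Hy' : Rabs (y - t) < t + INR n * T) by exact Hy.
revert Hy'. abs_lra.
Qed.

Lemma periodic_ext_der n t : 0 < t + INR n * T ->
  is_derive periodic_ext t (Derive_on (half_line 0) H (t + INR n * T)).
Proof.
intros Hn.
apply (is_derive_ext_loc (fun y => H (y + INR n * T))).
{ generalize (locally_shift_pos n t Hn). apply filter_imp. intros y Hy. symmetry. apply periodic_ext_any; auto. }
apply is_derive_eq with (1 * Derive_on (half_line 0) H (t + INR n * T)); [|ring].
apply (is_derive_comp H (fun y => y + INR n * T) t). apply H_der_pos; auto.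
apply is_derive_eq with (1 + 0); [|ring]. apply is_derive_Rplus. apply is_derive_Rid. apply is_derive_Rconst.
Qed.

Lemma periodic_ext_Derive n t : 0 < t + INR n * T ->
  Derive periodic_ext t = Derive_on (half_line 0) H (t + INR n * T).
Proof. intros Hn. apply is_derive_unique. apply periodic_ext_der; auto. Qed.

Lemma periodic_ext_C1 :
  (forall t, is_derive periodic_ext t (Derive periodic_ext t)) /\
  (forall t, continuous (Derive periodic_ext) t) /\
  (forall t, Rabs (periodic_ext t) <= sigma) /\ (forall t, Rabs (Derive periodic_ext t) <= sigma) /\
  (forall t, Derive periodic_ext (t + T) = Derive periodic_ext t).
Proof.
refine (conj _ (conj _ (conj _ (conj _ _)))); intros t; assert (Hs := shift_index_pos t); set (n := shift_index t) in *.
- rewrite (periodic_ext_Derive n t Hs). apply periodic_ext_der; auto.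
- apply (continuous_ext_loc _ (fun y => Derive_on (half_line 0) H (y + INR n * T))).
  { generalize (locally_shift_pos n t Hs). apply filter_imp. intros y Hy. symmetry. apply periodic_ext_Derive; auto. }
  apply (continuous_comp (fun y => y + INR n * T) (Derive_on (half_line 0) H)). cts.
  apply (continuous_continuous_on (half_line 0)). 2: apply HC.
  generalize (locally_pos _ Hs). apply filter_imp. intros y Hy. unfold half_line; lra.
- rewrite (periodic_ext_any n t Hs). apply B0. lra.
- rewrite (periodic_ext_Derive n t Hs). apply B1. lra.
- apply is_derive_unique. apply (is_derive_Rext (fun y => periodic_ext (y + - T))).
  { intros y. rewrite <- (periodic_ext_periodic (y + - T)). f_equal. ring. }
  apply is_derive_eq with (1 * Derive periodic_ext t); [|ring].
  apply (is_derive_comp periodic_ext (fun y => y + - T) (t + T)).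
  + replace (t + T + - T) with t by ring. rewrite (periodic_ext_Derive n t Hs). apply periodic_ext_der; auto.
  + apply is_derive_eq with (1 + 0); [|ring]. apply is_derive_Rplus. apply is_derive_Rid. apply is_derive_Rconst.
Qed.

Lemma periodic_ext_eq t : 0 <= t -> periodic_ext t = H t.
Proof.
intros [Ht| <-].
- rewrite (periodic_ext_any 0 t); simpl; [f_equal; ring|lra].
- (* at 0 both sides are limits from the right of the same values *)
  apply cond_eq. intros eps He. assert (He2 : 0 < eps / 2) by lra.
  assert (C2 : continuous (extend 0 H) 0).
  { apply (is_derive_continuous _ _ _ (extend_der 0 H 0 (Rle_refl 0) (proj1 HC 0 (Rle_refl 0)))). }
  assert (C1 : continuous periodic_ext 0) by (apply (is_derive_continuous _ _ _ (proj1 periodic_ext_C1 0))).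
  destruct (filter_and _ _ (continuous_eps_inv _ _ (eps / 2) C1 He2) (continuous_eps_inv _ _ (eps / 2) C2 He2)) as [d Hd].
  assert (d0 := cond_pos d).
  assert (Hb : ball 0 d (d / 2)) by (change (Rabs (d / 2 - 0) < d); rewrite Rabs_pos_eq; lra).
  destruct (Hd _ Hb) as [Q1 Q2]. rewrite !extend_eq in Q2 by lra.
  assert (E : periodic_ext (d / 2) = H (d / 2)).
  { rewrite (periodic_ext_any 0 (d / 2)); simpl; [f_equal; ring|lra]. }
  rewrite E in Q1. revert Q1 Q2. abs_lra.
Qed.

End PeriodicExtension.

(** * Norms *)

Lemma sup_norm_le {X : Type} (A : X -> Prop) (f : X -> R) (M : R) :
  (forall x, A x -> Rabs (f x) <= M) -> Rbar_le (sup_norm A f) M.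
Proof.
intros HM. unfold sup_norm.
destruct (Lub_Rbar_correct (fun y => exists x, A x /\ y = Rabs (f x))) as [_ HL].
apply HL. intros y [x [Ax ->]]. apply HM; auto.
Qed.

Lemma sup_norm_ge {X : Type} (A : X -> Prop) (f : X -> R) x :
  A x -> Rbar_le (Rabs (f x)) (sup_norm A f).
Proof.
intros Ax. unfold sup_norm.
destruct (Lub_Rbar_correct (fun y => exists x, A x /\ y = Rabs (f x))) as [HU _].
apply HU. exists x; auto.
Qed.

Lemma C1_norm_bounds (A : R -> Prop) f (s : R) x0 : A x0 -> Rbar_le (C1_norm A f) s ->
  forall x, A x -> Rabs (f x) <= s /\ Rabs (Derive_on A f x) <= s.
Proof.
intros A0 HN x Ax. unfold C1_norm in HN.
assert (P1 := sup_norm_ge A f x Ax). assert (P2 := sup_norm_ge A (Derive_on A f) x Ax).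
assert (Q1 := Rabs_pos (f x)). assert (Q2 := Rabs_pos (Derive_on A f x)).
destruct (sup_norm A f) as [a| |], (sup_norm A (Derive_on A f)) as [b| |]; simpl in *; try contradiction; split; lra.
Qed.

(** * The background flow *)

Section Constants.
Context (gamma rho0 U10 U20 S0 th : R).

(** The constants that control the flow on [r0, 2 r0].  They involve the data at
    [r0] but not [r0] itself, because the flow equations are invariant under
    scaling of [r]. *)
Definition sound_sq_0 : R := gamma * exp S0 * Rpower rho0 (gamma - 1).
Definition subsonic_gap : R := sound_sq_0 - U10 ^ 2.
Definition sound_max : R := sqrt ((gamma - 1) / 2 * (U10 ^ 2 + U20 ^ 2) + sound_sq_0).
Definition slope_max : R := (U10 ^ 2 + U20 ^ 2) / subsonic_gap.
Definition speed_min : R := Rmin (U10 * exp (- (1 + slope_max))) (sqrt sound_sq_0 - U10).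
Definition coef_max : R :=
  1 + (gamma + 3) + / th + (U10 + 2 * / (gamma - 1) * sound_max) + U20 + / (gamma * (gamma - 1)) * sound_max
  + U10 * (1 + slope_max) + 4 * (sound_max * slope_max).
End Constants.

Section Background.
Context (gamma rho0 U10 U20 S0 r0 r1 : R) (rho U1 U2 Sb : R -> R).
Context (Hgam : 1 < gamma) (Hrho0 : 0 < rho0) (HU10 : 0 < U10) (HU20 : 0 < U20) (Hr0 : 0 < r0).
Context (HBF : background_flow gamma rho0 U10 U20 S0 r0 rho U1 U2 Sb).

Definition sound_sq (r : R) : R := gamma * exp S0 * Rpower (rho r) (gamma - 1).
(** The logarithmic derivative of the density, as the flow equations determine
    it; see [density_slope]. *)
Definition log_slope (r : R) : R := (U1 r ^ 2 + U2 r ^ 2) / (r * (sound_sq r - U1 r ^ 2)).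

Let drho := Derive_on (half_line r0) rho.
Let dU1 := Derive_on (half_line r0) U1.
Let dU2 := Derive_on (half_line r0) U2.
Let dS := Derive_on (half_line r0) Sb.
Let erho := extend r0 rho.
Let eU1 := extend r0 U1.
Let eU2 := extend r0 U2.
Let eS := extend r0 Sb.

Let Drho r : r0 <= r -> is_derive erho r (drho r).
Proof. intros H. apply extend_der; auto. apply (bg_smooth_rho _ _ _ _ _ _ _ _ _ _ HBF 0%nat r H). Qed.
Let DU1 r : r0 <= r -> is_derive eU1 r (dU1 r).
Proof. intros H. apply extend_der; auto. apply (bg_smooth_U1 _ _ _ _ _ _ _ _ _ _ HBF 0%nat r H). Qed.
Let DU2 r : r0 <= r -> is_derive eU2 r (dU2 r).
Proof. intros H. apply extend_der; auto. apply (bg_smooth_U2 _ _ _ _ _ _ _ _ _ _ HBF 0%nat r H). Qed.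
Let DS r : r0 <= r -> is_derive eS r (dS r).
Proof. intros H. apply extend_der; auto. apply (bg_smooth_S _ _ _ _ _ _ _ _ _ _ HBF 0%nat r H). Qed.

Let rho_pos r : r0 <= r -> 0 < rho r. Proof. apply (bg_rho_pos _ _ _ _ _ _ _ _ _ _ HBF). Qed.
Let rpos r : r0 <= r -> 0 < r. Proof. lra. Qed.

Lemma mass_eq r : r0 <= r -> drho r * U1 r + rho r * dU1 r + rho r * U1 r / r = 0.
Proof.
intros H. rewrite <- (bg_mass _ _ _ _ _ _ _ _ _ _ HBF r H). f_equal. symmetry.
apply Derive_on_half_line; auto.
apply (is_derive_on_ext _ (fun s => erho s * eU1 s)); auto.
{ intros y Hy. unfold erho, eU1. rewrite !extend_eq; auto. }
apply is_derive_on_of_is_derive; auto.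
apply is_derive_eq with (drho r * eU1 r + erho r * dU1 r).
apply is_derive_Rmult; auto. unfold erho, eU1. rewrite !extend_eq; auto.
Qed.

Lemma mass_flux r : r0 <= r -> r * (rho r * U1 r) = r0 * (rho0 * U10).
Proof.
intros H. destruct (bg_init _ _ _ _ _ _ _ _ _ _ HBF) as [E1 [E2 _]].
rewrite <- E1, <- E2.
assert (K := constant_right (fun s => s * (erho s * eU1 s)) (fun s => 1 * (erho s * eU1 s) + s * (drho s * eU1 s + erho s * dU1 s)) r0 r H).
unfold erho, eU1 in K. simpl in K. rewrite !extend_eq in K by lra. apply K.
- intros x Hx. apply (is_derive_Rmult (fun s => s) (fun s => erho s * eU1 s)). apply is_derive_Rid. apply (is_derive_Rmult erho eU1); auto.
- intros x Hx. rewrite !extend_eq by lra. assert (M := mass_eq x Hx). assert (P := rpos x Hx).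
  apply Rmult_eq_reg_r with (/ x). 2:{ apply Rinv_neq_0_compat; lra. }
  rewrite Rmult_0_l, <- M. field. lra.
Qed.

Lemma U1_pos r : r0 <= r -> 0 < U1 r.
Proof.
intros H. assert (M := mass_flux r H).
assert (P : 0 < r0 * (rho0 * U10)) by (repeat apply Rmult_lt_0_compat; auto).
rewrite <- M in P. assert (Hr := rpos r H). assert (Hp := rho_pos r H).
assert (Q : 0 < r * rho r) by (apply Rmult_lt_0_compat; auto).
apply Rmult_lt_reg_l with (r * rho r); auto. rewrite Rmult_0_r. lra.
Qed.

Lemma dS_zero r : r0 <= r -> dS r = 0.
Proof.
intros H. assert (E := bg_entropy _ _ _ _ _ _ _ _ _ _ HBF r H). assert (P := U1_pos r H).
apply Rmult_integral in E. destruct E; auto. lra.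
Qed.

Lemma entropy_const r : r0 <= r -> Sb r = S0.
Proof.
intros H. destruct (bg_init _ _ _ _ _ _ _ _ _ _ HBF) as [_ [_ [_ E]]]. rewrite <- E.
assert (K := constant_right eS dS r0 r H). unfold eS in K. rewrite !extend_eq in K by lra.
apply K; auto. intros; apply dS_zero; auto.
Qed.

Lemma power_der (k r : R) : r0 <= r ->
  is_derive (fun s => Rpower (erho s) k) r (Rpower (rho r) k * (k * (drho r / rho r))).
Proof.
intros H. assert (P := rho_pos r H). assert (E : erho r = rho r) by (apply extend_eq; auto).
unfold Rpower. rewrite <- E.
apply is_derive_eq with (k * (drho r * / erho r) * exp (k * ln (erho r))); [|unfold Rdiv; ring].
apply (is_derive_comp exp (fun s => k * ln (erho s)) r). apply is_derive_exp.
apply (is_derive_scal (fun s => ln (erho s))).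
apply (is_derive_comp ln erho r). apply is_derive_ln. lra. apply Drho; auto.
Qed.

Lemma sound_sq_pos r : 0 < sound_sq r.
Proof.
unfold sound_sq. repeat apply Rmult_lt_0_compat. lra. apply exp_pos. unfold Rpower. apply exp_pos.
Qed.

Lemma radial_eq r : r0 <= r -> U1 r * dU1 r + sound_sq r * (drho r / rho r) - U2 r ^ 2 / r = 0.
Proof.
intros H. rewrite <- (bg_radial _ _ _ _ _ _ _ _ _ _ HBF r H). fold dU1. f_equal. f_equal.
assert (P := rho_pos r H).
rewrite (Derive_on_half_line r0 _ r (exp S0 * (Rpower (rho r) gamma * (gamma * (drho r / rho r))))); auto.
- assert (E : Rpower (rho r) gamma = Rpower (rho r) (gamma - 1) * rho r).
  { rewrite <- (Rpower_1 (rho r)) at 3 by auto. rewrite <- Rpower_plus. f_equal. ring. }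
  rewrite E. unfold sound_sq. field. lra.
- apply (is_derive_on_ext _ (fun s => exp S0 * Rpower (erho s) gamma)); auto.
  { intros y Hy. unfold erho. rewrite extend_eq by auto. rewrite entropy_const; auto. }
  apply is_derive_on_of_is_derive; auto.
  apply (is_derive_scal (fun s => Rpower (erho s) gamma)). apply power_der; auto.
Qed.

Lemma angular_eq r : r0 <= r -> dU2 r = - (U2 r / r).
Proof.
intros H. assert (E := bg_angular _ _ _ _ _ _ _ _ _ _ HBF r H). fold dU2 in E. assert (P := U1_pos r H).
assert (Hr := rpos r H).
assert (E2 : U1 r * (dU2 r + U2 r / r) = 0) by (rewrite <- E; field; lra).
apply Rmult_integral in E2. destruct E2; lra.
Qed.

Lemma sound_speed_sq r : sound_speed gamma S0 rho r ^ 2 = sound_sq r.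
Proof.
unfold sound_speed. fold (sound_sq r). assert (H := sound_sq_pos r).
rewrite <- Rsqr_pow2. apply Rsqr_sqrt. lra.
Qed.

Lemma subsonic r : r0 <= r -> U1 r ^ 2 + U2 r ^ 2 < sound_sq r.
Proof. intros H. rewrite <- sound_speed_sq. apply (bg_subsonic _ _ _ _ _ _ _ _ _ _ HBF); auto. Qed.

Lemma log_slope_pos r : r0 <= r -> 0 < sound_sq r - U1 r ^ 2 /\ 0 <= log_slope r.
Proof.
intros H. assert (A := subsonic r H). assert (B := pow2_ge_0 (U2 r)). assert (D := pow2_ge_0 (U1 r)).
assert (Hr := rpos r H). split. lra.
unfold log_slope. apply Rdiv_le_0_compat. lra. apply Rmult_lt_0_compat; lra.
Qed.

(** Cramer's rule for the mass and radial momentum equations, whose determinant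
    does not vanish because the flow is subsonic. *)
Lemma density_slope r : r0 <= r -> drho r / rho r = log_slope r.
Proof.
intros H. assert (A := proj1 (log_slope_pos r H)). assert (M := mass_eq r H). assert (Q := radial_eq r H).
assert (P := rho_pos r H). assert (Hr := rpos r H).
unfold log_slope. apply Rmult_eq_reg_r with (r * (sound_sq r - U1 r ^ 2)).
2:{ apply Rgt_not_eq, Rmult_lt_0_compat; lra. }
replace ((U1 r ^ 2 + U2 r ^ 2) / (r * (sound_sq r - U1 r ^ 2)) * (r * (sound_sq r - U1 r ^ 2)))
  with (U1 r ^ 2 + U2 r ^ 2) by (field; lra).
assert (M2 : dU1 r = - U1 r / r - U1 r * (drho r / rho r)).
{ apply Rmult_eq_reg_l with (rho r); [|lra].
  replace (rho r * (- U1 r / r - U1 r * (drho r / rho r))) with (- (rho r * U1 r / r) - drho r * U1 r) by (field; lra). lra. }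
rewrite M2 in Q.
assert (Q2 : U2 r ^ 2 / r = U1 r * (- U1 r / r - U1 r * (drho r / rho r)) + sound_sq r * (drho r / rho r)) by lra.
replace (U2 r ^ 2) with (U2 r ^ 2 / r * r) by (field; lra). rewrite Q2. field. lra.
Qed.

Lemma velocity_slope r : r0 <= r -> dU1 r = - U1 r * (/ r + log_slope r).
Proof.
intros H. rewrite <- density_slope by auto. assert (M := mass_eq r H).
assert (P := rho_pos r H). assert (Hr := rpos r H).
apply Rmult_eq_reg_l with (rho r); [|lra].
replace (rho r * (- U1 r * (/ r + drho r / rho r))) with (- (rho r * U1 r / r) - drho r * U1 r) by (field; lra). lra.
Qed.

Lemma sound_sq_der r : r0 <= r ->
  is_derive (fun s => gamma * exp S0 * Rpower (erho s) (gamma - 1)) r (sound_sq r * ((gamma - 1) * log_slope r)).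
Proof.
intros H. rewrite <- density_slope by auto.
apply is_derive_eq with (gamma * exp S0 * (Rpower (rho r) (gamma - 1) * ((gamma - 1) * (drho r / rho r)))).
2:{ unfold sound_sq; ring. }
apply (is_derive_scal (fun s => Rpower (erho s) (gamma - 1))). apply power_der; auto.
Qed.

Lemma extend_sound_sq r : r0 <= r -> gamma * exp S0 * Rpower (erho r) (gamma - 1) = sound_sq r.
Proof. intros H. unfold erho. rewrite extend_eq; auto. Qed.

Lemma sound_sq_init : sound_sq r0 = gamma * exp S0 * Rpower rho0 (gamma - 1).
Proof. unfold sound_sq. destruct (bg_init _ _ _ _ _ _ _ _ _ _ HBF) as [E _]. rewrite E. reflexivity. Qed.

Lemma sound_sq_lower r : r0 <= r -> sound_sq r0 <= sound_sq r.
Proof.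
intros H.
assert (K := increasing_right (fun s => gamma * exp S0 * Rpower (erho s) (gamma - 1)) (fun r => sound_sq r * ((gamma - 1) * log_slope r)) r0 r H sound_sq_der).
cbv beta in K. rewrite !extend_sound_sq in K by lra. apply K.
intros x Hx. assert (A := sound_sq_pos x). assert (B := proj2 (log_slope_pos x Hx)).
apply Rmult_le_pos; [lra|]. apply Rmult_le_pos; lra.
Qed.

Lemma U1_upper r : r0 <= r -> U1 r <= U10.
Proof.
intros H. destruct (bg_init _ _ _ _ _ _ _ _ _ _ HBF) as [_ [E2 _]]. rewrite <- E2.
assert (K := increasing_right (fun s => - eU1 s) (fun s => - dU1 s) r0 r H).
unfold eU1 in K. cbv beta in K. rewrite !extend_eq in K by lra. apply Ropp_le_cancel. apply K.
- intros x Hx. apply (is_derive_opp (V := R_NormedModule)). apply DU1; auto.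
- intros x Hx. rewrite velocity_slope by auto. assert (A := U1_pos x Hx). assert (B := proj2 (log_slope_pos x Hx)).
  assert (0 < / x) by (apply Rinv_0_lt_compat; lra).
  assert (0 <= U1 x * (/ x + log_slope x)) by (apply Rmult_le_pos; lra). lra.
Qed.

Lemma U2_bound r : r0 <= r -> Rabs (U2 r) <= U20.
Proof.
intros H. destruct (bg_init _ _ _ _ _ _ _ _ _ _ HBF) as [_ [_ [E3 _]]].
assert (K := constant_right (fun s => s * eU2 s) (fun s => 1 * eU2 s + s * dU2 s) r0 r H).
unfold eU2 in K. cbv beta in K. rewrite !extend_eq in K by lra.
assert (E : r * U2 r = r0 * U2 r0).
{ apply K. intros x Hx. apply (is_derive_Rmult (fun s => s) eU2). apply is_derive_Rid. apply DU2; auto.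
  intros x Hx. rewrite extend_eq, angular_eq by auto. field. assert (Hp := rpos x Hx). lra. }
rewrite E3 in E. assert (Hr := rpos r H).
assert (P : 0 < U2 r).
{ apply Rmult_lt_reg_l with r; auto. rewrite Rmult_0_r, E. apply Rmult_lt_0_compat; auto. }
rewrite Rabs_pos_eq by lra. apply Rmult_le_reg_l with r; auto. rewrite E. apply Rmult_le_compat_r; lra.
Qed.

(** Bernoulli's law bounds the sound speed from above. *)
Lemma sound_sq_upper r : r0 <= r ->
  sound_sq r <= (gamma - 1) / 2 * (U10 ^ 2 + U20 ^ 2) + sound_sq r0.
Proof.
intros H. destruct (bg_init _ _ _ _ _ _ _ _ _ _ HBF) as [_ [E2 [E3 _]]].
assert (K := constant_right (fun s => (gamma - 1) / 2 * (eU1 s * eU1 s + eU2 s * eU2 s) + gamma * exp S0 * Rpower (erho s) (gamma - 1))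
  (fun s => (gamma - 1) / 2 * ((dU1 s * eU1 s + eU1 s * dU1 s) + (dU2 s * eU2 s + eU2 s * dU2 s)) + sound_sq s * ((gamma - 1) * log_slope s)) r0 r H).
unfold eU1, eU2 in K. cbv beta in K. rewrite !extend_sound_sq in K by lra. rewrite !extend_eq in K by lra.
rewrite <- E2, <- E3.
assert (E : (gamma - 1) / 2 * (U1 r * U1 r + U2 r * U2 r) + sound_sq r = (gamma - 1) / 2 * (U1 r0 * U1 r0 + U2 r0 * U2 r0) + sound_sq r0).
{ apply K.
  - intros x Hx. apply is_derive_Rplus; [|apply sound_sq_der; auto].
    apply (is_derive_scal (fun s => eU1 s * eU1 s + eU2 s * eU2 s)). apply is_derive_Rplus; [apply (is_derive_Rmult eU1 eU1)|apply (is_derive_Rmult eU2 eU2)]; auto.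
  - intros x Hx. rewrite !extend_eq by auto. assert (Q := radial_eq x Hx). rewrite density_slope in Q by auto.
    rewrite angular_eq by auto. assert (Hp := rpos x Hx).
    assert (Q2 : U1 x * dU1 x = U2 x ^ 2 / x - sound_sq x * log_slope x) by lra.
    replace (dU1 x * U1 x + U1 x * dU1 x) with (2 * (U1 x * dU1 x)) by ring. rewrite Q2. field. lra. }
assert (A := pow2_ge_0 (U1 r)). assert (B := pow2_ge_0 (U2 r)).
assert (0 <= (gamma - 1) / 2 * (U1 r ^ 2 + U2 r ^ 2)) by (apply Rmult_le_pos; lra). lra.
Qed.

Context (Hsub : U10 ^ 2 + U20 ^ 2 < gamma * exp S0 * Rpower rho0 (gamma - 1)).

Let c2 := sound_sq_0 gamma rho0 S0.
Let G := subsonic_gap gamma rho0 U10 S0.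
Let cM := sound_max gamma rho0 U10 U20 S0.
Let k0 := slope_max gamma rho0 U10 U20 S0.

Lemma gap_eq : G = sound_sq r0 - U10 ^ 2.
Proof. unfold G, subsonic_gap, sound_sq_0. rewrite sound_sq_init. reflexivity. Qed.

Lemma gap_pos : 0 < G.
Proof. unfold G, subsonic_gap, sound_sq_0. assert (H := pow2_ge_0 U20). lra. Qed.

Lemma slope_max_pos : 0 <= k0.
Proof.
apply Rdiv_le_0_compat; [|apply gap_pos]. assert (A := pow2_ge_0 U10). assert (B := pow2_ge_0 U20). lra.
Qed.

Lemma log_slope_upper r : r0 <= r -> log_slope r <= k0 * / r0.
Proof.
intros H. assert (A := U1_upper r H). assert (B := U2_bound r H). assert (D := sound_sq_lower r H). assert (E := U1_pos r H).
assert (F1 : U1 r ^ 2 <= U10 ^ 2) by (apply pow_incr; lra).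
assert (F2 : U2 r ^ 2 <= U20 ^ 2).
{ rewrite <- (pow2_abs (U2 r)). apply pow_incr. split; auto. apply Rabs_pos. }
assert (Hr := rpos r H).
assert (HG := gap_eq). assert (HG0 := gap_pos).
unfold log_slope, k0, slope_max, Rdiv. fold G. rewrite Rmult_assoc.
apply Rmult_le_compat. assert (P := pow2_ge_0 (U1 r)). assert (P' := pow2_ge_0 (U2 r)). lra.
left. apply Rinv_0_lt_compat. apply Rmult_lt_0_compat; lra. lra.
rewrite <- Rinv_mult. apply Rinv_le_contravar. apply Rmult_lt_0_compat; auto.
rewrite (Rmult_comm r). apply Rmult_le_compat; lra.
Qed.

(** The logarithmic derivative of [U1] is at least [- (1 + k0) / r0], and the
    segment is no longer than [r0]. *)
Lemma U1_lower r : r0 <= r <= 2 * r0 -> U10 * exp (- (1 + k0)) <= U1 r.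
Proof.
intros [H H2]. destruct (bg_init _ _ _ _ _ _ _ _ _ _ HBF) as [_ [E2 _]].
set (ka := (1 + k0) / r0).
assert (ka0 : 0 <= ka) by (apply Rdiv_le_0_compat; auto; assert (Hx := slope_max_pos); lra).
assert (K := increasing_right (fun s => eU1 s * exp (ka * (s - r0))) (fun s => dU1 s * exp (ka * (s - r0)) + eU1 s * (ka * exp (ka * (s - r0)))) r0 r H).
unfold eU1 in K. cbv beta in K. rewrite !extend_eq in K by lra.
rewrite Rminus_eq_0, Rmult_0_r, exp_0, Rmult_1_r, E2 in K.
assert (K2 : U10 <= U1 r * exp (ka * (r - r0))).
{ apply K.
  - intros x Hx. apply (is_derive_Rmult eU1 (fun s => exp (ka * (s - r0)))). apply DU1; auto.
    apply (is_derive_comp exp (fun s => ka * (s - r0)) x). apply is_derive_exp.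
    apply is_derive_eq with (ka * (1 - 0)); [|ring]. apply (is_derive_scal (fun s => s - r0)).
    apply is_derive_Rminus. apply is_derive_Rid. apply is_derive_Rconst.
  - intros x Hx. rewrite extend_eq, velocity_slope by auto. assert (A := U1_pos x Hx).
    assert (B := log_slope_upper x Hx). assert (Q := exp_pos (ka * (x - r0))).
    replace (- U1 x * (/ x + log_slope x) * exp (ka * (x - r0)) + U1 x * (ka * exp (ka * (x - r0))))
     with (U1 x * exp (ka * (x - r0)) * (ka - / x - log_slope x)) by ring.
    assert (/ x <= / r0) by (apply Rinv_le_contravar; lra).
    apply Rmult_le_pos. apply Rmult_le_pos; lra. unfold ka, Rdiv. lra. }
assert (Hk : ka * (r - r0) <= 1 + k0).
{ apply Rle_trans with (ka * r0). apply Rmult_le_compat_l; lra. right; unfold ka; field; lra. }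
assert (He : exp (ka * (r - r0)) <= exp (1 + k0)).
{ destruct Hk as [Hk| ->]; [left; apply exp_increasing; auto|right; auto]. }
rewrite exp_Ropp. apply Rmult_le_reg_r with (exp (1 + k0)). apply exp_pos.
rewrite Rmult_assoc, Rinv_l, Rmult_1_r by (apply Rgt_not_eq, exp_pos).
eapply Rle_trans. exact K2. apply Rmult_le_compat_l; auto. left; apply U1_pos; auto.
Qed.

(** ** Derivatives of the background invariants *)

Let esound (s : R) : R := sqrt (gamma * exp S0 * Rpower (erho s) (gamma - 1)).

Lemma esound_eq r : r0 <= r -> esound r = sound_speed gamma S0 rho r.
Proof. intros H. unfold esound, sound_speed, erho. rewrite extend_eq; auto. Qed.

Lemma sound_pos r : 0 < sound_speed gamma S0 rho r.
Proof. unfold sound_speed. apply sqrt_lt_R0. apply sound_sq_pos. Qed.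

Lemma sound_der r : r0 <= r ->
  is_derive esound r (sound_speed gamma S0 rho r * ((gamma - 1) / 2 * log_slope r)).
Proof.
intros H. assert (P := sound_pos r). assert (Q := sound_sq_pos r).
apply is_derive_eq with (sound_sq r * ((gamma - 1) * log_slope r) * / (2 * sqrt (sound_sq r))).
- unfold esound. rewrite <- (extend_sound_sq r H) at 2.
  apply (is_derive_comp sqrt (fun s => gamma * exp S0 * Rpower (erho s) (gamma - 1)) r).
  + apply is_derive_Reals. apply derivable_pt_lim_sqrt. rewrite extend_sound_sq; auto.
  + apply sound_sq_der; auto.
- change (sqrt (sound_sq r)) with (sound_speed gamma S0 rho r). rewrite <- (sound_speed_sq r). field. lra.
Qed.

Lemma Derive_on_R1 r : r0 <= r ->
  Derive_on (half_line r0) (Rbg gamma S0 rho U1 U2 i1) r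
  = - U1 r * (/ r + log_slope r) - sound_speed gamma S0 rho r * log_slope r.
Proof.
intros H. apply Derive_on_half_line; auto.
apply (is_derive_on_ext _ (fun s => eU1 s - 2 * / (gamma - 1) * esound s)); auto.
{ intros y Hy. unfold eU1. rewrite extend_eq, esound_eq by auto. simpl. field. lra. }
apply is_derive_on_of_is_derive; auto.
apply is_derive_eq with (dU1 r - 2 * / (gamma - 1) * (sound_speed gamma S0 rho r * ((gamma - 1) / 2 * log_slope r))).
- apply is_derive_Rminus. apply DU1; auto. apply (is_derive_scal esound). apply sound_der; auto.
- rewrite velocity_slope by auto. field. lra.
Qed.

Lemma Derive_on_R4 r : r0 <= r ->
  Derive_on (half_line r0) (Rbg gamma S0 rho U1 U2 i4) r
  = - U1 r * (/ r + log_slope r) + sound_speed gamma S0 rho r * log_slope r.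
Proof.
intros H. apply Derive_on_half_line; auto.
apply (is_derive_on_ext _ (fun s => eU1 s + 2 * / (gamma - 1) * esound s)); auto.
{ intros y Hy. unfold eU1. rewrite extend_eq, esound_eq by auto. simpl. field. lra. }
apply is_derive_on_of_is_derive; auto.
apply is_derive_eq with (dU1 r + 2 * / (gamma - 1) * (sound_speed gamma S0 rho r * ((gamma - 1) / 2 * log_slope r))).
- apply is_derive_Rplus. apply DU1; auto. apply (is_derive_scal esound). apply sound_der; auto.
- rewrite velocity_slope by auto. field. lra.
Qed.

Definition frak_c_slope (r : R) : R := / (2 * gamma) * (sound_speed gamma S0 rho r * log_slope r).

Lemma frak_c_der r : r0 <= r ->
  is_derive (fun s => / (gamma * (gamma - 1)) * esound s) r (frak_c_slope r).
Proof.
intros H. apply is_derive_eq with (/ (gamma * (gamma - 1)) * (sound_speed gamma S0 rho r * ((gamma - 1) / 2 * log_slope r))).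
apply (is_derive_scal esound). apply sound_der; auto. unfold frak_c_slope. field. lra.
Qed.

Lemma Derive_on_frak_c r : r0 <= r ->
  Derive_on (half_line r0) (frak_c gamma S0 rho) r = frak_c_slope r.
Proof.
intros H. apply Derive_on_half_line; auto.
apply (is_derive_on_ext _ (fun s => / (gamma * (gamma - 1)) * esound s)); auto.
{ intros y Hy. rewrite esound_eq by auto. unfold frak_c. field. lra. }
apply is_derive_on_of_is_derive; auto. apply frak_c_der; auto.
Qed.

(** ** The coefficients, frozen outside the segment *)

Context (Hr1 : r0 < r1) (Hr2 : r1 <= 2 * r0).

Let x := clamp r0 r1.

Lemma x_range r : r0 <= x r <= r1.
Proof. apply clamp_range. lra. Qed.

Lemma x_ge r : r0 <= x r.
Proof. apply x_range. Qed.

Let comp_cont f (ef : R -> R) df :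
  (forall r, r0 <= r -> is_derive ef r (df r)) -> (forall r, r0 <= r -> ef r = f r) ->
  forall r, continuous (fun r => f (x r)) r.
Proof.
intros HD HE r. apply continuous_ext with (fun r => ef (x r)).
{ intros y. apply HE. apply x_ge. }
apply (continuous_comp x ef). apply clamp_cont. apply (is_derive_continuous _ _ (df (x r))). apply HD. apply x_ge.
Qed.

Lemma U1_curve_cont r : continuous (fun r => U1 (x r)) r.
Proof. apply (comp_cont U1 eU1 dU1); auto. intros; apply extend_eq; auto. Qed.

Lemma U2_curve_cont r : continuous (fun r => U2 (x r)) r.
Proof. apply (comp_cont U2 eU2 dU2); auto. intros; apply extend_eq; auto. Qed.

Lemma sound_curve_cont r : continuous (fun r => sound_speed gamma S0 rho (x r)) r.
Proof.
apply (comp_cont (sound_speed gamma S0 rho) esound (fun r => sound_speed gamma S0 rho r * ((gamma - 1) / 2 * log_slope r))).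
apply sound_der. apply esound_eq.
Qed.

Lemma inv_curve_cont (f : R -> R) : (forall r, continuous f r) -> (forall r, f r <> 0) -> forall r, continuous (fun r => / f r) r.
Proof.
intros Hf Hn r. apply (continuous_comp f Rinv); auto.
apply continuity_pt_filterlim. apply (continuity_pt_inv (fun y => y)). apply continuity_pt_id. apply Hn.
Qed.

Lemma log_slope_curve_cont r : continuous (fun r => log_slope (x r)) r.
Proof.
assert (C1 := U1_curve_cont). assert (C2 := U2_curve_cont). assert (C3 := sound_curve_cont).
apply continuous_ext with (fun r => (U1 (x r) * U1 (x r) + U2 (x r) * U2 (x r)) *
   / (x r * (sound_speed gamma S0 rho (x r) * sound_speed gamma S0 rho (x r) - U1 (x r) * U1 (x r)))).
{ intros y. unfold log_slope. rewrite <- sound_speed_sq. unfold Rdiv. f_equal. ring. f_equal. ring. }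
apply continuous_Rmult. { apply continuous_Rplus; apply continuous_Rmult; auto. }
apply (inv_curve_cont (fun r => x r * (sound_speed gamma S0 rho (x r) * sound_speed gamma S0 rho (x r) - U1 (x r) * U1 (x r)))).
{ intros y. apply continuous_Rmult; [apply clamp_cont|]. apply continuous_Rminus; apply continuous_Rmult; auto. }
intros y. assert (H := proj1 (log_slope_pos (x y) (x_ge y))). rewrite <- sound_speed_sq in H. assert (Hr := rpos _ (x_ge y)).
apply Rgt_not_eq. apply Rmult_lt_0_compat; auto. lra.
Qed.

(** The background coefficients, frozen outside [r0, r1]; frak_c is continued
    differentiably, since the system differentiates it along the orbits. *)
Definition background_profile : profile :=
  let Rb := Rbg gamma S0 rho U1 U2 in
  Profile (fun r => Rb i1 (x r)) (fun r => Rb i2 (x r)) (fun r => Rb i4 (x r))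
    (fun r => Derive_on (half_line r0) (Rb i1) (x r)) (fun r => Derive_on (half_line r0) (Rb i4) (x r))
    (fun r => frak_c gamma S0 rho r0 + RInt (fun s => cutoff r0 r1 s * frak_c_slope (x s)) r0 r)
    (fun r => frak_c_slope (x r)) (fun r => / x r).

Let snd_ := sound_speed gamma S0 rho.
Let slp := log_slope.

Lemma sound_range r : r0 <= r -> sqrt c2 <= snd_ r <= cM.
Proof.
intros H. unfold snd_, sound_speed. fold (sound_sq r).
assert (L := sound_sq_lower r H).
assert (U := sound_sq_upper r H).
rewrite sound_sq_init in L, U.
split; apply sqrt_le_1_alt; auto.
Qed.

Lemma sound_sq_0_gt : U10 < sqrt c2.
Proof.
rewrite <- (sqrt_pow2 U10) by lra. apply sqrt_lt_1_alt. assert (H := gap_pos). unfold G, subsonic_gap in H. fold c2 in H.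
assert (H2 := pow2_ge_0 U10). lra.
Qed.

Lemma sound_max_pos : 0 < cM.
Proof. assert (H := sound_range r0 (Rle_refl r0)). assert (H2 := sound_sq_0_gt). lra. Qed.

Lemma slope_range r : r0 <= r -> 0 <= slp r <= k0 * / r0.
Proof.
intros H. split. apply (log_slope_pos r H).
apply log_slope_upper; auto.
Qed.

Lemma U1_range r : r0 <= r -> 0 < U1 r <= U10.
Proof.
intros H. split. apply U1_pos; auto. apply U1_upper; auto.
Qed.

Lemma sound_slope_range r : r0 <= r -> 0 <= snd_ r * slp r <= cM * k0 * / r0.
Proof.
intros H. assert (A := sound_range r H). assert (B := slope_range r H). assert (D := sound_sq_0_gt).
split. apply Rmult_le_pos; lra. rewrite Rmult_assoc. apply Rmult_le_compat; lra.
Qed.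

Lemma frak_slope_range r : r0 <= r -> 0 <= frak_c_slope r <= cM * k0 * / r0.
Proof.
intros H. assert (A := sound_slope_range r H). unfold frak_c_slope. fold snd_ slp.
assert (I : 0 < / (2 * gamma) <= 1).
{ split. apply Rinv_0_lt_compat; lra. rewrite <- Rinv_1. apply Rinv_le_contravar; lra. }
split. apply Rmult_le_pos; lra.
apply Rle_trans with (1 * (snd_ r * slp r)). apply Rmult_le_compat_r; lra. lra.
Qed.

Lemma inv_r_range r : r0 <= r -> 0 < / r <= / r0.
Proof. intros H. split. apply Rinv_0_lt_compat; lra. apply Rinv_le_contravar; lra. Qed.

Lemma inv_x_cont r : continuous (fun r => / x r) r.
Proof.
apply (inv_curve_cont x). apply clamp_cont. intros y. assert (H := x_ge y). lra.
Qed.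

Lemma frakx_cont r : continuous (fun r => frak_c_slope (x r)) r.
Proof.
assert (C1 := sound_curve_cont). assert (C2 := log_slope_curve_cont).
apply (continuous_Rmult (fun _ => / (2 * gamma)) (fun r => snd_ (x r) * slp (x r))). apply continuous_const.
apply (continuous_Rmult (fun r => snd_ (x r)) (fun r => slp (x r))); auto.
Qed.

Lemma profile_cf_der r : is_derive (cf background_profile) r (cutoff r0 r1 r * cf' background_profile r).
Proof.
simpl. fold x. assert (C1 := frakx_cont). assert (C2 := cutoff_cont r0 r1).
apply is_derive_eq with (0 + cutoff r0 r1 r * frak_c_slope (x r)); [|ring].
apply is_derive_Rplus. apply is_derive_Rconst.
apply (is_derive_RInt_cont (fun s => cutoff r0 r1 s * frak_c_slope (x s))). intros.
apply continuous_Rmult; auto.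
Qed.

(** Both sides have the same value at [r0] and the same derivative on the
    segment, where the cut-off is 1. *)
Lemma profile_cf_eq r : r0 <= r <= r1 -> cf background_profile r = frak_c gamma S0 rho r.
Proof.
intros Hr.
assert (Ef : forall s, r0 <= s -> / (gamma * (gamma - 1)) * sqrt (gamma * exp S0 * Rpower (extend r0 rho s) (gamma - 1)) = frak_c gamma S0 rho s).
{ intros s Hs. rewrite extend_eq by auto. unfold frak_c, sound_speed, Rdiv. ring. }
destruct (mean_value_right (fun s => cf background_profile s - / (gamma * (gamma - 1)) * sqrt (gamma * exp S0 * Rpower (extend r0 rho s) (gamma - 1)))
  (fun s => cutoff r0 r1 s * cf' background_profile s - frak_c_slope s) r0 r (proj1 Hr)) as [c [Hc E]].
- intros y Hy. apply is_derive_Rminus. apply profile_cf_der.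
  apply (frak_c_der y Hy).
- cbv beta in E. rewrite !Ef in E by lra. rewrite cutoff_one in E by lra.
  assert (Ecf : cf' background_profile c = frak_c_slope c).
  { simpl. unfold x. rewrite clamp_eq by lra. reflexivity. }
  rewrite Ecf in E.
  assert (E0 : cf background_profile r0 = frak_c gamma S0 rho r0).
  { simpl. rewrite RInt_point. unfold zero; simpl. ring. }
  lra.
Qed.

Context (th : R) (Hth : 0 < th < 1).
Let C := coef_max gamma rho0 U10 U20 S0 th.

Lemma coef_terms : 0 < / th /\ 0 <= 2 * / (gamma - 1) * cM /\ 0 <= / (gamma * (gamma - 1)) * cM /\ 0 <= U10 * (1 + k0) /\ 0 <= cM * k0.
Proof.
assert (A := sound_max_pos). assert (B := slope_max_pos).
assert (D : 0 < / (gamma - 1)) by (apply Rinv_0_lt_compat; lra).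
assert (E : 0 < / (gamma * (gamma - 1))) by (apply Rinv_0_lt_compat, Rmult_lt_0_compat; lra).
refine (conj _ (conj _ (conj _ (conj _ _)))).
apply Rinv_0_lt_compat; lra. apply Rmult_le_pos; lra. apply Rmult_le_pos; lra. apply Rmult_le_pos; lra. apply Rmult_le_pos; lra.
Qed.

Lemma coef_max_eq : C = 1 + (gamma + 3) + / th + (U10 + 2 * / (gamma - 1) * cM) + U20 + / (gamma * (gamma - 1)) * cM
  + U10 * (1 + k0) + 4 * (cM * k0).
Proof. reflexivity. Qed.

Lemma coef_max_range : 1 <= C /\ gamma + 3 <= C /\ / th <= C.
Proof. assert (T := coef_terms). rewrite coef_max_eq. lra. Qed.

Lemma frak_c_init_range : 0 <= frak_c gamma S0 rho r0 <= / (gamma * (gamma - 1)) * cM.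
Proof.
unfold frak_c, Rdiv. fold snd_. rewrite Rmult_comm. assert (A := sound_range r0 (Rle_refl r0)). assert (D := sound_sq_0_gt).
assert (E : 0 < / (gamma * (gamma - 1))) by (apply Rinv_0_lt_compat, Rmult_lt_0_compat; lra).
split. apply Rmult_le_pos; lra. apply Rmult_le_compat_l; lra.
Qed.

Lemma background_bounds : profile_bounds background_profile C (/ r0).
Proof.
assert (T := coef_terms).
assert (Ir : 0 < / r0) by (apply Rinv_0_lt_compat; auto).
assert (D1 : 0 < / (gamma - 1)) by (apply Rinv_0_lt_compat; lra).
assert (RE : forall y, Rbg gamma S0 rho U1 U2 i1 y = U1 y - 2 * / (gamma - 1) * snd_ y).
{ intros y. simpl. unfold snd_, Rdiv. ring. }
assert (RE4 : forall y, Rbg gamma S0 rho U1 U2 i4 y = U1 y + 2 * / (gamma - 1) * snd_ y).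
{ intros y. simpl. unfold snd_, Rdiv. ring. }
assert (S2 : forall y, r0 <= y -> 0 <= 2 * / (gamma - 1) * snd_ y <= 2 * / (gamma - 1) * cM).
{ intros y Hy. assert (A := sound_range y Hy). assert (D := sound_sq_0_gt).
  split. apply Rmult_le_pos; lra. apply Rmult_le_compat_l; lra. }
assert (UR : forall y, r0 <= y -> 0 <= U1 y * (/ y + slp y) <= U10 * (1 + k0) * / r0).
{ intros y Hy. assert (A := U1_range y Hy). assert (B := slope_range y Hy). assert (D := inv_r_range y Hy).
  split. apply Rmult_le_pos; lra. rewrite Rmult_assoc. apply Rmult_le_compat; lra. }
assert (CS : forall X Y, X <= Y -> X * / r0 <= Y * / r0) by (intros; apply Rmult_le_compat_r; lra).
split.
- intros f Hf r. simpl in Hf. fold x in Hf. assert (C1 := U1_curve_cont). assert (C2 := U2_curve_cont).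
  assert (C3 := sound_curve_cont). assert (C4 := log_slope_curve_cont). assert (C5 := inv_x_cont). assert (C6 := frakx_cont).
  destruct Hf as [<-|[<-|[<-|[<-|[<-|[<-|[<-|[<-|[]]]]]]]]].
  + apply continuous_Rext with (fun r => U1 (x r) - 2 * / (gamma - 1) * snd_ (x r)). { intros; symmetry; apply RE. }
    apply continuous_Rminus; auto. apply continuous_Rmult; auto. apply continuous_const.
  + apply C2.
  + apply continuous_Rext with (fun r => U1 (x r) + 2 * / (gamma - 1) * snd_ (x r)). { intros; symmetry; apply RE4. }
    apply continuous_Rplus; auto. apply continuous_Rmult; auto. apply continuous_const.
  + apply continuous_Rext with (fun r => - (U1 (x r)) * (/ x r + slp (x r)) - snd_ (x r) * slp (x r)).
    { intros y. symmetry. apply Derive_on_R1. apply x_ge. }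
    apply continuous_Rminus; apply continuous_Rmult; auto. apply continuous_Ropp; auto. apply continuous_Rplus; auto.
  + apply continuous_Rext with (fun r => - (U1 (x r)) * (/ x r + slp (x r)) + snd_ (x r) * slp (x r)).
    { intros y. symmetry. apply Derive_on_R4. apply x_ge. }
    apply continuous_Rplus; apply continuous_Rmult; auto. apply continuous_Ropp; auto. apply continuous_Rplus; auto.
  + apply (is_derive_continuous _ _ _ (profile_cf_der r)).
  + apply C6.
  + apply C5.
- intros f Hf r. simpl in Hf. fold x in Hf. assert (Hx := x_ge r). rewrite coef_max_eq.
  assert (A := U1_range (x r) Hx). assert (B := S2 (x r) Hx).
  destruct Hf as [<-|[<-|[<-|[<-|[]]]]].
  + match goal with |- _ <= ?c => change (Rabs (Rbg gamma S0 rho U1 U2 i1 (x r)) <= c) end. rewrite RE. apply Rabs_le. lra.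
  + assert (Z := U2_bound (x r) Hx). lra.
  + match goal with |- _ <= ?c => change (Rabs (Rbg gamma S0 rho U1 U2 i4 (x r)) <= c) end. rewrite RE4. apply Rabs_le. lra.
  + assert (F := frak_c_init_range).
    assert (I : Rabs (RInt (fun s => cutoff r0 r1 s * frak_c_slope (x s)) r0 r) <= 3 * (r1 - r0) * (cM * k0 * / r0)).
    { apply (abs_RInt_le_weight (cutoff r0 r1)). apply weight_cutoff; auto.
      intros y. apply continuous_Rmult. apply cutoff_cont. apply frakx_cont.
      apply Rmult_le_pos; lra.
      intros s _. assert (Q := cutoff_range r0 r1 s). assert (Q2 := frak_slope_range (x s) (x_ge s)).
      rewrite Rabs_mult, !Rabs_pos_eq by lra. apply Rmult_le_compat_l; lra. }
    assert (I2 : 3 * (r1 - r0) * (cM * k0 * / r0) <= 3 * (cM * k0)).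
    { apply Rle_trans with (3 * r0 * (cM * k0 * / r0)). apply Rmult_le_compat_r; [apply Rmult_le_pos|]; lra.
      right; field; lra. }
    eapply Rle_trans. apply Rabs_triang. rewrite (Rabs_pos_eq (frak_c gamma S0 rho r0)) by lra. lra.
- intros f Hf r. simpl in Hf. fold x in Hf. assert (Hx := x_ge r).
  assert (A := UR (x r) Hx). assert (B := sound_slope_range (x r) Hx).
  assert (Tot : U10 * (1 + k0) * / r0 + cM * k0 * / r0 <= C * / r0).
  { rewrite <- Rmult_plus_distr_r. apply CS. rewrite coef_max_eq. lra. }
  destruct Hf as [<-|[<-|[<-|[]]]].
  + rewrite (Derive_on_R1 (x r) Hx). fold snd_ slp. apply Rabs_le. lra.
  + rewrite (Derive_on_R4 (x r) Hx). fold snd_ slp. apply Rabs_le. lra.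
  + assert (Q2 := frak_slope_range (x r) Hx). apply Rabs_le. lra.
- intros r. simpl. fold x. assert (H := inv_r_range (x r) (x_ge r)). rewrite Rabs_pos_eq; lra.
Qed.

Lemma speed_min_pos : 0 < speed_min gamma rho0 U10 U20 S0.
Proof.
apply Rmin_pos. apply Rmult_lt_0_compat; auto. apply exp_pos. assert (H := sound_sq_0_gt). fold c2. lra.
Qed.

(** Without perturbation the speeds are [U1 - c], [U1] and [U1 + c], all
    bounded away from 0 because the flow is subsonic. *)
Lemma background_speed i r :
  speed_min gamma rho0 U10 U20 S0 <= Rabs (speed_at gamma th background_profile i r (fun _ => 0)).
Proof.
assert (Hx := x_range r). assert (A := U1_range (x r) (proj1 Hx)). assert (B := sound_range (x r) (proj1 Hx)).
assert (D := sound_sq_0_gt).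
assert (L := U1_lower (x r) ltac:(lra)).
assert (M1 : speed_min gamma rho0 U10 U20 S0 <= U10 * exp (- (1 + k0))) by apply Rmin_l.
assert (M2 : speed_min gamma rho0 U10 U20 S0 <= sqrt c2 - U10) by apply Rmin_r.
destruct i; simpl; fold x; fold snd_.
- match goal with |- _ <= Rabs ?z => replace z with (- (snd_ (x r) - U1 (x r))) by (field; lra) end.
  rewrite Rabs_Ropp, Rabs_pos_eq; lra.
- match goal with |- _ <= Rabs ?z => replace z with (U1 (x r)) by (field; lra) end. rewrite Rabs_pos_eq; lra.
- match goal with |- _ <= Rabs ?z => replace z with (U1 (x r)) by (field; lra) end. rewrite Rabs_pos_eq; lra.
- match goal with |- _ <= Rabs ?z => replace z with (U1 (x r) + snd_ (x r)) by (field; lra) end. rewrite Rabs_pos_eq; lra.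
Qed.

End Background.

(** * Back to the physical unknowns *)

Definition physical (th nu : R) (u : idx4 -> R -> R -> R) (i : idx4) (t r : R) : R := nu / wt th i * u i r t.

Section Physical.
Context (th nu r0 r1 N : R) (chi : R -> R) (P : state).
Context (Hth : 0 < th < 1) (Hnu : 0 < nu) (Hr : r0 < r1) (HN : 0 <= N) (chi01 : forall r, 0 <= chi r <= 1) (BP : C1_bounded chi N P).

Let A := nu / th.

Lemma physical_factor i : 0 < nu / wt th i <= A.
Proof.
assert (0 < / th) by (apply Rinv_0_lt_compat; lra).
assert (1 <= / th) by (rewrite <- Rinv_1; apply Rinv_le_contravar; lra).
unfold A, Rdiv. destruct i; simpl; rewrite ?Rinv_1; split; try apply Rmult_lt_0_compat; try lra; apply Rmult_le_compat_l; lra.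
Qed.

Lemma physical_der_t i t r : is_derive (fun s => physical th nu (su P) i s r) t (physical th nu (st P) i t r).
Proof. apply (is_derive_scal (fun s => su P i r s)). apply BP. Qed.

Lemma physical_der_r i t r : is_derive (fun s => physical th nu (su P) i t s) r (physical th nu (sr P) i t r).
Proof. apply (is_derive_scal (fun s => su P i s t)). apply BP. Qed.

Lemma dt_physical i t r : 0 <= t -> dt (physical th nu (su P) i) t r = physical th nu (st P) i t r.
Proof.
intros Ht. apply Derive_on_half_line; auto. apply is_derive_on_of_is_derive; auto. apply physical_der_t.
Qed.

Lemma dr_physical i t r : r0 <= r <= r1 -> dr r0 r1 (physical th nu (su P) i) t r = physical th nu (sr P) i t r.
Proof.
intros H. apply Derive_on_unique. apply segment_limit_point; auto.
apply is_derive_on_of_is_derive; auto. apply physical_der_r.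
Qed.

Lemma physical_cont u i : cont2 (u i) -> forall p : R * R, continuous (uncurry2 (physical th nu u i)) p.
Proof.
intros Hu p. unfold uncurry2, physical.
apply (continuous_Rmult (fun _ => nu / wt th i) (fun p : R * R => u i (snd p) (fst p))). apply continuous_const. cts.
Qed.

Lemma physical_bound u i t r M : 0 <= M -> (Rabs (u i r t) <= M) -> Rabs (physical th nu u i t r) <= A * M.
Proof.
intros HM Hu. unfold physical. assert (F := physical_factor i). rewrite Rabs_mult, (Rabs_pos_eq (nu / wt th i)) by lra.
apply Rmult_le_compat; try lra. apply Rabs_pos.
Qed.

Lemma sr_bound i r t : Rabs (sr P i r t) <= N.
Proof.
eapply Rle_trans. apply BP. assert (H := chi01 r).
apply Rle_trans with (1 * N); [apply Rmult_le_compat_r; lra|lra].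
Qed.

Lemma physical_C1_on_dom i : C1_on_dom r0 r1 (physical th nu (su P) i).
Proof.
destruct BP as [B1 _]. destruct (B1 i) as [_ [_ [C1 C2]]].
split; [|split; [|split]].
- intros t r [H1 H2]. simpl in H1, H2. split.
  + exists (physical th nu (st P) i t r). apply is_derive_on_of_is_derive; auto. apply physical_der_t.
  + exists (physical th nu (sr P) i t r). apply is_derive_on_of_is_derive; auto. apply physical_der_r.
- apply continuous_on_forall. intros p _. apply physical_cont. apply (C1f_cont2 _ _ _ (B1 i)).
- apply continuous_on_ext with (uncurry2 (physical th nu (st P) i)).
  + intros [t r] [H1 H2]. unfold uncurry2. symmetry. apply dt_physical. exact H1.
  + apply continuous_on_forall. intros p _. apply physical_cont; auto.
- apply continuous_on_ext with (uncurry2 (physical th nu (sr P) i)).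
  + intros [t r] [H1 H2]. unfold uncurry2. symmetry. apply dr_physical. exact H2.
  + apply continuous_on_forall. intros p _. apply physical_cont; auto.
Qed.

Lemma physical_norm_dom i : Rbar_le (C1_norm_dom r0 r1 (physical th nu (su P) i)) (A * (2 + N)).
Proof.
unfold C1_norm_dom.
replace (Finite (A * (2 + N))) with (Rbar_plus (Finite (A * 1)) (Rbar_plus (Finite (A * 1)) (Finite (A * N)))).
2:{ simpl. f_equal. ring. }
apply Rbar_plus_le_compat; [|apply Rbar_plus_le_compat]; apply sup_norm_le; intros [t r] [H1 H2]; unfold uncurry2.
- apply physical_bound. lra. apply BP.
- simpl fst; simpl snd. rewrite dt_physical by exact H1. apply physical_bound. lra. apply BP.
- simpl fst; simpl snd. rewrite dr_physical by exact H2. apply physical_bound; auto. apply sr_bound.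
Qed.

Lemma physical_slice_C1 i : C1_on (segment r0 r1) (fun r => physical th nu (su P) i 0 r).
Proof.
destruct BP as [B1 _]. destruct (B1 i) as [_ [_ [C1 C2]]].
split; [|split].
- intros r H2. exists (physical th nu (sr P) i 0 r). apply is_derive_on_of_is_derive; auto. apply physical_der_r.
- apply continuous_on_forall. intros r _. apply (is_derive_continuous _ _ _ (physical_der_r i 0 r)).
- apply continuous_on_ext with (fun r => physical th nu (sr P) i 0 r).
  + intros r H2. symmetry. apply (dr_physical i 0 r H2).
  + apply continuous_on_forall. intros r _. unfold physical. cts.
Qed.

Lemma physical_slice_norm i : Rbar_le (C1_norm (segment r0 r1) (fun r => physical th nu (su P) i 0 r)) (A * (2 + N)).
Proof.
assert (HA : 0 < A) by (apply Rdiv_lt_0_compat; lra).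
apply Rbar_le_trans with (Rbar_plus (Finite (A * 1)) (Finite (A * N))).
2:{ simpl. lra. }
unfold C1_norm. apply Rbar_plus_le_compat; apply sup_norm_le; intros r H2.
- apply physical_bound. lra. apply BP.
- change (Rabs (dr r0 r1 (physical th nu (su P) i) 0 r) <= A * N). rewrite dr_physical by exact H2.
  apply physical_bound; auto. apply sr_bound.
Qed.

End Physical.

Lemma nonzero_of_bound l v : 0 < l -> l / 2 <= Rabs v -> v <> 0.
Proof. intros Hl H E. rewrite E, Rabs_R0 in H. lra. Qed.

(** On the segment the frozen coefficients are the original ones and the cut-off
    is 1, so multiplying the normalized equations by the speeds gives the system. *)
Lemma physical_system gamma S0 rho U1 U2 r0 r1 th nu K dmu dg H H' P l t r :
  1 < gamma -> 0 < th < 1 -> 0 < nu -> 0 < r0 -> r0 < r1 -> 0 < l -> 0 <= t -> r0 <= r <= r1 ->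
  (forall i, l / 2 <= Rabs (speed_at gamma th (background_profile gamma S0 r0 r1 rho U1 U2) i r (scaled nu (at_ (su P) r t)))) ->
  cf (background_profile gamma S0 r0 r1 rho U1 U2) r = frak_c gamma S0 rho r ->
  Derive_on (half_line r0) (frak_c gamma S0 rho) r = frak_c_slope gamma S0 rho U1 U2 r ->
  solves (cutoff r0 r1) (rescaled_data gamma th r0 r1 (background_profile gamma S0 r0 r1 rho U1 U2) (cutoff r0 r1) K nu dmu dg H H') P P ->
  (forall i t r, 0 <= t -> dt (physical th nu (su P) i) t r = physical th nu (st P) i t r) ->
  (forall i t r, r0 <= r <= r1 -> dr r0 r1 (physical th nu (su P) i) t r = physical th nu (sr P) i t r) ->
  system_P gamma r0 r1 (frak_c gamma S0 rho) (Rbg gamma S0 rho U1 U2) (physical th nu (su P)) t r.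
Proof.
intros Hg Hth Hnu Hr0 Hr1 Hl Ht Hr Hlow Ecf Ec' [HS _] Hdt Hdr.
set (B := background_profile gamma S0 r0 r1 rho U1 U2) in *.
set (D := rescaled_data gamma th r0 r1 B (cutoff r0 r1) K nu dmu dg H H') in *.
set (p := scaled nu (at_ (su P) r t)).
assert (Ex : clamp r0 r1 r = r) by (apply clamp_eq; auto).
assert (Eb1 : bg1 B r = Rbg gamma S0 rho U1 U2 i1 r) by (unfold B, background_profile; cbn [bg1]; rewrite Ex; reflexivity).
assert (Eb2 : bg2 B r = Rbg gamma S0 rho U1 U2 i2 r) by (unfold B, background_profile; cbn [bg2]; rewrite Ex; reflexivity).
assert (Eb4 : bg4 B r = Rbg gamma S0 rho U1 U2 i4 r) by (unfold B, background_profile; cbn [bg4]; rewrite Ex; reflexivity).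
assert (Eb1' : bg1' B r = Derive_on (half_line r0) (Rbg gamma S0 rho U1 U2 i1) r) by (unfold B, background_profile; cbn [bg1']; rewrite Ex; reflexivity).
assert (Eb4' : bg4' B r = Derive_on (half_line r0) (Rbg gamma S0 rho U1 U2 i4) r) by (unfold B, background_profile; cbn [bg4']; rewrite Ex; reflexivity).
assert (Ecf' : cf' B r = Derive_on (half_line r0) (frak_c gamma S0 rho) r) by (rewrite Ec'; unfold B, background_profile; cbn [cf']; rewrite Ex; reflexivity).
assert (Eri : ri B r = / r) by (unfold B, background_profile; cbn [ri]; rewrite Ex; reflexivity).
assert (Echi : cutoff r0 r1 r = 1) by (apply cutoff_one; auto).
set (lam := fun i => speed_at gamma th B i r p).
assert (Nz : forall i, lam i <> 0) by (intros i; apply (nonzero_of_bound l); auto; apply Hlow).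
assert (P1 : physical th nu (su P) i1 t r = p i1 / th) by (unfold physical, p, scaled, at_; simpl; field; lra).
assert (P2 : physical th nu (su P) i2 t r = p i2) by (unfold physical, p, scaled, at_; simpl; field; lra).
assert (P3 : physical th nu (su P) i3 t r = p i3) by (unfold physical, p, scaled, at_; simpl; field; lra).
assert (P4 : physical th nu (su P) i4 t r = p i4) by (unfold physical, p, scaled, at_; simpl; field; lra).
assert (El : forall i, lambda gamma (frak_c gamma S0 rho) (Rbg gamma S0 rho U1 U2) (physical th nu (su P)) i t r = lam i).
{ intros i. unfold lambda, lam, speed_at. rewrite P1, P3, P4, Ecf, Eb1, Eb4. destruct i; reflexivity. }
(* the normalized equation times [nu lam_i / wt_i] *)
set (tr := fun j i => physical th nu (st P) i t r + lam j * physical th nu (sr P) i t r).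
assert (Main : forall i, tr i i + / wt th i * mcoef D P i r t * tr i i3 = source_at gamma th B i r p).
{ intros i. assert (E := HS i r t). unfold spd in E. 
  change (d_mu D i r (at_ (su P) r t)) with (/ lam i) in E.
  change (d_g D i r (at_ (su P) r t)) with (reduced_source gamma th B i r p / nu) in E.
  unfold reduced_source in E. fold (lam i) in E. rewrite Echi in E.
  assert (Hw : wt th i <> 0) by (destruct i; simpl; lra).
  assert (Nzi := Nz i).
  transitivity (nu / wt th i * lam i * (1 * (wt th i * (/ lam i * source_at gamma th B i r p) / nu))).
  2:{ field. repeat split; auto; lra. }
  rewrite <- E. unfold tr, physical. change (wt th i3) with 1. field. repeat split; auto; lra. }
unfold system_P. cbv zeta. rewrite !El.
rewrite !Hdt, !Hdr by auto.
fold (tr i1 i1) (tr i1 i3) (tr i2 i2) (tr i3 i3) (tr i4 i4) (tr i4 i3).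
assert (M1 : / wt th i1 * mcoef D P i1 r t = (p i4 - p i1 / th) / (4 * gamma) + (gamma - 1) * frak_c gamma S0 rho r * p i3 / 2).
{ unfold mcoef, sum4. change (d_c D) with (coupling gamma th B nu). cbn [coupling wt]. rewrite Ecf. unfold p, scaled, at_. field. lra. }
assert (M4 : / wt th i4 * mcoef D P i4 r t = - ((p i4 - p i1 / th) / (4 * gamma) + (gamma - 1) * frak_c gamma S0 rho r * p i3 / 2)).
{ unfold mcoef, sum4. change (d_c D) with (coupling gamma th B nu). cbn [coupling wt]. rewrite Ecf. unfold p, scaled, at_. field. lra. }
assert (M2 : mcoef D P i2 r t = 0) by (unfold mcoef, sum4; change (d_c D) with (coupling gamma th B nu); cbn [coupling]; ring).
assert (M3 : mcoef D P i3 r t = 0) by (unfold mcoef, sum4; change (d_c D) with (coupling gamma th B nu); cbn [coupling]; ring).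
assert (Q1 := Main i1). assert (Q2 := Main i2). assert (Q3 := Main i3). assert (Q4 := Main i4).
rewrite M1 in Q1. rewrite M2 in Q2. rewrite M3 in Q3. rewrite M4 in Q4.
rewrite !P1, !P2, !P3, !P4.
unfold source_at in Q1, Q2, Q3, Q4. cbv zeta in Q1, Q2, Q3, Q4.
fold (lam i1) in Q1. fold (lam i2) in Q2. fold (lam i4) in Q4.
rewrite Eb1, Eb2, Eb4, Eb1', Ecf', Ecf, Eri in Q1. rewrite Eri in Q2. rewrite Eb1, Eb2, Eb4, Eb4', Ecf', Ecf, Eri in Q4.
repeat split.
- match type of Q1 with ?a + ?b = ?c => transitivity (c - b); [lra|] end. field; repeat split; lra.
- match type of Q2 with ?a + ?b = ?c => transitivity (c - b); [lra|] end. field; repeat split; simpl; lra.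
- match type of Q3 with ?a + ?b = ?c => transitivity (c - b); [lra|] end. ring.
- match type of Q4 with ?a + ?b = ?c => transitivity (c - b); [lra|] end. field; repeat split; lra.
Qed.

Theorem theorem1p2 :
  forall gamma rho0 U10 U20 S0 K2 K3 K4 : R,
  1 < gamma -> 0 < rho0 -> 0 < U10 -> 0 < U20 -> 0 < S0 ->
  U10 ^ 2 + U20 ^ 2 < gamma * exp S0 * Rpower rho0 (gamma - 1) ->
  Rabs K2 < 1 -> Rabs K3 < 1 -> Rabs K4 < 1 ->
  exists xi0 : R, 0 < xi0 /\
  forall (r0 T : R) (rho U1 U2 Sb : R -> R),
  0 < r0 -> 0 < T ->
  background_flow gamma rho0 U10 U20 S0 r0 rho U1 U2 Sb ->
  forall r1 : R, r0 < r1 < r0 * (1 + xi0) ->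
  exists sigma1 C1 : R, 0 < sigma1 /\ 0 < C1 /\
  forall (sigma : R) (H : idx4 -> R -> R),
  0 < sigma < sigma1 ->
  (forall i, C1_on (half_line 0) (H i)) ->
  (forall i t, 0 < t -> H i (t + T) = H i t) ->
  (forall i, Rbar_le (C1_norm (half_line 0) (H i)) sigma) ->
  exists Psi0 : idx4 -> R -> R,
    (forall i, C1_on (segment r0 r1) (Psi0 i)) /\
    (forall i, Rbar_le (C1_norm (segment r0 r1) (Psi0 i)) (C1 * sigma)) /\
    exists Psi : idx4 -> R -> R -> R,
      (forall i, C1_on_dom r0 r1 (Psi i)) /\
      (forall t r, 0 <= t -> r0 <= r <= r1 ->
         system_P gamma r0 r1 (frak_c gamma S0 rho) (Rbg gamma S0 rho U1 U2)
           Psi t r) /\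
      (forall t, 0 <= t -> boundary_B K2 K3 K4 r0 r1 H Psi t) /\
      (forall i r, r0 <= r <= r1 -> Psi i 0 r = Psi0 i r) /\
      (forall i t r, 0 <= t -> r0 <= r <= r1 -> Psi i (t + T) r = Psi i t r) /\
      (forall i, Rbar_le (C1_norm_dom r0 r1 (Psi i)) (C1 * sigma)).
Proof.
intros gamma rho0 U10 U20 S0 K2 K3 K4 Hgam Hrho0 HU10 HU20 HS0 Hsub HK2 HK3 HK4.
set (Km := Rmax (Rabs K2) (Rmax (Rabs K3) (Rabs K4))).
assert (Km1 : 0 <= Km < 1).
{ split. apply Rle_trans with (Rabs K2). apply Rabs_pos. apply Rmax_l. repeat apply Rmax_lub_lt; auto. }
(* [Km <= th^2] because [th^2 - Km = (1 - Km)^2 / 4] *)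
set (th := (1 + Km) / 2).
assert (Hth : 0 < th < 1) by (unfold th; lra).
assert (Kth : Km <= th * th) by (unfold th; nra).
set (K := fun i => match i with i1 => 0 | i2 => K2 | i3 => K3 | i4 => K4 end).
assert (HK : forall i, Rabs (K i) <= th * th).
{ assert (A2 : Rabs K2 <= Km) by apply Rmax_l.
  assert (A3 : Rabs K3 <= Km) by (eapply Rle_trans; [apply Rmax_l|apply Rmax_r]).
  assert (A4 : Rabs K4 <= Km) by (eapply Rle_trans; [apply Rmax_r|apply Rmax_r]).
  intros [ | | | ]; simpl; rewrite ?Rabs_R0; lra. }
set (C := coef_max gamma rho0 U10 U20 S0 th). set (l0 := speed_min gamma rho0 U10 U20 S0).
set (Ks := 40 * (C * C * C * C * C) / l0).
(* [xi0] makes the zero-order terms, of size 1/r0 on a segment of length at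
   most [xi0 r0], smaller than the loss at the boundary *)
exists (Rmin 1 ((1 - th) / (12 * (Rabs Ks + 1)))).
assert (Ks0 := Rabs_pos Ks).
split. { apply Rmin_pos. lra. apply Rdiv_lt_0_compat; lra. }
intros r0 T rho U1 U2 Sb Hr0 HT HBF r1 [Hr1 Hr1'].
set (xi := Rmin 1 ((1 - th) / (12 * (Rabs Ks + 1)))) in *.
assert (xi1 : xi <= 1) by apply Rmin_l.
assert (xi2 : xi <= (1 - th) / (12 * (Rabs Ks + 1))) by apply Rmin_r.
assert (Hxi : r0 * xi <= r0 * 1) by (apply Rmult_le_compat_l; lra).
assert (Hr2 : r1 <= 2 * r0) by lra.
set (B := background_profile gamma S0 r0 r1 rho U1 U2).
set (chi := cutoff r0 r1).
destruct (coef_max_range gamma rho0 U10 U20 S0 r0 rho U1 U2 Sb) with (th := th) as [HC1 [HCg HCth]]; auto.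
fold C in HC1, HCg, HCth.
assert (Hl0 : 0 < l0) by (apply (speed_min_pos gamma rho0 U10 U20 S0); auto).
assert (HW := weight_cutoff r0 r1 Hr1).
assert (Hshort : 3 * (r1 - r0) * (40 * (C * C * C * C * C) / l0 * / r0) <= (1 - th) / 4).
{ fold Ks. assert (HKs : Ks <= Rabs Ks + 1) by (assert (Z := Rle_abs Ks); lra).
  apply Rle_trans with (3 * (r0 * xi) * ((Rabs Ks + 1) * / r0)).
  - apply Rmult_le_compat; try lra.
    + apply Rmult_le_pos. unfold Ks. apply Rdiv_le_0_compat; auto. repeat apply Rmult_le_pos; lra.
      left; apply Rinv_0_lt_compat; auto.
    + apply Rmult_le_compat_r; auto. left; apply Rinv_0_lt_compat; auto.
  - replace (3 * (r0 * xi) * ((Rabs Ks + 1) * / r0)) with (3 * (Rabs Ks + 1) * xi) by (field; lra).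
    apply Rle_trans with (3 * (Rabs Ks + 1) * ((1 - th) / (12 * (Rabs Ks + 1)))).
    apply Rmult_le_compat_l; lra. right; field; lra. }
destruct (rescaled_solution gamma th r0 r1 B chi K C (/ r0) l0 (3 * (r1 - r0))) as [nu0 [N [Hnu0 [HN HSol]]]]; auto.
{ apply Rinv_0_lt_compat; auto. }
{ apply (background_bounds gamma rho0 U10 U20 S0 r0 r1 rho U1 U2 Sb); auto. }
{ intros i r. apply (background_speed gamma rho0 U10 U20 S0 r0 r1 rho U1 U2 Sb); auto. }
{ intros r; apply cutoff_range. }
{ intros r. apply (profile_cf_der gamma rho0 U10 U20 S0 r0 r1 rho U1 U2 Sb); auto. }
(* the boundary data may fill a quarter of the gap [1 - th] left by the
   reflections, so data of size [sigma] are rescaled by [sigma / eta] *)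
set (eta := (1 - th) / 4) in *. assert (Heta : 0 < eta) by (unfold eta; lra).
exists (nu0 * eta), ((2 + N) / (th * eta)).
split. { apply Rmult_lt_0_compat; lra. }
split. { apply Rdiv_lt_0_compat. lra. apply Rmult_lt_0_compat; lra. }
intros sigma H [Hs0 Hs1] HC HP HNm.
set (nu := sigma / eta). assert (Hnu : 0 < nu) by (apply Rdiv_lt_0_compat; auto).
assert (Enu : eta * nu = sigma) by (unfold nu; field; lra).
assert (Hnu1 : nu <= nu0).
{ apply Rmult_le_reg_l with eta; auto. rewrite Enu. lra. }
assert (HB : forall i t, 0 <= t -> Rabs (H i t) <= sigma /\ Rabs (Derive_on (half_line 0) (H i) t) <= sigma).
{ intros i. apply (C1_norm_bounds (half_line 0) (H i) sigma 0); auto. unfold half_line; lra. }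
set (HE := fun i => periodic_ext (H i) T).
set (HE' := fun i => Derive (HE i)).
assert (PE : forall i, _) by (intros i; exact (periodic_ext_C1 (H i) T sigma HT (HC i) (HP i) (fun t Ht => proj1 (HB i t Ht)) (fun t Ht => proj2 (HB i t Ht)))).
destruct (HSol nu HE HE') as [dmu [dg [P [BP [SP PP]]]]].
{ lra. }
{ intros i t. apply (PE i). }
{ intros i t. apply (PE i). }
{ intros i t. rewrite Enu. apply (PE i). }
{ intros i t. rewrite Enu. apply (PE i). }
{ intros e He.
  assert (Q : forall i, exists b, 0 <= b /\ forall t t', Rabs (HE' i t - HE' i t') <= e + b * Rabs (t - t')).
  { intros i. apply (periodic_affine_modulus (HE' i) T sigma); auto; apply (PE i). }
  destruct (exists_for_idx4 _ Q) as [b Hb]. exists (sum4 b).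
  intros i t t'. eapply Rle_trans. apply (proj2 (Hb i)). apply Rplus_le_compat_l.
  apply Rmult_le_compat_r. apply Rabs_pos. apply abs_le_sum4. intros j; apply (Hb j). }
assert (chi01 : forall r, 0 <= chi r <= 1) by (intros; apply cutoff_range).
assert (Cst : (2 + N) / (th * eta) * sigma = nu / th * (2 + N)).
{ rewrite <- Enu. field. lra. }
assert (DT : forall i t r, 0 <= t -> dt (physical th nu (su P) i) t r = physical th nu (st P) i t r).
{ intros. apply (dt_physical th nu N chi P BP); auto. }
assert (DR : forall i t r, r0 <= r <= r1 -> dr r0 r1 (physical th nu (su P) i) t r = physical th nu (sr P) i t r).
{ intros. apply (dr_physical th nu r0 r1 N chi P); auto. }
exists (fun i r => physical th nu (su P) i 0 r).
split. { intros i. apply (physical_slice_C1 th nu r0 r1 N chi P); auto. }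
split. { intros i. rewrite Cst. apply (physical_slice_norm th nu r0 r1 N chi P); auto. }
exists (physical th nu (su P)).
split. { intros i. apply (physical_C1_on_dom th nu r0 r1 N chi P); auto. }
split; [|split; [|split; [|split]]].
- intros t r Ht Hr.
  apply (physical_system gamma S0 rho U1 U2 r0 r1 th nu K dmu dg HE HE' P l0 t r); auto.
  + intros i. apply (speed_lower gamma th B C (/ r0) l0); auto.
    apply (background_bounds gamma rho0 U10 U20 S0 r0 r1 rho U1 U2 Sb); auto.
    intros i' r'. apply (background_speed gamma rho0 U10 U20 S0 r0 r1 rho U1 U2 Sb); auto.
    apply cube_scaled; try lra. intros j. apply BP.
  + apply (profile_cf_eq gamma rho0 U10 U20 S0 r0 r1 rho U1 U2 Sb); auto.
  + apply (Derive_on_frak_c gamma rho0 U10 U20 S0 r0 rho U1 U2 Sb); auto. lra.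
- intros t Ht. destruct SP as [_ BC].
  assert (EH : forall i, HE i t = H i t).
  { intros i. apply (periodic_ext_eq (H i) T sigma HT (HC i) (HP i) (fun t Ht => proj1 (HB i t Ht)) (fun t Ht => proj2 (HB i t Ht)) t Ht). }
  assert (b1 := BC i1 t). assert (b2 := BC i2 t). assert (b3 := BC i3 t). assert (b4 := BC i4 t).
  simpl in b1, b2, b3, b4. rewrite EH in b1, b2, b3, b4.
  unfold boundary_B, physical. simpl. rewrite b1, b2, b3, b4.
  repeat split; field; lra.
- reflexivity.
- intros i t r Ht Hr. unfold physical. rewrite (PP T); auto.
  intros i' t'. apply periodic_ext_periodic; auto.
- intros i. rewrite Cst. apply (physical_norm_dom th nu r0 r1 N chi P); auto.
Qed.
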